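(* The problem $\mathsf{QBSF}$ is in $\mathrm{AEXP}(\mathrm{poly})$.
   Context: Quantified Boolean second-order formulas (qbsfs): the constants $0,1$ are qbsfs; if $f^n$ is a function variable of arity $n \ge 0$ and $\varphi_1,\ldots,\varphi_n$ are qbsfs, then $f^n(\varphi_1,\ldots,\varphi_n)$, $\varphi_1 \land \varphi_2$, $\neg\varphi_1$ and $\exists f^n \varphi_1$ are qbsfs ($\lor,\to,\leftrightarrow,\forall$ are the usual abbreviations). An interpretation $\mathcal I$ maps function variables $f^n$ to Boolean functions $\{0,1\}^n\to\{0,1\}$; the value of a formula is defined as usual, with $f^n(\varphi_1,\ldots,\varphi_n)$ evaluating to $\mathcal I(f^n)$ applied to the values of the $\varphi_i$, and $\exists f^n\varphi$ true iff $\varphi$ is true for some choice of Boolean function $F\colon\{0,1\}^n\to\{0,1\}$ for $f^n$. $\mathsf{QBSF}$ is the set of all qbsfs satisfied by the empty interpretation (i.e. closed true qbsfs). For $g(n)\ge1$, $\mathrm{ATIME}^{\Sigma}(t,g)$ is the class of problems decided by an alternating Turing machine starting in an existential state in time $O(t(n))$ with at most $g(n)$ alternations (counting the initial configuration as the first); $\mathrm{AEXP}(\mathrm{poly}) = \bigcup_{t \in 2^{n^{O(1)}},\, p \in n^{O(1)}} \mathrm{ATIME}^{\Sigma}(t,p)$. *)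

(* Defs.v *)
From mathcomp Require Import all_boot.
From mathcomp Require Import ssralg ssrint.
From Stdlib Require Import BinNat ClassicalEpsilon.

Set Implicit Arguments.
Unset Strict Implicit.
Unset Printing Implicit Defensive.

(* A function variable f^n is identified by its arity n and an index i.     *)

Inductive qbsf : Type :=
| QConst : bool -> qbsf
| QApp   : nat -> nat -> list qbsf -> qbsf
| QAnd   : qbsf -> qbsf -> qbsf
| QNot   : qbsf -> qbsf
| QEx    : nat -> nat -> qbsf -> qbsf.

Fixpoint qwf (phi : qbsf) : bool :=
  match phi with
  | QConst _ => true
  | QApp n _ args => (size args == n) && all qwf args
  | QAnd a b => qwf a && qwf b
  | QNot a => qwf a
  | QEx _ _ a => qwf a
  end.

Fixpoint qclosed_in (bnd : seq (nat * nat)) (phi : qbsf) : bool :=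
  match phi with
  | QConst _ => true
  | QApp n i args => ((n, i) \in bnd) && all (qclosed_in bnd) args
  | QAnd a b => qclosed_in bnd a && qclosed_in bnd b
  | QNot a => qclosed_in bnd a
  | QEx n i a => qclosed_in ((n, i) :: bnd) a
  end.

(* An interpretation maps f^n_i to a Boolean function {0,1}^n -> {0,1},
   represented as a function on bit lists (only lists of length n matter). *)
Definition interp := nat -> nat -> seq bool -> bool.

Definition upd (I : interp) (n i : nat) (F : seq bool -> bool) : interp :=
  fun n' i' => if (n' == n) && (i' == i) then F else I n' i'.

Definition pbool (P : Prop) : bool :=
  if excluded_middle_informative P then true else false.

Fixpoint qeval (I : interp) (phi : qbsf) : bool :=
  match phi with
  | QConst b => b
  | QApp n i args => I n i (map (qeval I) args)
  | QAnd a b => qeval I a && qeval I b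
  | QNot a => ~~ qeval I a
  | QEx n i a => pbool (exists F : seq bool -> bool, qeval (upd I n i F) a = true)
  end.

(* the empty interpretation: only relevant on closed formulas *)
Definition empty_interp : interp := fun _ _ _ => false.

Definition QBSF (phi : qbsf) : Prop :=
  qwf phi /\ qclosed_in [::] phi /\ qeval empty_interp phi = true.

Inductive sym : Type :=
| SZero | SOne | SF | SLP | SRP | SComma | SAnd | SNot | SEx | SB0 | SB1.

Fixpoint pos_bits (p : positive) : seq sym :=
  match p with
  | xH => [:: SB1]
  | xO q => pos_bits q ++ [:: SB0]
  | xI q => pos_bits q ++ [:: SB1]
  end.

Definition bin (n : nat) : seq sym :=
  match N.of_nat n with
  | N0 => [:: SB0]
  | Npos p => pos_bits p
  end.

Definition enc_var (n i : nat) : seq sym := SF :: bin n ++ SComma :: bin i.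

Fixpoint sep_comma (l : seq (seq sym)) : seq sym :=
  match l with
  | [::] => [::]
  | [:: w] => w
  | w :: l' => w ++ SComma :: sep_comma l'
  end.

Fixpoint enc (phi : qbsf) : seq sym :=
  match phi with
  | QConst b => if b then [:: SOne] else [:: SZero]
  | QApp n i args => enc_var n i ++ SLP :: sep_comma (map enc args) ++ [:: SRP]
  | QAnd a b => SLP :: enc a ++ SAnd :: enc b ++ [:: SRP]
  | QNot a => SNot :: enc a
  | QEx n i a => SEx :: enc_var n i ++ SLP :: enc a ++ [:: SRP]
  end.

Definition QBSF_lang (w : seq sym) : Prop :=
  exists phi, w = enc phi /\ QBSF phi.

Inductive stkind : Type := KEx | KUn | KAcc | KRej.

Definition stkind_eqb (a b : stkind) : bool :=
  match a, b with
  | KEx, KEx | KUn, KUn | KAcc, KAcc | KRej, KRej => true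
  | _, _ => false
  end.

Inductive move : Type := MLeft | MRight | MStay.

Record ATM : Type := {
  atm_state : finType;
  atm_gam   : finType;
  atm_inp   : sym -> atm_gam;
  atm_blank : atm_gam;
  atm_start : atm_state;
  atm_kind  : atm_state -> stkind;
  atm_delta : atm_state -> atm_gam -> list (atm_state * atm_gam * move)
}.

Record config (M : ATM) : Type := Config {
  c_state : atm_state M;
  c_tape  : int -> atm_gam M;
  c_head  : int
}.

Definition step (M : ATM) (c : config M) (tr : atm_state M * atm_gam M * move)
  : config M :=
  let: (q', g', mv) := tr in
  Config q'
    (fun z => if z == c_head c then g' else c_tape c z)
    (match mv with
     | MLeft => (c_head c - 1)%R
     | MRight => (c_head c + 1)%R
     | MStay => c_head c
     end).

Definition trans (M : ATM) (c : config M) :=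
  atm_delta (c_state c) (c_tape c (c_head c)).

Definition init_config (M : ATM) (w : seq sym) : config M :=
  Config (atm_start M)
    (fun z => match z with
              | Posz k => if k < size w then atm_inp M (nth SZero w k)
                          else atm_blank M
              | Negz _ => atm_blank M
              end)
    0%R.

(* [bounded M T a c]: every computation path from c halts (reaches an
   accepting/rejecting state) within T steps, and the sequence of existential /
   universal states along every path consists of at most a maximal blocks
   (alternations counted with the first configuration as the first one). *)
Fixpoint bounded (M : ATM) (T a : nat) (c : config M) : Prop :=
  match atm_kind (c_state c) with
  | KAcc | KRej => True
  | _ =>
    1 <= a /\
    match T with
    | 0 => False
    | T'.+1 =>
      forall tr, List.In tr (trans c) ->
        let c' := step c tr in
        bounded T'
          (if stkind_eqb (atm_kind (c_state c')) (atm_kind (c_state c))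
           then a else a.-1) c'
    end
  end.

Fixpoint accepts (M : ATM) (T : nat) (c : config M) : Prop :=
  match atm_kind (c_state c) with
  | KAcc => True
  | KRej => False
  | KEx => match T with
           | 0 => False
           | T'.+1 => exists tr, List.In tr (trans c) /\ accepts T' (step c tr)
           end
  | KUn => match T with
           | 0 => False
           | T'.+1 => forall tr, List.In tr (trans c) -> accepts T' (step c tr)
           end
  end.

Definition ATIME_Sigma (t g : nat -> nat) (L : seq sym -> Prop) : Prop :=
  exists (M : ATM) (C : nat),
    atm_kind (atm_start M) = KEx /\
    forall w : seq sym,
      let T := C * t (size w) + C in
      bounded T (g (size w)) (init_config M w) /\
      (accepts T (init_config M w) <-> L w).

(* AEXP(poly) = union over t in 2^{n^O(1)} and p in n^O(1) of ATIME^Sigma(t,p) *)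
Definition AEXP_poly (L : seq sym -> Prop) : Prop :=
  exists k : nat, ATIME_Sigma (fun n => 2 ^ (n ^ k)) (fun n => n ^ k + k) L.

(* Main.v *)
Require Import Defs.
From Stdlib Require Import NArith PArith ClassicalEpsilon FunctionalExtensionality.
From HB Require Import structures.
From mathcomp Require Import all_boot.
From mathcomp Require Import ssralg ssrint zify.

(* Acceptance is a game in which the existential player defends claims of the
   form "this part of the input is a well formed formula, closed in the current
   scope, and its value is v".  He names the outermost connective, the extent of
   the immediate subformulas and their values, all by relabelling the input; the
   universal player then challenges one of the subformulas.  Hence no parsing,
   no stack and no recursion are needed, and the number of rounds is at most the
   length N of the input.  A quantifier makes the existential player (claimed
   value 1) or the universal player (claimed value 0) append a table of 2^N bits
   to the tape; if the arity exceeds N, then the variable is never applied, and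
   the table is harmless.  An application f(a_1, ..., a_n) can also be challenged
   on its arity or on the value of f, which is read off the table by halving:
   for each argument, every second surviving bit of each table is erased.

   All phases are left to right sweeps of a letter-to-letter transducer that may
   append one letter at the end.  An alternating machine simulates the sweeps,
   so time and alternations are bounded by potentials of the sweeps. *)

Set Implicit Arguments.
Unset Strict Implicit.
Unset Printing Implicit Defensive.

(** * Sweep machines *)

(** A claim bundles well-formedness, closedness and value, so a parse needs no test of its own: if
    all its parts can be defended, they assemble to a formula with the given encoding. For this
    reason a conjunct must be defended even if the other one is already false. Unique readability
    enters in one place: under a quantifier of claimed value 0 the formula witnessing the claim
    could vary with the table, which injectivity of [enc] excludes. Tables have 2^N bits whatever
    the arity, because an arity is written in binary and may be exponential in N. This length is
    also easy to measure, by a binary counter of N bits kept on the text cells themselves.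
    Alternations stay linear in N: each round takes the segment label from at least one text cell
    and costs at most two changes of player, while the arity check and the lookup are purely
    existential and end the play. The time is the number of sweeps times the tape length. Both are
    of order N 2^N, and the product is absorbed by 2^(N^k). *)

Fixpoint run (S G : Type) (d : S -> G -> list (S * G)) (q : S) (u : seq G)
    (q' : S) (u' : seq G) : Prop :=
  match u with
  | [::] => q' = q /\ u' = [::]
  | g :: w => exists q1 g' w',
      [/\ List.In (q1, g') (d q g), run d q1 w q' w' & u' = g' :: w']
  end.

Lemma run_size (S G : Type) (d : S -> G -> list (S * G)) q u q' u' :
  run d q u q' u' -> size u' = size u.
Proof.
elim: u q q' u' => [|g u IH] q q' u' /=; first by case=> _ ->.
by case=> q1 [g' [w' [_ /IH H ->]]] /=; rewrite H.
Qed.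

Definition oseq (G : Type) (o : option G) : seq G :=
  if o is Some g then [:: g] else [::].

(** [sw_kindP] keeps the kind fixed within a sweep, so that a whole sweep acts as one existential or
    universal choice. Only [sw_fin] can change the kind, and only it can append a cell. *)
Record sweeper : Type := Sweeper {
  sw_state : finType;
  sw_cell : finType;
  sw_kind : sw_state -> stkind;
  sw_delta : sw_state -> sw_cell -> list (sw_state * sw_cell);
  sw_fin : sw_state -> list (sw_state * option sw_cell);
  sw_kindP : forall q g q' g', List.In (q', g') (sw_delta q g) ->
    sw_kind q' = sw_kind q
}.

Section Sweeps.
Context (S : sweeper).
Notation Q := (sw_state S).
Notation G := (sw_cell S).
Implicit Types (q : Q) (g : G) (u : seq G).

Definition swp q u q' u' : Prop := exists q1 v o,
  [/\ run (@sw_delta S) q u q1 v, List.In (q', o) (sw_fin q1) & u' = v ++ oseq o].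

Lemma swp_nil q q' u' : swp q [::] q' u' <->
  exists o, List.In (q', o) (sw_fin q) /\ u' = oseq o.
Proof.
split; first by case=> q1 [v [o [[-> ->] H ->]]]; exists o.
by case=> o [H ->]; exists q, [::], o.
Qed.

Lemma swp_cons q g u q' u' : swp q (g :: u) q' u' <->
  exists q1 g' w', [/\ List.In (q1, g') (sw_delta q g), swp q1 u q' w' & u' = g' :: w'].
Proof.
split.
- case=> q2 [v [o [[q1 [g' [w' [H1 H2 ->]]]] H3 ->]]].
  by exists q1, g', (w' ++ oseq o); split=> //; exists q2, w', o.
- case=> q1 [g' [w' [H1 [q2 [v [o [H2 H3 ->]]]] ->]]].
  by exists q2, (g' :: v), o; split=> //; exists q1, g', v.
Qed.

Fixpoint sbnd (n a : nat) q u : Prop :=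
  match sw_kind q with
  | KAcc | KRej => True
  | _ => 1 <= a /\
    match n with
    | 0 => False
    | n'.+1 => forall q' u', swp q u q' u' ->
       sbnd n' (if stkind_eqb (sw_kind q') (sw_kind q) then a else a.-1) q' u'
    end
  end.

(** Acceptance without a clock, as a least fixed point. A universal state without outcomes is won,
    an existential one is lost. *)
Inductive win : Q -> seq G -> Prop :=
| WinAcc q u : sw_kind q = KAcc -> win q u
| WinEx q u q' u' : sw_kind q = KEx -> swp q u q' u' -> win q' u' -> win q u
| WinUn q u : sw_kind q = KUn -> (forall q' u', swp q u q' u' -> win q' u') -> win q u.

Definition kquant (k : stkind) (R P : Q -> seq G -> Prop) : Prop :=
  match k with
  | KEx => exists q' u', R q' u' /\ P q' u'
  | KUn => forall q' u', R q' u' -> P q' u'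
  | KAcc => True
  | KRej => False
  end.

Lemma winE q u : win q u <-> kquant (sw_kind q) (swp q u) win.
Proof.
split.
- by case=> {q u} [q u -> | q u q' u' -> H1 H2 | q u -> H] //=; exists q', u'.
- case E: (sw_kind q) => //=.
  + by case=> q' [u' [H1 H2]]; apply: WinEx H1 H2.
  + exact: WinUn.
  + by move=> _; apply: WinAcc.
Qed.

(** * Simulation of sweeps by an alternating Turing machine *)

Definition tape_of u (z : int) : option G :=
  if z is Posz k then nth None (map Some u) k else None.

Lemma tape_of_at pre g rest :
  tape_of (pre ++ g :: rest) (Posz (size pre)) = Some g.
Proof. by rewrite /= map_cat nth_cat size_map ltnn subnn. Qed.

Lemma tape_of_end u : tape_of u (Posz (size u)) = None.
Proof. by rewrite /= nth_default ?size_map. Qed.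

Lemma tape_of_write pre g g' rest :
  (fun z : int => if z == Posz (size pre) then Some g' else tape_of (pre ++ g :: rest) z)
  = tape_of (pre ++ g' :: rest).
Proof.
apply: functional_extensionality => -[k|k] //=.
rewrite !map_cat !nth_cat size_map eqz_nat.
case: ltngtP => //= [lt|->]; last by rewrite subnn.
by case: (k - size pre) (subn_gt0 (size pre) k) => //=; rewrite lt.
Qed.

Lemma tape_of_append u o :
  (fun z : int => if z == Posz (size u) then o else tape_of u z)
  = tape_of (u ++ oseq o).
Proof.
apply: functional_extensionality => -[k|k] //=.
rewrite map_cat nth_cat size_map eqz_nat.
case: ltngtP => //= [lt|->]; last by rewrite subnn; case: o.
rewrite nth_default ?size_map ?(ltnW lt) // nth_default //.
by case: o => [g|] //=; rewrite subn_gt0.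
Qed.

Lemma tape_of_id u (z : int) : (fun z' : int => if z' == z then tape_of u z else tape_of u z')
  = tape_of u.
Proof. by apply: functional_extensionality => z'; case: eqP => [->|]. Qed.

Context (inp : sym -> G) (q0 : Q).

(** The boolean is true on the way right and false while rewinding. The blank [None] marks both
    ends: on the right it may be overwritten by the appended cell, on the left it stands at position
    -1 and turns the head round. *)
Definition sweep_delta (s : Q * bool) (og : option G)
    : list ((Q * bool) * option G * move) :=
  match s.2, og with
  | true, Some g => List.map (fun p => ((p.1, true), Some p.2, MRight)) (sw_delta s.1 g)
  | true, None => List.map (fun p => ((p.1, false), p.2, MLeft)) (sw_fin s.1)
  | false, Some g => [:: ((s.1, false), Some g, MLeft)]
  | false, None => [:: ((s.1, true), None, MRight)]
  end.

Definition sweep_atm : ATM :=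
  {| atm_state := (Q * bool)%type;
     atm_gam := option G;
     atm_inp := fun s => Some (inp s);
     atm_blank := None;
     atm_start := (q0, true);
     atm_kind := fun s => sw_kind s.1;
     atm_delta := sweep_delta |}.

Definition fwd q pre rest : config sweep_atm :=
  @Config sweep_atm (q, true) (tape_of (pre ++ rest)) (Posz (size pre)).

(** With the head at [h - 1], exactly [h] cells remain to be crossed, and [h = 0] is the blank at
    position -1. *)
Definition back q u h : config sweep_atm :=
  @Config sweep_atm (q, false) (tape_of u) (Posz h - 1)%R.

Lemma init_configE w : init_config sweep_atm w = fwd q0 [::] (map inp w).
Proof.
rewrite /init_config /fwd; congr (@Config _ _ _ _).
apply: functional_extensionality => -[k|k] //=.
case: ltnP => h; first by rewrite (nth_map (inp SZero)) ?size_map // (nth_map SZero).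
by rewrite nth_default // !size_map.
Qed.

Lemma trans_fwd_cons q pre g rest : trans (fwd q pre (g :: rest)) =
  List.map (fun p => ((p.1, true), Some p.2, MRight)) (sw_delta q g).
Proof. by rewrite /trans -[c_tape _ _]/(tape_of _ _) tape_of_at. Qed.

Lemma step_fwd_cons q pre g rest q' g' :
  step (fwd q pre (g :: rest)) ((q', true), Some g', MRight) = fwd q' (rcons pre g') rest.
Proof.
rewrite /step /= /fwd; congr (@Config _ _ _ _).
- by rewrite tape_of_write cat_rcons.
- by rewrite size_rcons -addn1 PoszD.
Qed.

Lemma trans_fwd_nil q pre : trans (fwd q pre [::]) =
  List.map (fun p => ((p.1, false), p.2, MLeft)) (sw_fin q).
Proof. by rewrite /trans -[c_tape _ _]/(tape_of _ _) cats0 tape_of_end. Qed.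

Lemma step_fwd_nil q pre q' o :
  step (fwd q pre [::]) ((q', false), o, MLeft) = back q' (pre ++ oseq o) (size pre).
Proof. by rewrite /step /= /back; congr (@Config _ _ _ _); rewrite cats0 tape_of_append. Qed.

Lemma trans_back0 q u : trans (back q u 0) = [:: ((q, true), None, MRight)].
Proof. by []. Qed.

Lemma step_back0 q u :
  step (back q u 0) ((q, true), None, MRight) = fwd q [::] u.
Proof.
rewrite /step /= /fwd; congr (@Config _ _ _ _).
exact: (tape_of_id u (Negz 0)).
Qed.

Lemma Posz_pred h : (Posz h.+1 - 1)%R = Posz h.
Proof. by rewrite -addn1 PoszD GRing.addrK. Qed.

Lemma tape_of_lt u h : h < size u -> exists g, tape_of u (Posz h) = Some g.
Proof.
case: u => // g u lt; exists (nth g (g :: u) h).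
by rewrite /tape_of (nth_map g).
Qed.

Lemma back_step q u h : h < size u ->
  exists g, trans (back q u h.+1) = [:: ((q, false), Some g, MLeft)] /\
    step (back q u h.+1) ((q, false), Some g, MLeft) = back q u h.
Proof.
move=> /tape_of_lt [g E]; exists g; split.
  by rewrite /trans -[c_tape _ _]/(tape_of _ _) [c_head _]Posz_pred E.
rewrite /step /= /back Posz_pred; congr (@Config _ _ _ _).
by rewrite -E tape_of_id.
Qed.

Lemma accepts_mono T T' (c : config sweep_atm) : T <= T' -> accepts T c -> accepts T' c.
Proof.
elim: T T' c => [|T IH] [|T'] c //=; case: sw_kind => // h.
- by case=> tr [H1 H2]; exists tr; split=> //; apply: IH H2.
- by move=> H tr Htr; apply: IH (H _ Htr).
Qed.

Definition accepting (c : config sweep_atm) : Prop := exists T, accepts T c.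

Lemma acceptingE (c : config sweep_atm) : accepting c <->
  match sw_kind (c_state c).1 with
  | KEx => exists tr, List.In tr (trans c) /\ accepting (step c tr)
  | KUn => forall tr, List.In tr (trans c) -> accepting (step c tr)
  | KAcc => True
  | KRej => False
  end.
Proof.
case E: sw_kind; split.
- case=> -[|T] /=; rewrite E // => -[tr [H1 H2]]; exists tr; split=> //; by exists T.
- by case=> tr [H1 [T H2]]; exists T.+1; rewrite /= E; exists tr.
- by case=> -[|T] /=; rewrite E // => H tr /H; exists T.
(* Each of the finitely many successors has its own time; the maximum serves them all. *)
- move=> H; suff [T HT] : exists T, forall tr, List.In tr (trans c) -> accepts T (step c tr).
    by exists T.+1; rewrite /= E.
  elim: (trans c) H => [|tr l IH] H; first by exists 0.
  have [T HT] := IH (fun t h => H t (or_intror h)).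
  have [T' HT'] := H tr (or_introl erefl).
  exists (maxn T T') => t /= [<-|/HT h]; first by apply: accepts_mono HT'; apply: leq_maxr.
  by apply: accepts_mono h; apply: leq_maxl.
- by [].
- by move=> _; exists 0; rewrite /= E.
- by case=> -[|T] /=; rewrite E.
- by [].
Qed.

Lemma accepting_det (c : config sweep_atm) tr : trans c = [:: tr] ->
  sw_kind (c_state (step c tr)).1 = sw_kind (c_state c).1 ->
  accepting c <-> accepting (step c tr).
Proof.
move=> Et Ek; rewrite acceptingE Et.
case E: sw_kind; rewrite E in Ek.
- by split=> [[t [[<-|//] h]]|h] //; exists tr; split=> //; left.
- by split=> [h|h t [<-|//]] //; apply: h; left.
- by rewrite (acceptingE (step _ _)) Ek.
- by rewrite (acceptingE (step _ _)) Ek.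
Qed.

Lemma accepting_back q u h : h <= size u -> accepting (back q u h) <-> accepting (fwd q [::] u).
Proof.
elim: h => [|h IH] hu.
  by rewrite (accepting_det (trans_back0 q u)) ?step_back0.
have [g [Et Es]] := back_step q hu.
by rewrite (accepting_det Et) ?Es // IH // ltnW.
Qed.

(** By [sw_kindP] all configurations of the sweep have the same kind, so the choices made letter by
    letter merge into one quantifier over the outcomes of [swp]. Rewinding is deterministic and adds
    nothing. *)
Lemma accepting_fwd q pre rest : accepting (fwd q pre rest) <->
  kquant (sw_kind q) (swp q rest) (fun q' u' => accepting (fwd q' [::] (pre ++ u'))).
Proof.
elim: rest q pre => [|g rest IH] q pre; rewrite acceptingE.
- rewrite trans_fwd_nil (_ : (c_state (fwd q pre [::])).1 = q) //; case: sw_kind => //=; split.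
  + case=> tr [/List.in_map_iff [[q' o] [<- H]]]; rewrite step_fwd_nil accepting_back.
      by exists q', (oseq o); split=> //; apply/swp_nil; exists o.
    by rewrite size_cat leq_addr.
  + case=> q' [u' [/swp_nil [o [H ->]] Ha]]; exists ((q', false), o, MLeft); split.
      by apply/List.in_map_iff; exists (q', o).
    by rewrite step_fwd_nil accepting_back // size_cat leq_addr.
  + move=> H q' u' /swp_nil [o [H1 ->]].
    have := H ((q', false), o, MLeft); rewrite step_fwd_nil accepting_back.
      by apply; apply/List.in_map_iff; exists (q', o).
    by rewrite size_cat leq_addr.
  + move=> H tr /List.in_map_iff [[q' o] [<- H1]]; rewrite step_fwd_nil accepting_back.
      by apply: H; apply/swp_nil; exists o.
    by rewrite size_cat leq_addr.
- rewrite trans_fwd_cons (_ : (c_state (fwd q pre (g :: rest))).1 = q) //.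
  case E: sw_kind => //=; split.
  + case=> tr [/List.in_map_iff [[q1 g'] [<- H]]]; rewrite step_fwd_cons IH.
    rewrite (sw_kindP H) E => -[q' [u' [H1 H2]]]; exists q', (g' :: u'); split.
      by apply/swp_cons; exists q1, g', u'.
    by rewrite -cat_rcons.
  + case=> q' [u' [/swp_cons [q1 [g' [w' [H1 H2 ->]]]] Ha]].
    exists ((q1, true), Some g', MRight); split.
      by apply/List.in_map_iff; exists (q1, g').
    rewrite step_fwd_cons IH (sw_kindP H1) E; exists q', w'; split=> //.
    by rewrite cat_rcons.
  + move=> H q' u' /swp_cons [q1 [g' [w' [H1 H2 ->]]]].
    have := H ((q1, true), Some g', MRight); rewrite step_fwd_cons IH (sw_kindP H1) E /=.
    rewrite -cat_rcons; apply=> //.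
    by apply/List.in_map_iff; exists (q1, g').
  + move=> H tr /List.in_map_iff [[q1 g'] [<- H1]]; rewrite step_fwd_cons IH (sw_kindP H1) E.
    move=> q' u' H2; rewrite cat_rcons; apply: H.
    by apply/swp_cons; exists q1, g', u'.
Qed.

(** The bound on the number of sweeps is the induction measure that links machine acceptance with
    the inductive [win]. *)
Lemma accepting_win n a q u : sbnd n a q u -> accepting (fwd q [::] u) <-> win q u.
Proof.
elim: n a q u => [|n IH] a q u.
  by rewrite accepting_fwd winE /=; case: sw_kind => //= -[].
rewrite accepting_fwd winE /=; case: sw_kind => //= -[_ H].
- split=> -[q' [u' [H1 H2]]]; exists q', u'; split=> //;
    by [rewrite -IH //; apply: H H1|rewrite IH //; apply: H H1].
- split=> H2 q' u' H1;
    by [rewrite -IH; [apply: H2|apply: H H1]|rewrite IH; [apply: H2|apply: H H1]].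
Qed.

Lemma bounded_mono T T' a a' (c : config sweep_atm) : T <= T' -> a <= a' ->
  bounded T a c -> bounded T' a' c.
Proof.
elim: T T' a a' c => [|T IH] [|T'] a a' c hT ha //=; case: sw_kind => // -[h1 h2];
  split=> //; try exact: leq_trans ha.
- by move=> tr /h2; apply: IH => //; case: ifP => _ //; rewrite -!subn1 leq_sub2r.
- by move=> tr /h2; apply: IH => //; case: ifP => _ //; rewrite -!subn1 leq_sub2r.
Qed.

Lemma stkind_eqbb k : stkind_eqb k k.
Proof. by case: k. Qed.

Lemma bounded_halt T a (c : config sweep_atm) :
  sw_kind (c_state c).1 = KAcc \/ sw_kind (c_state c).1 = KRej -> bounded T a c.
Proof. by case: T => [|T] /= [] ->. Qed.

Lemma bounded_step T a (c : config sweep_atm) : 1 <= a ->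
  (forall tr, List.In tr (trans c) ->
    bounded T (if stkind_eqb (sw_kind (c_state (step c tr)).1) (sw_kind (c_state c).1)
               then a else a.-1) (step c tr)) ->
  bounded T.+1 a c.
Proof. by move=> ha H /=; case: (sw_kind (c_state c).1) H => H. Qed.

Lemma bounded_pos T a (c : config sweep_atm) : bounded T a c ->
  [\/ sw_kind (c_state c).1 = KAcc, sw_kind (c_state c).1 = KRej | 1 <= a].
Proof.
by case: T => [|T] /=; case: sw_kind => //; try (by case=> h _; constructor 3);
  try (by constructor 1); constructor 2.
Qed.

Lemma bounded_back T a q u h : h <= size u -> bounded T a (fwd q [::] u) ->
  bounded (T + h.+1) a (back q u h).
Proof.
move=> hu hb; have [hk|hk|ha] := bounded_pos hb.
- by apply: bounded_halt; left.
- by apply: bounded_halt; right.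
elim: h hu => [|h IH] hu; rewrite addnS; apply: bounded_step => //.
  by move=> tr; rewrite trans_back0 => -[<-|//]; rewrite step_back0 stkind_eqbb addn0.
have [g [Et Es]] := back_step q hu.
by move=> tr; rewrite Et => -[<-|//]; rewrite Es stkind_eqbb; apply: IH; rewrite ltnW.
Qed.

(** Still to come are [size rest] cells and the right end, then all [size pre + size rest] cells
    once more and the left end. *)
Lemma bounded_fwd T a q pre rest : 1 <= a ->
  (forall q' u', swp q rest q' u' ->
     bounded T (if stkind_eqb (sw_kind q') (sw_kind q) then a else a.-1)
       (fwd q' [::] (pre ++ u'))) ->
  bounded (T + (size pre + (size rest).*2 + 2)) a (fwd q pre rest).
Proof.
move=> ha; elim: rest q pre => [|g rest IH] q pre H.
- rewrite addn0 !addnS addn0; apply: bounded_step => // tr; rewrite trans_fwd_nil.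
  move=> /List.in_map_iff [[q' o] [<- H1]]; rewrite step_fwd_nil -addnS.
  apply: bounded_back; first by rewrite size_cat leq_addr.
  by apply: H; apply/swp_nil; exists o.
- set n := (X in bounded X); have -> : n = (T + (size (rcons pre g) + (size rest).*2 + 2)).+1.
    by rewrite /n size_rcons /=; lia.
  apply: bounded_step => // tr; rewrite trans_fwd_cons => /List.in_map_iff [[q1 g'] [<- H1]].
  rewrite step_fwd_cons [sw_kind (c_state (fwd q1 _ _)).1](sw_kindP H1) stkind_eqbb.
  rewrite size_rcons -(size_rcons pre g').
  apply: IH => q' u' H2; rewrite (sw_kindP H1) cat_rcons; apply: H.
  by apply/swp_cons; exists q1, g', u'.
Qed.

Lemma swp_size q u q' u' : swp q u q' u' -> size u' <= (size u).+1.
Proof.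
case=> q1 [v [o [Hr _ ->]]]; rewrite size_cat (run_size Hr) -addn1 leq_add2l.
by case: o.
Qed.

(** A sweep appends at most one cell, so the tape never exceeds [size u + n], and a sweep with its
    rewinding takes at most twice that plus two steps. *)
Lemma bounded_sweeps n a q u : sbnd n a q u ->
  bounded (n * ((size u + n).*2 + 2)) a (fwd q [::] u).
Proof.
elim: n a q u => [|n IH] a q u /=.
  by case E: sw_kind => //; try (by case); move=> _; rewrite E.
move=> H.
have [hk|hk|[ha Hb]] : [\/ sw_kind q = KAcc, sw_kind q = KRej
   | 1 <= a /\ forall q' u', swp q u q' u' ->
       sbnd n (if stkind_eqb (sw_kind q') (sw_kind q) then a else a.-1) q' u'].
  by case: (sw_kind q) H => H; by [constructor 3|constructor 1|constructor 2].
- by apply: bounded_halt; left.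
- by apply: bounded_halt; right.
apply: (@bounded_mono (n * ((size u + n.+1).*2 + 2) + (0 + (size u).*2 + 2)) _ a) => //.
  by rewrite mulSn; nia.
apply: (@bounded_fwd _ a q [::] u) => // q' u' Hs.
apply: bounded_mono (IH _ _ _ (Hb _ _ Hs)) => //.
by have := swp_size Hs; nia.
Qed.

(** Every path halts within [T] steps, so cutting acceptance off at [T] loses nothing. *)
Lemma accepts_bounded T a (c : config sweep_atm) :
  bounded T a c -> accepts T c <-> accepting c.
Proof.
move=> hb; split; first by exists T.
case=> T'; elim: T T' a c hb => [|T IH] [|T'] a c /=; case: sw_kind => // -[_] // hb.
- by case=> tr [H1 H2]; exists tr; split=> //; apply: IH H2; apply: hb.
- by move=> H tr Htr; apply: IH (H tr Htr); apply: hb.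
Qed.

Theorem sweep_atm_correct n a T w : sbnd n a q0 (map inp w) ->
  n * ((size w + n).*2 + 2) <= T ->
  bounded T a (init_config sweep_atm w) /\
  (accepts T (init_config sweep_atm w) <-> win q0 (map inp w)).
Proof.
move=> hs hT; rewrite init_configE.
have hb : bounded T a (fwd q0 [::] (map inp w)).
  by apply: bounded_mono (bounded_sweeps hs) => //; rewrite size_map.
by split=> //; rewrite (accepts_bounded hb) (accepting_win hs).
Qed.

End Sweeps.

(** * The evaluation game as a sweep machine *)

Section EnumFinite.
Context (T : Type) (dec : comparable T) (e : seq T).

Definition enum_index (x : T) : 'I_(size e).+1 := inord (find (fun y => dec x y : bool) e).

Lemma enum_indexK : (forall x, List.In x e) -> pcancel enum_index (fun i => onth e i).
Proof.
move=> He x; rewrite /enum_index inordK ?ltnS ?find_size //.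
have h : has (fun y => dec x y : bool) e.
  elim: e (He x) => //= y s IH [->|/IH ->]; last by rewrite orbT.
  by case: (dec x x).
rewrite onthE (nth_map x) -?has_find //.
by have := nth_find x h; case: (dec x _) => // E _; rewrite -E.
Qed.

End EnumFinite.

Lemma sym_dec : comparable sym. Proof. rewrite /comparable /decidable; decide equality. Defined.

Lemma sym_enumP s : List.In s
  [:: SZero; SOne; SF; SLP; SRP; SComma; SAnd; SNot; SEx; SB0; SB1].
Proof. by case: s; rewrite /=; tauto. Qed.

HB.instance Definition _ := Finite.copy sym (pcan_type (enum_indexK sym_dec sym_enumP)).

(* [Seg fst v]: cell of a subformula occurrence claimed to have value [v], [fst]
   on its first cell.  [Nm], [Nmc]: name of the function symbol under evaluation,
   [Nmc] once compared.  [Bnd]: name of a quantified variable in scope.  Names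
   include the opening parenthesis that terminates them. *)
Inductive lab := Out | Seg of bool & bool | Nm | Nmc | Bnd.

Definition lab_code (l : lab) : option (bool * bool) + option bool :=
  match l with
  | Out => inl None | Seg f v => inl (Some (f, v))
  | Nm => inr None | Nmc => inr (Some true) | Bnd => inr (Some false)
  end.
Definition lab_decode c :=
  match c with
  | inl None => Out | inl (Some (f, v)) => Seg f v
  | inr None => Nm | inr (Some true) => Nmc | inr (Some false) => Bnd
  end.
Lemma lab_codeK : cancel lab_code lab_decode. Proof. by case. Qed.
HB.instance Definition _ := Finite.copy lab (can_type lab_codeK).

(* A table is a cell [TH] followed by its bits; [TX] is an erased cell. *)
Inductive tcell := TH | TB of bool | TX.

Definition tcell_code (t : tcell) : option (option bool) :=
  match t with TH => None | TB b => Some (Some b) | TX => Some None end.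
Definition tcell_decode c :=
  match c with None => TH | Some (Some b) => TB b | Some None => TX end.
Lemma tcell_codeK : cancel tcell_code tcell_decode. Proof. by case. Qed.
HB.instance Definition _ := Finite.copy tcell (can_type tcell_codeK).

(* A text cell also carries one bit of the counter that measures tables. *)
Definition cell : Type := (sym * lab * bool) + tcell.

(* Automaton for [bin n ++ SComma :: bin i ++ [:: SLP]]. *)
Inductive nst := A0 | Az | A1 | I0 | Iz | I1.

Lemma nst_dec : comparable nst. Proof. rewrite /comparable /decidable; decide equality. Defined.
Lemma nst_enumP s : List.In s [:: A0; Az; A1; I0; Iz; I1].
Proof. by case: s; rewrite /=; tauto. Qed.
HB.instance Definition _ := Finite.copy nst (pcan_type (enum_indexK nst_dec nst_enumP)).

(** [None] rejects and [Some None] accepts. No bit may follow a leading 0 ([Az], [Iz]), so only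
    numerals produced by [bin] pass. *)
Definition nstep (x : nst) (s : sym) : option (option nst) :=
  match x, s with
  | A0, SB0 => Some (Some Az)
  | A0, SB1 => Some (Some A1)
  | A1, SB0 | A1, SB1 => Some (Some A1)
  | Az, SComma | A1, SComma => Some (Some I0)
  | I0, SB0 => Some (Some Iz)
  | I0, SB1 => Some (Some I1)
  | I1, SB0 | I1, SB1 => Some (Some I1)
  | Iz, SLP | I1, SLP => Some None
  | _, _ => None
  end.

(* The role of the subformula being relabelled, which determines what follows it:
   [NotT b], [AndR b] and [ExB b] carry its claimed value [b]; in [AndL b v] and
   [Arg b v], [v] is the claimed value of the whole formula. *)
Inductive rkind :=
| NotT of bool
| AndL of bool & bool
| AndR of bool
| ExB of bool
| Arg of bool & bool.

Definition rkind_code (c : rkind) : bool + (bool * bool) + (bool + bool + (bool * bool)) :=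
  match c with
  | NotT b => inl (inl b) | AndL a v => inl (inr (a, v))
  | AndR b => inr (inl (inl b)) | ExB v => inr (inl (inr v)) | Arg b v => inr (inr (b, v))
  end.
Definition rkind_decode c :=
  match c with
  | inl (inl b) => NotT b | inl (inr (a, v)) => AndL a v
  | inr (inl (inl b)) => AndR b | inr (inl (inr v)) => ExB v | inr (inr (b, v)) => Arg b v
  end.
Lemma rkind_codeK : cancel rkind_code rkind_decode. Proof. by case. Qed.
HB.instance Definition _ := Finite.copy rkind (can_type rkind_codeK).

Definition rval (c : rkind) : bool :=
  match c with NotT b | AndL b _ | AndR b | ExB b | Arg b _ => b end.

(** What follows the labelling: [RWin] for a correct constant, [RGen v] for a quantifier whose table
    is to be written, [RQ] for a challenge, with [Some v] if an application of claimed value [v] can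
    also be challenged on arity and lookup. *)
Inductive result := RWin | RQ of option bool | RGen of bool.

Definition result_code (r : result) : option (option bool + bool) :=
  match r with RWin => None | RQ x => Some (inl x) | RGen v => Some (inr v) end.
Definition result_decode c :=
  match c with None => RWin | Some (inl x) => RQ x | Some (inr v) => RGen v end.
Lemma result_codeK : cancel result_code result_decode. Proof. by case. Qed.
HB.instance Definition _ := Finite.copy result (can_type result_codeK).

(* [MName app v _] reads a name that is applied ([app]) or quantified, in a formula
   of claimed value [v]; [MRun st c] relabels a subformula, [st] once it is known to
   be nonempty; [MClose v] expects the end of an empty argument list. *)
Inductive mst :=
| M0
| MSF of bool
| MName of bool & bool & nst
| MRun of bool & rkind
| MClose of bool
| MEnd of result.

Definition mst_code (m : mst)
    : (option bool + (bool * bool * nst)) + ((bool * rkind) + (bool + result)) :=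
  match m with
  | M0 => inl (inl None) | MSF v => inl (inl (Some v)) | MName a v x => inl (inr (a, v, x))
  | MRun b c => inr (inl (b, c)) | MClose v => inr (inr (inl v)) | MEnd r => inr (inr (inr r))
  end.
Definition mst_decode c :=
  match c with
  | inl (inl None) => M0 | inl (inl (Some v)) => MSF v | inl (inr (a, v, x)) => MName a v x
  | inr (inl (b, c)) => MRun b c | inr (inr (inl v)) => MClose v | inr (inr (inr r)) => MEnd r
  end.
Lemma mst_codeK : cancel mst_code mst_decode. Proof. by case=> // -[]. Qed.
HB.instance Definition _ := Finite.copy mst (can_type mst_codeK).

Definition mhead (s : sym) (v : bool) : list mst :=
  match s with
  | SOne => if v then [:: MEnd RWin] else [::]
  | SZero => if v then [::] else [:: MEnd RWin]
  | SNot => [:: MRun false (NotT (~~ v))]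
  | SLP => [:: MRun false (AndL true v); MRun false (AndL false v)]
  | SEx => [:: MSF v]
  | SF => [:: MName true v A0]
  | _ => [::]
  end.

(** The values guessed for the conjuncts have conjunction [v]. After a false left conjunct the value
    of the right one is free, yet it is guessed: the right conjunct has to be defended as well
    formed and closed. *)
Definition mafter (c : rkind) (s : sym) : list mst :=
  match c, s with
  | AndL true v, SAnd => [:: MRun false (AndR v)]
  | AndL false false, SAnd => [:: MRun false (AndR true); MRun false (AndR false)]
  | AndR _, SRP => [:: MEnd (RQ None)]
  | ExB v, SRP => [:: MEnd (RGen v)]
  | Arg _ v, SComma => [:: MRun false (Arg true v); MRun false (Arg false v)]
  | Arg _ v, SRP => [:: MEnd (RQ (Some v))]
  | _, _ => [::]
  end.

Definition mname_end (app v : bool) : list mst :=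
  if app then [:: MClose v; MRun false (Arg true v); MRun false (Arg false v)]
  else [:: MRun false (ExB v)].

Definition mseg (m : mst) (s : sym) (v : bool) : list (mst * lab) :=
  let outs l := List.map (fun m' => (m', Out)) l in
  match m with
  | M0 => outs (mhead s v)
  | MSF v' => if s is SF then [:: (MName false v' A0, Out)] else [::]
  | MName app v' x =>
      let l := if app then Nm else Bnd in
      match nstep x s with
      | None => [::]
      | Some (Some y) => [:: (MName app v' y, l)]
      | Some None => List.map (fun m' => (m', l)) (mname_end app v')
      end
  | MRun st c =>
      (MRun true c, Seg (~~ st) (rval c)) :: (if st then outs (mafter c s) else [::])
  | MClose v' => if s is SRP then [:: (MEnd (RQ (Some v')), Out)] else [::]
  | MEnd _ => [::]
  end.

(** A negation has no closing symbol. Its subformula extends to the end of the claimed segment,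
    which shows by a cell without segment label or, in [mresult], by the end of the tape. *)
Definition mskip (m : mst) : list mst :=
  match m with
  | M0 => [:: M0]
  | MRun true (NotT _) => [:: MEnd (RQ None)]
  | MEnd r => [:: MEnd r]
  | _ => [::]
  end.

Definition mdelta (m : mst) (g : cell) : list (mst * cell) :=
  match g with
  | inl (s, Seg _ v, c) => List.map (fun p => (p.1, inl (s, p.2, c))) (mseg m s v)
  | _ => List.map (fun m' => (m', g)) (mskip m)
  end.

Definition mresult (m : mst) : list result :=
  match m with
  | MRun true (NotT _) => [:: RQ None]
  | MEnd r => [:: r]
  | _ => [::]
  end.

(** [P0]: nothing picked yet; [PKeep]: in the picked segment; [P1]: behind it. *)
Inductive pst := P0 | PKeep | P1.
Definition pst_code (p : pst) : option bool :=
  match p with P0 => None | PKeep => Some true | P1 => Some false end.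
Definition pst_decode c :=
  match c with None => P0 | Some true => PKeep | Some false => P1 end.
Lemma pst_codeK : cancel pst_code pst_decode. Proof. by case. Qed.
HB.instance Definition _ := Finite.copy pst (can_type pst_codeK).

Definition pdelta (p : pst) (g : cell) : list (pst * cell) :=
  match g with
  | inl (s, Seg true v, c) =>
      match p with
      | P0 => [:: (PKeep, g); (P0, inl (s, Out, c))]
      | PKeep | P1 => [:: (P1, inl (s, Out, c))]
      end
  | inl (s, Seg false v, c) =>
      [:: (p, if p is PKeep then g else inl (s, Out, c))]
  | inl (s, l, c) =>
      [:: (if p is PKeep then P1 else p,
           inl (s, if l is Bnd then Bnd else Out, c))]
  | inr _ => [:: (p, g)]
  end.

(* [G0] writes the head of a table; [Gc carry] increments the counter, whose least
   significant bit is the leftmost one, and writes one bit of the table. *)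
Inductive gst := G0 | Gc of bool.
Definition gst_code (p : gst) : option bool := match p with G0 => None | Gc b => Some b end.
Definition gst_decode c := match c with None => G0 | Some b => Gc b end.
Lemma gst_codeK : cancel gst_code gst_decode. Proof. by case. Qed.
HB.instance Definition _ := Finite.copy gst (can_type gst_codeK).

Definition gdelta (p : gst) (g : cell) : list (gst * cell) :=
  match p, g with
  | Gc b, inl (s, l, c) => [:: (Gc (b && c), inl (s, l, b (+) c))]
  | _, _ => [:: (p, g)]
  end.

(* Arity check: [C0]/[C1] no/some bit of the arity was kept, [CB b] its last bit
   [b] was removed, [CC b] the separating comma was passed, [CF] no bit is left. *)
Inductive cst := C0 | C1 | CB of bool | CC of bool | CF.
Definition cst_code (p : cst) : option bool + option (option bool) :=
  match p with
  | C0 => inl None | CB b => inl (Some b) | C1 => inr None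
  | CC b => inr (Some (Some b)) | CF => inr (Some None)
  end.
Definition cst_decode c :=
  match c with
  | inl None => C0 | inl (Some b) => CB b | inr None => C1
  | inr (Some (Some b)) => CC b | inr (Some None) => CF
  end.
Lemma cst_codeK : cancel cst_code cst_decode. Proof. by case. Qed.
HB.instance Definition _ := Finite.copy cst (can_type cst_codeK).

Definition cname (a : cst) (s : sym) : list (cst * lab) :=
  match a, s with
  | C0, SComma => [:: (CF, Nm)]
  | C0, SB0 | C1, SB0 => [:: (C1, Nm); (CB false, Out)]
  | C0, SB1 | C1, SB1 => [:: (C1, Nm); (CB true, Out)]
  | CB b, SComma => [:: (CC b, Nm)]
  | CC b, _ => [:: (CC b, Nm)]
  | CF, _ => [:: (CF, Nm)]
  | _, _ => [::]
  end.

(** Both numbers are divided by two: a sweep removes the last bit of the arity, records the parity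
    of the number of argument heads for comparison in [gfin], and erases every other head. [CF]
    permits no head, since a numeral without bits stands for 0. *)
Definition cdelta (p : cst * bool) (g : cell) : list ((cst * bool) * cell) :=
  match g with
  | inl (s, Nm, c) => List.map (fun x => ((x.1, p.2), inl (s, x.2, c))) (cname p.1 s)
  | inl (s, Seg true v, c) =>
      if p.1 is CF then [::]
      else [:: ((p.1, ~~ p.2), inl (s, if p.2 then Seg true v else Out, c))]
  | _ => [:: (p, g)]
  end.

(** The leftmost remaining argument is the lowest digit of the table index, so the entries at
    positions of its parity survive. The parity restarts at each [TH]: all tables are treated alike,
    before it is known which one belongs to the function symbol. *)
Definition ldelta (p : option bool * bool) (g : cell) : list ((option bool * bool) * cell) :=
  match g with
  | inl (s, Seg true v, c) =>
      if p.1 is None then [:: ((Some v, p.2), inl (s, Out, c))] else [:: (p, g)]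
  | inr TH => [:: ((p.1, false), g)]
  | inr (TB b) =>
      if p.1 is Some v then [:: ((p.1, ~~ p.2), inr (if p.2 == v then TB b else TX))]
      else [:: (p, g)]
  | _ => [:: (p, g)]
  end.

(* Comparison of the first bound name with the name under evaluation: [XM s] looks
   for a match of symbol [s], [XN s dr] for a mismatch ([dr]: the bound name is
   still being erased), [XT1]/[XT2] erase the first table, reading its first bit
   if [take]. *)
Inductive xst :=
| X0 of option bool
| XP of option bool
| XM of option bool & sym
| XN of option bool & sym & bool
| XT1 of option bool & bool
| XT2 of option bool & bool.

Definition xst_code (x : xst)
    : (option bool + option bool) +
      ((option bool * sym + option bool * sym * bool) +
       (option bool * bool + option bool * bool)) :=
  match x with
  | X0 a => inl (inl a) | XP a => inl (inr a)
  | XM a s => inr (inl (inl (a, s))) | XN a s d => inr (inl (inr (a, s, d)))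
  | XT1 a t => inr (inr (inl (a, t))) | XT2 a t => inr (inr (inr (a, t)))
  end.
Definition xst_decode c :=
  match c with
  | inl (inl a) => X0 a | inl (inr a) => XP a
  | inr (inl (inl (a, s))) => XM a s | inr (inl (inr (a, s, d))) => XN a s d
  | inr (inr (inl (a, t))) => XT1 a t | inr (inr (inr (a, t))) => XT2 a t
  end.
Lemma xst_codeK : cancel xst_code xst_decode. Proof. by case. Qed.
HB.instance Definition _ := Finite.copy xst (can_type xst_codeK).

Definition is_lp (s : sym) : bool := if s is SLP then true else false.

(** Bound names and tables stand in the same order, so the first remaining name owns the first
    remaining table. A match stores the first bit of that table, and later matches overwrite it: the
    innermost binding counts. *)
Definition xdelta (x : xst) (g : cell) : list (xst * cell) :=
  match x, g with
  | X0 a, inl (s, Bnd, c) => [:: (XM a s, inl (s, Out, c)); (XN a s (~~ is_lp s), inl (s, Out, c))]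
  | XM a s, inl (s', Nmc, c) => [:: (x, inl (s', if is_lp s then Nm else Nmc, c))]
  | XM a s, inl (s', Nm, c) =>
      if s' == s then
        if is_lp s then [:: (XT1 a true, g)] else [:: (XP a, inl (s', Nmc, c))]
      else [::]
  | XN a s true, inl (s', Bnd, c) => [:: (XN a s (~~ is_lp s'), inl (s', Out, c))]
  | XN a s dr, inl (s', Nmc, c) => [:: (x, inl (s', Nm, c))]
  | XN a s dr, inl (s', Nm, c) => if s' == s then [::] else [:: (XT1 a false, g)]
  | XT1 a t, inr TH => [:: (XT2 a t, inr TX)]
  | XT2 a t, inr (TB b) => [:: (XT2 (if t then Some b else a) false, inr TX)]
  | XT2 a t, inr TH => [:: (XP (if t then Some false else a), g)]
  | _, _ => [:: (x, g)]
  end.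

(** The phases: [SM] labelling, [SQ] choice of a challenge, [SP] picking a subformula, [SG] writing
    a table (existentially if the flag is true), [SC] arity check, [SL] selection by the arguments,
    [SX] name lookup. The flag of [SL] and [SX] is the claimed value. *)
Inductive gstate :=
| SM of mst
| SQ of option bool
| SP of pst
| SG of bool & gst
| SC of cst * bool
| SL of bool & option bool * bool
| SX of bool & xst
| SWin.

Definition gstate_code (q : gstate)
    : ((mst + option bool) + (pst + bool * gst)) +
      ((cst * bool + bool * (option bool * bool)) + option (bool * xst)) :=
  match q with
  | SM m => inl (inl (inl m)) | SQ x => inl (inl (inr x))
  | SP p => inl (inr (inl p)) | SG k p => inl (inr (inr (k, p)))
  | SC p => inr (inl (inl p)) | SL v p => inr (inl (inr (v, p)))
  | SX v x => inr (inr (Some (v, x))) | SWin => inr (inr None)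
  end.
Definition gstate_decode c :=
  match c with
  | inl (inl (inl m)) => SM m | inl (inl (inr x)) => SQ x
  | inl (inr (inl p)) => SP p | inl (inr (inr (k, p))) => SG k p
  | inr (inl (inl p)) => SC p | inr (inl (inr (v, p))) => SL v p
  | inr (inr (Some (v, x))) => SX v x | inr (inr None) => SWin
  end.
Lemma gstate_codeK : cancel gstate_code gstate_decode. Proof. by case. Qed.
HB.instance Definition _ := Finite.copy gstate (can_type gstate_codeK).

Definition embed (A : Type) (f : A -> gstate) (l : list (A * cell)) : list (gstate * cell) :=
  List.map (fun p => (f p.1, p.2)) l.

Definition gkind (q : gstate) : stkind :=
  match q with
  | SM _ | SG true _ | SC _ | SL _ _ | SX _ _ => KEx
  | SQ _ | SP _ | SG false _ => KUn
  | SWin => KAcc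
  end.

Definition gdelta_all (q : gstate) (g : cell) : list (gstate * cell) :=
  match q with
  | SM m => embed SM (mdelta m g)
  | SQ x => [:: (SQ x, g)]
  | SP p => embed SP (pdelta p g)
  | SG k p => embed (SG k) (gdelta p g)
  | SC p => embed SC (cdelta p g)
  | SL v p => embed (SL v) (ldelta p g)
  | SX v x => embed (SX v) (xdelta x g)
  | SWin => [::]
  end.

Definition gstart (r : result) : gstate :=
  match r with
  | RWin => SWin
  | RQ x => SQ x
  | RGen v => SG v G0
  end.

(** A run of [SP] that picks nothing has no successor and so does no harm to the existential player;
    this covers applications without arguments. In [SG], the final carry [b] tells that the bit
    being appended completes the table. *)
Definition gfin (q : gstate) : list (gstate * option cell) :=
  match q with
  | SM m => List.map (fun r => (gstart r, None)) (mresult m)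
  | SQ x => (SP P0, None) ::
      (if x is Some v then [:: (SC (C0, false), None); (SL v (None, false), None)] else [::])
  | SP p => if p is (PKeep | P1) then [:: (SM M0, None)] else [::]
  | SG k G0 => [:: (SG k (Gc true), Some (inr TH))]
  | SG k (Gc b) =>
      let q := if b then SQ None else SG k (Gc true) in
      [:: (q, Some (inr (TB true))); (q, Some (inr (TB false)))]
  | SC (CF, _) => [:: (SWin, None)]
  | SC (CC b, p) => if p == b then [:: (SC (C0, false), None)] else [::]
  | SC _ => [::]
  | SL v (None, _) => [:: (SX v (X0 None), None)]
  | SL v _ => [:: (SL v (None, false), None)]
  | SX v (X0 a) => if a == Some v then [:: (SWin, None)] else [::]
  | SX v (XP a) => [:: (SX v (X0 a), None)]
  | SX v (XT2 a t) => [:: (SX v (X0 (if t then Some false else a)), None)]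
  | SX _ _ => [::]
  | SWin => [::]
  end.

Lemma embed_kind (A : Type) (f : A -> gstate) l k q' g' :
  (forall a, gkind (f a) = k) -> List.In (q', g') (embed f l) -> gkind q' = k.
Proof. by move=> h /List.in_map_iff [[a g] [[<- _] _]]; apply: h. Qed.

Lemma gdelta_kind q g q' g' : List.In (q', g') (gdelta_all q g) -> gkind q' = gkind q.
Proof.
case: q => [m|x|p|k p|p|v p|v x|] //=; try exact: embed_kind.
by case=> // -[<-].
Qed.

Definition game : sweeper := @Sweeper gstate cell gkind gdelta_all gfin gdelta_kind.

(** * Runs, and the winning condition of each phase *)

Lemma run_cat (S G : Type) (d : S -> G -> list (S * G)) q u1 u2 q' u' :
  run d q (u1 ++ u2) q' u' <->
  exists q1 v1 v2, [/\ run d q u1 q1 v1, run d q1 u2 q' v2 & u' = v1 ++ v2].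
Proof.
elim: u1 q u' => [|g u1 IH] q u' /=; split.
- by move=> H; exists q, [::], u'.
- by case=> q1 [v1 [v2 [[-> ->] H ->]]].
- case=> q1 [g' [w' [H /IH [q2 [v1 [v2 [H1 H2 ->]]]] ->]]].
  by exists q2, (g' :: v1), v2; split=> //; exists q1, g', v1.
- case=> q1 [v1 [v2 [[q2 [g' [w' [H1 H2 ->]]]] H3 ->]]].
  by exists q2, g', (w' ++ v2); split=> //; apply/IH; exists q1, w', v2.
Qed.

Lemma run_cat_intro (S G : Type) (d : S -> G -> list (S * G)) q u1 q1 v1 u2 q' v2 :
  run d q u1 q1 v1 -> run d q1 u2 q' v2 -> run d q (u1 ++ u2) q' (v1 ++ v2).
Proof. by move=> H1 H2; apply/run_cat; exists q1, v1, v2. Qed.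

Lemma run_cons_intro (S G : Type) (d : S -> G -> list (S * G)) q g q1 g1 u q' v :
  List.In (q1, g1) (d q g) -> run d q1 u q' v -> run d q (g :: u) q' (g1 :: v).
Proof. by move=> H1 H2; exists q1, g1, v. Qed.

Lemma run_map (S G T : Type) (d : S -> G -> list (S * G)) q (f f' : T -> G) u :
  (forall x, d q (f x) = [:: (q, f' x)]) -> run d q (map f u) q (map f' u).
Proof.
move=> H; elim: u => //= x u IH; exists q, (f' x), (map f' u).
by rewrite H; split=> //; left.
Qed.

Lemma run_uniq (S G : Type) (d : S -> G -> list (S * G)) (I : S -> Prop) :
  (forall q g p1 p2, I q -> List.In p1 (d q g) -> List.In p2 (d q g) -> p1 = p2) ->
  (forall q g p, I q -> List.In p (d q g) -> I p.1) ->
  forall q u q1 v1 q2 v2, I q -> run d q u q1 v1 -> run d q u q2 v2 -> q1 = q2 /\ v1 = v2.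
Proof.
move=> Hd HI q u; elim: u q => [|g u IH] q q1 v1 q2 v2 Iq /=.
  by case=> -> -> [-> ->].
case=> a [g1 [w1 [A1 A2 ->]]] [b [g2 [w2 [B1 B2 ->]]]].
have [Eab Eg] := Hd _ _ _ _ Iq A1 B1; subst b g2.
by have [-> ->] := IH _ _ _ _ _ (HI _ _ _ Iq A1) A2 B2.
Qed.

Lemma run_embed (A : Type) (f : A -> gstate) (d : A -> cell -> list (A * cell)) :
  (forall a g, gdelta_all (f a) g = embed f (d a g)) ->
  forall a u q' u', run gdelta_all (f a) u q' u' <->
    exists a', q' = f a' /\ run d a u a' u'.
Proof.
move=> H a u; elim: u a => [|g u IH] a q' u' /=.
  by split=> [[-> ->]|[a' [-> [-> ->]]]] //; exists a.
rewrite H; split.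
- case=> q1 [g' [w' [/List.in_map_iff [[a1 g1] [[<- <-] H1]] /IH [a' [-> H2]] ->]]].
  by exists a'; split=> //; exists a1, g1, w'.
- case=> a' [-> [a1 [g1 [w' [H1 H2 ->]]]]]; exists (f a1), g1, w'; split=> //.
    by apply/List.in_map_iff; exists (a1, g1).
  by apply/IH; exists a'.
Qed.

Section WinEmbed.
Context (A : Type) (f : A -> gstate) (d : A -> cell -> list (A * cell)).
Hypothesis fd : forall a g, gdelta_all (f a) g = embed f (d a g).

Lemma swp_embed a u q' u' : @swp game (f a) u q' u' <->
  exists a' v o, [/\ run d a u a' v, List.In (q', o) (gfin (f a')) & u' = v ++ oseq o].
Proof.
split.
- case=> q1 [v [o [/(run_embed fd) [a' [-> H1]] H2 ->]]]; by exists a', v, o.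
- case=> a' [v [o [H1 H2 ->]]]; exists (f a'), v, o; split=> //.
  by apply/(run_embed fd); exists a'.
Qed.

Lemma win_embed_ex a u : gkind (f a) = KEx -> @win game (f a) u <->
  exists a' v q' o, [/\ run d a u a' v, List.In (q', o) (gfin (f a'))
    & @win game q' (v ++ oseq o)].
Proof.
move=> E; rewrite winE [sw_kind _]E /=; split.
- by case=> q' [u' [/swp_embed [a' [v [o [H1 H2 ->]]]] H3]]; exists a', v, q', o.
- case=> a' [v [q' [o [H1 H2 H3]]]]; exists q', (v ++ oseq o); split=> //.
  by apply/swp_embed; exists a', v, o.
Qed.

Lemma win_embed_un a u : gkind (f a) = KUn -> @win game (f a) u <->
  forall a' v q' o, run d a u a' v -> List.In (q', o) (gfin (f a')) ->
    @win game q' (v ++ oseq o).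
Proof.
move=> E; rewrite winE [sw_kind _]E /=; split.
- by move=> H a' v q' o H1 H2; apply: H; apply/swp_embed; exists a', v, o.
- by move=> H q' u' /swp_embed [a' [v [o [H1 H2 ->]]]]; apply: H H1 H2.
Qed.

End WinEmbed.

Notation gwin := (@win game).

Lemma gwin_SWin u : gwin SWin u.
Proof. exact: WinAcc. Qed.

Lemma gwin_SM u : gwin (SM M0) u <->
  exists m v r, [/\ run mdelta M0 u m v, List.In r (mresult m) & gwin (gstart r) v].
Proof.
rewrite (win_embed_ex (f := SM) (d := mdelta)) //; split.
- case=> m [v [q' [o [H1 /List.in_map_iff [r [[<- <-] H2]] H3]]]].
  by exists m, v, r; rewrite cats0 in H3.
- case=> m [v [r [H1 H2 H3]]]; exists m, v, (gstart r), None; rewrite cats0; split=> //.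
  by apply/List.in_map_iff; exists r.
Qed.

Lemma run_id (S G : Type) (d : S -> G -> list (S * G)) q u q' u' :
  (forall g, d q g = [:: (q, g)]) -> run d q u q' u' <-> q' = q /\ u' = u.
Proof.
move=> H; elim: u u' => //= g u IH u'; split.
  rewrite H => -[q1 [g' [w' [[[E1 E2]|//] H2 ->]]]]; subst.
  by have [-> ->] := proj1 (IH _) H2.
by case=> E1 ->; subst; exists q, g, u; rewrite H; split=> //; [left|apply/IH].
Qed.

Lemma gwin_SQ x u : gwin (SQ x) u <->
  gwin (SP P0) u /\
  (if x is Some v then gwin (SC (C0, false)) u /\ gwin (SL v (None, false)) u else True).
Proof.
rewrite (win_embed_un (f := SQ) (d := fun x g => [:: (x, g)])) //; split.
- move=> H; have {}H q' : List.In (q', None) (gfin (SQ x)) -> gwin q' u.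
    by move=> h; rewrite -[u]cats0; apply: (H x u q' None) => //; apply/run_id.
  split; first by apply: H; left.
  by case: x H => // v H; split; apply: H; [right; left|right; right; left].
- case=> H1 H2 a' v q' o /run_id -[] // -> ->; rewrite /gfin.
  case=> [[<- <-]|]; first by rewrite cats0.
  by case: x H2 => // w [H2 H3] [[<- <-]|[[<- <-]|//]]; rewrite cats0.
Qed.

Lemma gwin_SP u : gwin (SP P0) u <->
  forall p v, run pdelta P0 u p v -> p <> P0 -> gwin (SM M0) v.
Proof.
rewrite (win_embed_un (f := SP) (d := pdelta)) //; split.
- by move=> H p v H1 H2; rewrite -[v]cats0; apply: (H p v _ None H1);
    case: p H1 H2 => // *; left.
- move=> H p v q' o H1 H2; case: p H1 H2 => //= H1 [[<- <-]|//]; rewrite cats0;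
    exact: (H _ _ H1).
Qed.

Lemma gwin_SC u : gwin (SC (C0, false)) u <->
  exists p v, run cdelta (C0, false) u p v /\
    match p with
    | (CF, _) => True
    | (CC b, c) => c = b /\ gwin (SC (C0, false)) v
    | _ => False
    end.
Proof.
rewrite (win_embed_ex (f := SC) (d := cdelta)) //; split.
- case=> -[a c] [v [q' [o [H1 H2 H3]]]]; exists (a, c), v; split=> //.
  case: a H1 H2 => //= b H1; case: eqP => // -> [[E1 E2]|//]; subst; split=> //.
  by rewrite cats0 in H3.
- case=> -[a c] [v [H1 H2]]; case: a H1 H2 => // [b|] H1 H2.
  + case: H2 => E H2; exists (CC b, c), v, (SC (C0, false)), None; rewrite cats0; split=> //.
    by rewrite /= E eqxx; left.
  + exists (CF, c), v, SWin, None; split=> //; [by left|exact: gwin_SWin].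
Qed.

Lemma gwin_SL w u : gwin (SL w (None, false)) u <->
  exists p v, run ldelta (None, false) u p v /\
    gwin (if p.1 is Some _ then SL w (None, false) else SX w (X0 None)) v.
Proof.
rewrite (win_embed_ex (f := SL w) (d := ldelta)) //; split.
- case=> -[a c] [v [q' [o [H1 H2 H3]]]]; exists (a, c), v; split=> //.
  by case: a H1 H2 => [b|] H1 /= [[E1 E2]|//]; subst; rewrite cats0 in H3.
- case=> -[a c] [v [H1 H2]]; case: a H1 H2 => [b|] H1 H2.
  + by exists (Some b, c), v, (SL w (None, false)), None; rewrite cats0; split=> //; left.
  + by exists (None, c), v, (SX w (X0 None)), None; rewrite cats0; split=> //; left.
Qed.

Definition xnext (x : xst) : option (option bool) :=
  match x with
  | XP a => Some a
  | XT2 a t => Some (if t then Some false else a)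
  | _ => None
  end.

Lemma gwin_SX w a u : gwin (SX w (X0 a)) u <->
  exists x v, run xdelta (X0 a) u x v /\
    ((exists b, x = X0 b /\ b = Some w) \/
     (exists b, xnext x = Some b /\ gwin (SX w (X0 b)) v)).
Proof.
rewrite (win_embed_ex (f := SX w) (d := xdelta)) //; split.
- case=> x [v [q' [o [H1 H2 H3]]]]; exists x, v; split=> //.
  case: x H1 H2 => //= [b|b|b t] H1; last 2 first.
  + by case=> [[E1 E2]|//]; subst; rewrite cats0 in H3; right; exists b.
  + by case=> [[E1 E2]|//]; subst; rewrite cats0 in H3; right; eexists.
  by case: eqP => // -> _; left; exists (Some w).
- case=> x [v [H1 [[b [E1 E2]]|[b [E H2]]]]].
  + subst; exists (X0 (Some w)), v, SWin, None; split=> //; last exact: gwin_SWin.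
    by rewrite /= eqxx; left.
  + exists x, v, (SX w (X0 b)), None; rewrite cats0; split=> //.
    by case: x E {H1} => //= [c|c t] [->]; left.
Qed.

(** * Cells that the lookup phases ignore *)

Definition relevant (g : cell) : bool :=
  match g with
  | inl (_, Out, _) | inl (_, Seg false _, _) | inr TX => false
  | _ => true
  end.

Definition looking (q : gstate) : bool :=
  match q with SC _ | SL _ _ | SX _ _ => true | _ => false end.

Lemma looking_skip q g : looking q -> ~~ relevant g -> gdelta_all q g = [:: (q, g)].
Proof.
case: q => // [p|v p|v x] _; case: g => [[[s [|[] b| | |]] c]|[|b|]] //= _;
  by case: x => // a t [].
Qed.

Lemma looking_delta q g q' g' : looking q -> List.In (q', g') (gdelta_all q g) -> looking q'.
Proof. by case: q => // [p|v p|v x] _ /List.in_map_iff [[a b] [[<- _] _]]. Qed.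

Lemma run_looking q u q' u' : looking q -> run gdelta_all q u q' u' -> looking q'.
Proof.
elim: u q u' => [|g u IH] q u' lq /=; first by case=> ->.
by case=> a [g' [w' [K1 K2 _]]]; apply: IH K2; apply: looking_delta K1.
Qed.

Lemma run_filter q u q' u' : looking q -> run gdelta_all q u q' u' ->
  exists w', run gdelta_all q (filter relevant u) q' w' /\ filter relevant w' = filter relevant u'.
Proof.
elim: u q u' => [|g u IH] q u' lq /=; first by case=> -> ->; exists [::].
case=> q1 [g' [w' [H1 H2 ->]]].
have [v [H3 H4]] := IH _ _ (looking_delta lq H1) H2.
case: ifP => hg.
- by exists (g' :: v); split; [exists q1, g', v|rewrite /= H4].
- move: H1; rewrite looking_skip ?hg // => -[[E1 E2]|//]; subst.
  by exists v; rewrite /= hg.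
Qed.

Lemma run_unfilter q u q' w' : looking q -> run gdelta_all q (filter relevant u) q' w' ->
  exists u', run gdelta_all q u q' u' /\ filter relevant u' = filter relevant w'.
Proof.
elim: u q w' => [|g u IH] q w' lq /=; first by case=> -> ->; exists [::].
case: ifP => hg.
- case=> q1 [g' [v [H1 H2 ->]]].
  have [u' [H3 H4]] := IH _ _ (looking_delta lq H1) H2.
  by exists (g' :: u'); split; [exists q1, g', u'|rewrite /= H4].
- move=> H; have [u' [H3 H4]] := IH _ _ lq H.
  exists (g :: u'); split; last by rewrite /= hg.
  by exists q, g, u'; split=> //; rewrite looking_skip ?hg //; left.
Qed.

Lemma looking_fin q q' o : looking q -> List.In (q', o) (gfin q) ->
  o = None /\ (q' = SWin \/ looking q').
Proof.
case: q => // [[[||b|b|] c]|v [[b|] c]|v x] _ /=; try by [|case=> [[<- <-]|//]; auto].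
- by case: eqP => // _ [[<- <-]|//]; auto.
- by case: x => [a|a|a s|a s d|a t|a t] //=; try (case: eqP => // _); case=> [[<- <-]|//]; auto.
Qed.

(** The lookup phases pass over irrelevant cells without change and append nothing, so each sweep on
    [u] has a counterpart on [u2]. Thus erased cells can be forgotten, and a halved word be treated
    like one written without gaps. *)
Lemma gwin_rel_eq q u : gwin q u -> q = SWin \/ looking q ->
  forall u2, filter relevant u2 = filter relevant u -> gwin q u2.
Proof.
elim=> {q u} [q u E|q u q' u' E H1 _ IH|q u E _ _].
- by move=> _ u2 _; apply: WinAcc.
- case=> [Eq|lq] u2 Eu; first by rewrite Eq in E.
  case: H1 IH => q1 [v [o [H1 H2 ->]]] IH.
  have [w [H3 H4]] := run_filter lq H1.
  rewrite -Eu in H3; have [v2 [H5 H6]] := run_unfilter lq H3.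
  have lq1 := run_looking lq H1.
  have [Eo Hq'] := looking_fin lq1 H2; subst o.
  apply: (@WinEx game q u2 q' (v2 ++ oseq None) E); first by exists q1, v2, None.
  by apply: IH => //=; rewrite !cats0 H6.
- by case=> [Eq|lq]; [rewrite Eq in E|case: q lq E].
Qed.

Lemma gwin_rel q u : looking q -> gwin q u <-> gwin q (filter relevant u).
Proof.
by move=> lq; split=> /gwin_rel_eq; apply; try (by right); rewrite filter_id.
Qed.

Lemma gwin_rel2 q u u' : looking q ->
  filter relevant u = filter relevant u' -> gwin q u <-> gwin q u'.
Proof. by move=> lq E; rewrite gwin_rel // E -gwin_rel. Qed.

Lemma run_map_inv (S G T : Type) (d : S -> G -> list (S * G)) q (f f' : T -> G) u q' v :
  run d q (map f u) q' v -> (forall x, d q (f x) = [:: (q, f' x)]) ->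
  q' = q /\ v = map f' u.
Proof.
move=> + H; elim: u v => [|x u IH] v /=; first by case=> -> ->.
by rewrite H => -[q1 [g' [w' [[[<- <-]|//] /IH [-> ->] ->]]]].
Qed.

(** * Tape contents as blocks *)

Definition lcs (l : lab) (x : seq sym) : seq cell := [seq inl (s, l, false) | s <- x].
Definition starts (sl : seq (sym * bool)) : seq cell :=
  [seq inl (p.1, Seg true p.2, false) | p <- sl].
Definition tbits (t : seq bool) : seq cell := [seq inr (TB b) | b <- t].
Definition table (t : seq bool) : seq cell := inr TH :: tbits t.
Definition tables (ts : seq (seq bool)) : seq cell := flatten (map table ts).

Lemma lcs_cat l x y : lcs l (x ++ y) = lcs l x ++ lcs l y.
Proof. exact: map_cat. Qed.

(** A flat form of the tables, [None] being a head, through which [tables] becomes a [map]. *)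
Definition tcells (ts : seq (seq bool)) : seq (option bool) :=
  flatten [seq None :: map Some t | t <- ts].

Lemma tablesE ts :
  tables ts = [seq inr (if o is Some b then TB b else TH) | o <- tcells ts].
Proof.
rewrite map_flatten /tables -map_comp; congr flatten; apply: eq_map => t /=.
by rewrite -map_comp.
Qed.

Lemma run_tables (S : Type) (d : S -> cell -> list (S * cell)) q ts :
  d q (inr TH) = [:: (q, inr TH)] -> (forall b, d q (inr (TB b)) = [:: (q, inr (TB b))]) ->
  run d q (tables ts) q (tables ts).
Proof. by move=> Hh Hb; rewrite !tablesE; apply: run_map => -[b|] /=. Qed.

Lemma filter_lcs l x : filter relevant (lcs l x) =
  if l is (Out | Seg false _) then [::] else lcs l x.
Proof. by case: l => [|[] b| | |]; elim: x => //= s x ->. Qed.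

Lemma filter_starts sl : filter relevant (starts sl) = starts sl.
Proof. by elim: sl => //= p sl ->. Qed.

Lemma filter_tables ts : filter relevant (tables ts) = tables ts.
Proof. by rewrite tablesE; elim: (tcells ts) => //= -[b|] l /= ->. Qed.

(** * Checking the arity *)

Definition isbit (s : sym) : bool := (s == SB0) || (s == SB1).
Definition bval (u : seq sym) : nat := foldl (fun n s => n.*2 + (s == SB1)) 0 u.

Lemma bval_rcons u s : bval (rcons u s) = (bval u).*2 + (s == SB1).
Proof. by rewrite /bval foldl_rcons. Qed.

Lemma cname_bit a p s q1 g1 : a = C0 \/ a = C1 -> isbit s ->
  List.In (q1, g1) (cdelta (a, p) (inl (s, Nm, false))) <->
    (q1 = (C1, p) /\ g1 = inl (s, Nm, false)) \/
    (q1 = (CB (s == SB1), p) /\ g1 = inl (s, Out, false)).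
Proof.
move=> Ha; have E : (SB0 == SB1) = false by apply/eqP.
case/orP=> /eqP ->; rewrite ?E ?eqxx; case: Ha => ->; split=> /=.
all: try by case=> [[<- <-]|[[<- <-]|[]]]; auto.
all: by case=> -[-> ->]; auto.
Qed.

(** Each bit may be guessed to be the last one, but then [CB] insists on the comma, so only the
    right guess survives. *)
Lemma run_arity (a : cst) p u s q' v : a = C0 \/ a = C1 -> all isbit (rcons u s) ->
  run cdelta (a, p) (lcs Nm (rcons u s ++ [:: SComma])) q' v <->
  q' = (CC (s == SB1), p) /\ v = lcs Nm u ++ lcs Out [:: s] ++ lcs Nm [:: SComma].
Proof.
elim: u a v => [|s1 u IH] a v Ha.
- rewrite [all _ _]/= andbT => Hs; split.
  + case=> q1 [g1 [w1 [/(cname_bit _ _ _ Ha Hs) [[-> ->]|[-> ->]] H ->]]].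
      by case: H => q2 [g2 [w2 []]].
    by case: H => q2 [g2 [w2 [[[<- <-]|//] [-> ->] ->]]].
  + case=> -> ->; apply: run_cons_intro; first by apply/(cname_bit _ _ _ Ha Hs); right.
    by apply: run_cons_intro; first by left.
- rewrite rcons_cons [all _ _]/= => /andP [Hs1 Hu].
  have IH1 v' := IH C1 v' (or_intror erefl) Hu.
  split.
  + case=> q1 [g1 [w1 [/(cname_bit _ _ _ Ha Hs1) [[-> ->]|[-> ->]] H ->]]].
      by have [-> ->] := proj1 (IH1 _) H.
    case: u Hu H {IH IH1} => [|s2 u] /= /andP [Hs2 _] [q2 [g2 [w2 [H2 _ _]]]];
      by move: H2; case/orP: Hs2 => /eqP ->.
  + case=> Eq ->; subst q'; apply: (@run_cons_intro _ _ _ _ _ (C1, p)).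
      by apply/(cname_bit _ _ _ Ha Hs1); left.
    by apply/IH1.
Qed.

Fixpoint halve (T : Type) (p : bool) (l : seq T) : seq T :=
  if l is x :: l' then if p then x :: halve (~~ p) l' else halve (~~ p) l' else [::].

Lemma size_halve (T : Type) p (l : seq T) : size (halve p l) = (size l + p)./2.
Proof.
elim: l p => [|x l IH] [] //=; rewrite IH //= ?addn0 ?addn1 //.
Qed.

Lemma run_halve b p sl : exists v,
  run cdelta (CC b, p) (starts sl) (CC b, p (+) odd (size sl)) v /\
  filter relevant v = starts (halve p sl).
Proof.
elim: sl p => [|x sl IH] p; first by exists [::]; rewrite addbF.
have [v [H1 H2]] := IH (~~ p).
exists (inl (x.1, if p then Seg true x.2 else Out, false) :: v); split.
  rewrite [odd (size (x :: sl))]/= addbN -addNb.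
  by apply: run_cons_intro H1; left.
by case: p {H1} H2 => /= ->.
Qed.

Lemma cdelta_uniq q u q1 v1 q2 v2 : (exists b, q.1 = CC b) ->
  run cdelta q u q1 v1 -> run cdelta q u q2 v2 -> q1 = q2 /\ v1 = v2.
Proof.
apply: (@run_uniq _ _ cdelta (fun q => exists b, q.1 = CC b)) => {q u q1 v1 q2 v2}.
- move=> [q p] g p1 p2 [b /= ->].
  case: g => [[[s [|[] w| | |]] c]|t] /=; by [move=> [<-|//] [<-|//]].
- move=> [q p] g p1 [b /= ->].
  case: g => [[[s [|[] w| | |]] c]|t] /=; by [move=> [<-|//]; exists b].
Qed.

(** The numeral loses its last bit while the heads are halved. So the claim for [rcons u s] reduces
    to the one for [u] once the parity of [size sl] has been compared with [s]. *)
Lemma gwin_count u B rest sl ts : all isbit u ->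
  gwin (SC (C0, false)) (lcs Bnd B ++ lcs Nm (u ++ SComma :: rest) ++ starts sl ++ tables ts)
  <-> size sl = bval u.
Proof.
elim/last_ind: u sl => [|u s IH] sl Hu; rewrite gwin_SC.
- rewrite /bval /=; split.
  + case=> p [v [/run_cat [q1 [v1 [v2 [H1 H _]]]] Hp]].
    have [E1 _] := run_map_inv H1 (fun _ => erefl); subst q1.
    move: H => /= [q2 [g2 [w2 [[[<- _]|//] H _]]]].
    move: H => /run_cat [q3 [v3 [v4 [H2 H _]]]].
    have [E2 _] := run_map_inv H2 (fun _ => erefl); subst q3.
    by case: sl H => // x sl /= [q4 [g4 [w4 []]]].
  + move=> /size0nil ->.
    exists (CF, false), (lcs Bnd B ++ lcs Nm (SComma :: rest) ++ tables ts); split=> //.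
    apply: run_cat_intro; first by apply: run_map.
    apply: (@run_cons_intro _ _ _ _ _ (CF, false)); first by left.
    apply: run_cat_intro; first by apply: run_map.
    by apply: run_tables.
- move: (Hu); rewrite all_rcons => /andP [Hs Hu'].
  have [w [Hw Ew]] := run_halve (s == SB1) false sl.
  have Enm : lcs Nm (rcons u s ++ SComma :: rest) =
      lcs Nm (rcons u s ++ [:: SComma]) ++ lcs Nm rest by rewrite -lcs_cat -catA.
  set W := lcs Bnd B ++ _.
  have HW : run cdelta (C0, false) W (CC (s == SB1), odd (size sl))
     (lcs Bnd B ++ (lcs Nm u ++ lcs Out [:: s] ++ lcs Nm [:: SComma]) ++
      lcs Nm rest ++ w ++ tables ts).
    apply: run_cat_intro; first by apply: run_map.
    rewrite Enm -[X in run _ _ X]catA; apply: run_cat_intro; first by apply/run_arity; auto.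
    apply: run_cat_intro; first by apply: run_map.
    apply: run_cat_intro; first exact: Hw.
    by apply: run_tables.
  have Hwin v : filter relevant v = filter relevant (lcs Bnd B ++
      (lcs Nm u ++ lcs Out [:: s] ++ lcs Nm [:: SComma]) ++ lcs Nm rest ++ w ++ tables ts) ->
     gwin (SC (C0, false)) v <-> (size sl)./2 = bval u.
    move=> Ev; rewrite -[(size sl)./2]/((false + size sl)./2) addnC -(size_halve false sl).
    rewrite -IH //; apply: gwin_rel2 => //.
    rewrite {}Ev !filter_cat !filter_lcs !filter_starts !filter_tables Ew.
    by rewrite lcs_cat -!catA.
  rewrite bval_rcons; split.
  (* [run_arity] settles the only choice. Behind the comma the automaton is deterministic, so the
     run is the one of [HW]. *)
  + case=> p [v [H]].
    move: (H); rewrite {1}/W => /run_cat [q1 [v1 [v2 [H1 H2 Ev]]]].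
    have [E1 E1'] := run_map_inv H1 (fun _ => erefl); subst q1 v1; move: H2.
    rewrite Enm -[X in run _ _ X]catA => /run_cat [q2 [v3 [v4 [H2 H3 E4]]]].
    have [E2 E3] := proj1 (run_arity _ _ _ (or_introl erefl) Hu) H2; subst v2 v3 q2.
    have [E6 E7] : p = (CC (s == SB1), odd (size sl)) /\ v4 = lcs Nm rest ++ w ++ tables ts.
      apply: (cdelta_uniq _ H3); first by exists (s == SB1).
      apply: run_cat_intro; first by apply: run_map.
      apply: run_cat_intro; first exact: Hw.
      by apply: run_tables.
    subst p v v4; case=> E /Hwin <- //.
    by rewrite -E addnC -[size sl in LHS]odd_double_half.
  + move=> E; eexists; eexists; split; first exact: HW.
    have Eodd : odd (size sl) = (s == SB1) by rewrite E oddD odd_double; case: eqP.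
    split=> //; apply/Hwin => //.
    by rewrite E addnC half_bit_double.
Qed.

(** * Looking a value up *)

Lemma nth_halve (T : Type) (x0 : T) p (l : seq T) k :
  nth x0 (halve p l) k = nth x0 l (k.*2 + ~~ p).
Proof.
elim: l p k => [|x l IH] p k /=; first by rewrite !nth_nil.
case: p; last by rewrite IH /= addn0 addn1.
by case: k => [|k] //=; rewrite IH /= addn0 addn1.
Qed.

Fixpoint idx (bs : seq bool) : nat := if bs is b :: bs' then (idx bs').*2 + b else 0.

Definition select (bs : seq bool) (t : seq bool) : seq bool :=
  foldl (fun t b => halve (~~ b) t) t bs.

(** Halving by [b] keeps the entries at positions [2k + b], which strips the lowest digit of the
    index. *)
Lemma head_select bs t : head false (select bs t) = nth false t (idx bs).
Proof.
rewrite -nth0; elim: bs t => [|b bs IH] t //=.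
by rewrite IH nth_halve negbK.
Qed.

Lemma ldelta_uniq q u q1 v1 q2 v2 :
  run ldelta q u q1 v1 -> run ldelta q u q2 v2 -> q1 = q2 /\ v1 = v2.
Proof.
apply: (@run_uniq _ _ ldelta (fun _ => True)) => // {q u q1 v1 q2 v2} [[q p]] g p1 p2 _.
by case: g => [[[s [|[] w| | |]] c]|[|b|]] /=; case: q => [v|]; move=> [<-|//] [<-|//].
Qed.

Lemma run_select_table b p t : exists p' v,
  run ldelta (Some b, p) (tbits t) (Some b, p') v /\ filter relevant v = tbits (halve (p == b) t).
Proof.
elim: t p => [|x t IH] p; first by exists p, [::].
have [p' [v [H1 H2]]] := IH (~~ p).
exists p', (inr (if p == b then TB x else TX) :: v); split.
  by apply: run_cons_intro H1; left.
by rewrite /=; case: (p) (b) H2 => [] [] /= ->.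
Qed.

Lemma run_select_tables b p ts : exists p' v,
  run ldelta (Some b, p) (tables ts) (Some b, p') v /\
  filter relevant v = tables (map (halve (~~ b)) ts).
Proof.
elim: ts p => [|t ts IH] p; first by exists p, [::].
have [p1 [v1 [H1 E1]]] := run_select_table b false t.
have [p2 [v2 [H2 E2]]] := IH p1.
exists p2, (inr TH :: v1 ++ v2); split.
  apply: (@run_cons_intro _ _ _ _ _ (Some b, false)); first by left.
  exact: run_cat_intro H1 H2.
by rewrite /= filter_cat E1 E2; case: (b).
Qed.

Lemma run_tables_none p ts : exists p', run ldelta (None, p) (tables ts) (None, p') (tables ts).
Proof.
elim: ts p => [|t ts IH] p; first by exists p.
have [p' H] := IH false; exists p'.
apply: (@run_cons_intro _ _ _ _ _ (None, false)); first by left.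
by apply: run_cat_intro H; apply: run_map.
Qed.

Lemma gwin_select w B x sl ts :
  gwin (SL w (None, false)) (lcs Bnd B ++ lcs Nm x ++ starts sl ++ tables ts) <->
  gwin (SX w (X0 None)) (lcs Bnd B ++ lcs Nm x ++ tables (map (select (map snd sl)) ts)).
Proof.
elim: sl ts => [|[s b] sl IH] ts; rewrite gwin_SL.
- have [p' Ht] := run_tables_none false ts.
  have HW : run ldelta (None, false) (lcs Bnd B ++ lcs Nm x ++ starts [::] ++ tables ts)
      (None, p') (lcs Bnd B ++ lcs Nm x ++ tables ts).
    apply: run_cat_intro; first by apply: run_map.
    by apply: run_cat_intro; first by apply: run_map.
  rewrite /= map_id_in //; split.
  + by case=> p [v [H1 H2]]; have [E1 E2] := ldelta_uniq H1 HW; subst.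
  + by move=> H; exists (None, p'), (lcs Bnd B ++ lcs Nm x ++ tables ts).
- have [p' [v [Ht Et]]] := run_select_tables b false ts.
  have HW : run ldelta (None, false) (lcs Bnd B ++ lcs Nm x ++ starts ((s, b) :: sl) ++ tables ts)
      (Some b, p') (lcs Bnd B ++ lcs Nm x ++ inl (s, Out, false) :: starts sl ++ v).
    apply: run_cat_intro; first by apply: run_map.
    apply: run_cat_intro; first by apply: run_map.
    apply: (@run_cons_intro _ _ _ _ _ (Some b, false)); first by left.
    by apply: run_cat_intro Ht; apply: run_map.
  rewrite /= (eq_map (_ : _ =1 select (map snd sl) \o halve (~~ b))) // map_comp -IH.
  have Eq : gwin (SL w (None, false))
       (lcs Bnd B ++ lcs Nm x ++ inl (s, Out, false) :: starts sl ++ v) <->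
     gwin (SL w (None, false))
       (lcs Bnd B ++ lcs Nm x ++ starts sl ++ tables [seq halve (~~ b) i | i <- ts]).
    apply: gwin_rel2 => //; rewrite !filter_cat /= !filter_cat.
    by rewrite Et filter_tables.
  rewrite -Eq; split.
  + by case=> p [v' [H1 H2]]; have [E1 E2] := ldelta_uniq H1 HW; subst.
  + by move=> H; eexists; eexists; split; first exact: HW.
Qed.

(** * Comparison of names *)

Definition xlive (x : xst) : bool := if x is X0 _ then false else true.

Lemma xdelta_live x g p : xlive x -> List.In p (xdelta x g) -> xlive p.1.
Proof.
case: x => // [a|a s|a s d|a t|a t] _; case: g => [[[s' [|[] w| | |]] c]|[|b|]] //=;
  try (by case=> [<-|//]).
- by case: eqP => // _; case: is_lp => /= -[<-|//].
- by case: d => /= -[<-|//].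
- by case: d => /= -[<-|//].
- by case: d => /= -[<-|//].
- by case: d; case: eqP => //= _ -[<-|//].
- by case: d => /= -[<-|//].
- by case: d => /= -[<-|//].
- by case: d => /= -[<-|//].
- by case: d => /= -[<-|//].
- by case: d => /= -[<-|//].
Qed.

(** The guess between match and mismatch, made when [X0] meets a bound symbol, is the only
    nondeterminism of a lookup sweep. *)
Lemma xdelta_uniq x u x1 v1 x2 v2 : xlive x ->
  run xdelta x u x1 v1 -> run xdelta x u x2 v2 -> x1 = x2 /\ v1 = v2.
Proof.
apply: (@run_uniq _ _ xdelta xlive) => {x u x1 v1 x2 v2}; last first.
  by move=> *; apply: xdelta_live; eauto.
move=> x g p1 p2.
case: x => // [a|a s|a s d|a t|a t] _; case: g => [[[s' [|[] w| | |]] c]|[|b|]] //=;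
  try (by case=> [<-|//] [<-|//]).
- by case: eqP => // _; case: is_lp => /= -[<-|//] [<-|//].
all: case: d => /=; try (case: eqP => //= _); by move=> -[<-|//] [<-|//].
Qed.

Lemma run_live x u x' u' : xlive x -> run xdelta x u x' u' -> xlive x'.
Proof.
elim: u x u' => [|g u IH] x u' lx /=; first by case=> ->.
by case=> y [g' [w' [H1 H2 _]]]; apply: IH H2; apply: (xdelta_live lx H1).
Qed.

(** While a bound name remains, every run ends in a live state, so the verdict on the stored value
    cannot be reached too early. *)
Lemma gwin_SX_bnd w a s W : gwin (SX w (X0 a)) (inl (s, Bnd, false) :: W) <->
  exists x v, (run xdelta (XM a s) W x v \/ run xdelta (XN a s (~~ is_lp s)) W x v) /\
    exists b, xnext x = Some b /\ gwin (SX w (X0 b)) v.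
Proof.
have Eo b v : gwin (SX w (X0 b)) (inl (s, Out, false) :: v) <-> gwin (SX w (X0 b)) v.
  exact: gwin_rel2.
rewrite gwin_SX; split.
- case=> x [v [[y [g [v' [Hin H ->]]]] Hx]]; exists x, v'.
  have {Hin} [Eg Hr] : g = inl (s, Out, false) /\
     (run xdelta (XM a s) W x v' \/ run xdelta (XN a s (~~ is_lp s)) W x v').
    by case: Hin H => [[<- <-]|[[<- <-]|//]]; auto.
  subst g; split=> //; case: Hx => [[b [E _]]|[b [E Hb]]]; last by exists b; split=> //; apply/Eo.
  have : xlive x by case: Hr => /run_live; apply.
  by rewrite E.
- case=> x [v [Hr [b [E Hb]]]]; exists x, (inl (s, Out, false) :: v); split.
    by case: Hr => Hr; apply: run_cons_intro Hr; [left|right; left].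
  by right; exists b; split=> //; apply/Eo.
Qed.

Lemma run_erase a t : exists x,
  run xdelta (XT2 a false) (tbits t) (XT2 a false) x /\ filter relevant x = [::].
Proof.
by elim: t => [|b t [v [H1 H2]]]; [exists [::]|exists (inr TX :: v); split=> //;
  apply: run_cons_intro H1; left].
Qed.

(** An empty table reads as 0: it shows by the next [TH] or by the end of the tape, and in both
    cases [Some false] is stored, in accordance with [head false]. *)
Lemma run_erase_table a take t ts : exists x v,
  [/\ run xdelta (XT1 a take) (tables (t :: ts)) x v, filter relevant v = tables ts
    & xnext x = Some (if take then Some (head false t) else a)].
Proof.
have H0 a' take' : exists x, run xdelta (XT2 a' take') (tables ts) x (tables ts) /\
    xnext x = Some (if take' then Some false else a').
  case: (ts) => [|t1 ts']; first by exists (XT2 a' take').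
  exists (XP (if take' then Some false else a')); split=> //.
  apply: (@run_cons_intro _ _ _ _ _ (XP (if take' then Some false else a'))); first by left.
  by apply: run_cat_intro; [apply: run_map|apply: run_tables].
case: t => [|b t].
  have [x [H E]] := H0 a take; exists x, (inr TX :: tables ts); split=> //.
    by apply: run_cons_intro H; left.
  by rewrite /= filter_tables.
have [x [H E]] := H0 (if take then Some b else a) false.
have [v [Hv Ev]] := run_erase (if take then Some b else a) t.
exists x, (inr TX :: inr TX :: v ++ tables ts); split.
- do 2 (apply: run_cons_intro; first by left).
  exact: run_cat_intro Hv H.
- by rewrite /= filter_cat Ev filter_tables.
- by rewrite E; case: take {H E Hv Ev}.
Qed.

Lemma run_XM_inv a s B c s' W x v :
  run xdelta (XM a s) (lcs Bnd B ++ lcs Nmc c ++ inl (s', Nm, false) :: W) x v -> s' = s.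
Proof.
case/run_cat=> x1 [v1 [v2 [H1 H2 _]]].
have [E _] := run_map_inv H1 (fun _ => erefl); subst x1.
case/run_cat: H2 => x1 [v3 [v4 [H2 H3 _]]].
have [E _] := run_map_inv H2 (fun _ => erefl); subst x1.
by case: H3 => y [g [w []]] /=; case: eqP.
Qed.

(** [D] is what is left of the bound name behind [s]: it reaches up to its [SLP], and is empty if
    [s] was that [SLP]. The compared symbols [c] of the other name are reset for the next bound
    name. *)
Lemma run_drop a s B D B' c : B = ~~ nilp D ->
  (D = [::] \/ exists d, D = rcons d SLP /\ ~~ has is_lp d) ->
  run xdelta (XN a s B) (lcs Bnd D ++ lcs Bnd B' ++ lcs Nmc c) (XN a s false)
    (lcs Out D ++ lcs Bnd B' ++ lcs Nm c).
Proof.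
move=> HB HD; apply: run_cat_intro; last first.
  by apply: run_cat_intro; apply: run_map.
case: HD HB => [->|[d [-> Hd]]]; first by move=> ->.
have -> : nilp (rcons d SLP) = false by case: d {Hd}.
move=> ->; elim: d Hd => [|y d IH].
  by move=> _; apply: (@run_cons_intro _ _ _ _ _ (XN a s false)); first by left.
rewrite [has _ _]/= negb_or rcons_cons => /andP [Hy /IH H].
by apply: run_cons_intro H; rewrite /= Hy; left.
Qed.

Lemma run_XN_inv a s d B c s' W x v :
  run xdelta (XN a s d) (lcs Bnd B ++ lcs Nmc c ++ inl (s', Nm, false) :: W) x v -> s' <> s.
Proof.
elim: B d v => [|y B IH] d v /=; last first.
  by case=> q [g [w [+ H _]]]; case: d => -[[E _]|//]; subst q; apply: IH H.
case/run_cat=> x1 [v1 [v2 [H2 H3 _]]].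
have Hd y : xdelta (XN a s d) (inl (y, Nmc, false)) = [:: (XN a s d, inl (y, Nm, false))].
  by case: (d).
have [E _] := run_map_inv H2 Hd.
by subst x1; case: H3 => y [g [w []]] /=; case: (d); case: eqP.
Qed.

Lemma gwin_mismatch w a s s' D B' c r t ts : s <> s' ->
  (if is_lp s then D = [::] else exists d, D = rcons d SLP /\ ~~ has is_lp d) ->
  gwin (SX w (X0 a)) (lcs Bnd (s :: D ++ B') ++ lcs Nmc c ++ lcs Nm (s' :: r) ++ tables (t :: ts))
  <-> gwin (SX w (X0 a)) (lcs Bnd B' ++ lcs Nm (c ++ s' :: r) ++ tables ts).
Proof.
move=> ss' HD; rewrite [lcs Bnd (s :: _)]/= -/(lcs Bnd (D ++ B')) cat_cons gwin_SX_bnd.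
have [x [v [Hv Ev Ex]]] := run_erase_table a false t ts.
have HD' : ~~ is_lp s = ~~ nilp D.
  by case: is_lp HD => [->|[[|y d] [-> _]]].
have HD'' : D = [::] \/ exists d, D = rcons d SLP /\ ~~ has is_lp d.
  by case: is_lp HD => H; [left|right].
have HN : run xdelta (XN a s (~~ is_lp s))
    (lcs Bnd (D ++ B') ++ lcs Nmc c ++ lcs Nm (s' :: r) ++ tables (t :: ts)) x
    ((lcs Out D ++ lcs Bnd B' ++ lcs Nm c) ++ lcs Nm (s' :: r) ++ v).
  have -> : lcs Bnd (D ++ B') ++ lcs Nmc c ++ lcs Nm (s' :: r) ++ tables (t :: ts) =
     (lcs Bnd D ++ lcs Bnd B' ++ lcs Nmc c) ++ lcs Nm (s' :: r) ++ tables (t :: ts).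
    by rewrite lcs_cat -!catA.
  apply: run_cat_intro; first exact: run_drop.
  apply: (@run_cons_intro _ _ _ _ _ (XT1 a false)).
    by rewrite /=; case: eqP => [E|_]; [case: ss'|left].
  by apply: run_cat_intro Hv; apply: run_map.
have Eq : gwin (SX w (X0 a)) ((lcs Out D ++ lcs Bnd B' ++ lcs Nm c) ++ lcs Nm (s' :: r) ++ v)
  <-> gwin (SX w (X0 a)) (lcs Bnd B' ++ lcs Nm (c ++ s' :: r) ++ tables ts).
  apply: gwin_rel2 => //.
  by rewrite !filter_cat !filter_lcs Ev filter_tables /= lcs_cat -!catA.
rewrite -Eq; split.
- case=> y [v' [[/run_XM_inv E|H] [b [Eb Hb]]]]; first by case: ss'.
  have [E1 E2] := xdelta_uniq (isT : xlive (XN a s _)) H HN; subst y v'.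
  by move: Eb; rewrite Ex => -[E]; subst b.
- move=> H; exists x; eexists; split; first by right; exact: HN.
  by exists a.
Qed.

Lemma gwin_match w a s B' c r ts : ~~ is_lp s ->
  gwin (SX w (X0 a)) (lcs Bnd (s :: B') ++ lcs Nmc c ++ lcs Nm (s :: r) ++ tables ts)
  <-> gwin (SX w (X0 a)) (lcs Bnd B' ++ lcs Nmc (rcons c s) ++ lcs Nm r ++ tables ts).
Proof.
move=> Hs; rewrite [lcs Bnd (s :: _)]/= -/(lcs Bnd B') cat_cons gwin_SX_bnd.
have HM : run xdelta (XM a s) (lcs Bnd B' ++ lcs Nmc c ++ lcs Nm (s :: r) ++ tables ts) (XP a)
    (lcs Bnd B' ++ lcs Nmc c ++ inl (s, Nmc, false) :: lcs Nm r ++ tables ts).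
  apply: run_cat_intro; first by apply: run_map.
  apply: run_cat_intro; first by apply: run_map => y; rewrite /= (negbTE Hs).
  apply: (@run_cons_intro _ _ _ _ _ (XP a)).
    by rewrite /= eqxx (negbTE Hs); left.
  by apply: run_cat_intro; [apply: run_map|apply: run_tables].
have <- : lcs Bnd B' ++ lcs Nmc c ++ inl (s, Nmc, false) :: lcs Nm r ++ tables ts =
    lcs Bnd B' ++ lcs Nmc (rcons c s) ++ lcs Nm r ++ tables ts.
  by rewrite -cats1 lcs_cat -!catA.
split.
- case=> y [v' [[H|H] [b [Eb Hb]]]].
    have [E1 E2] := xdelta_uniq (isT : xlive (XM a s)) H HM; subst y v'.
    by case: Eb => E; subst b.
  by have := run_XN_inv H.
- by move=> H; exists (XP a); eexists; split; [left; exact: HM|exists a].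
Qed.

Lemma gwin_match_end w a B' c t ts :
  gwin (SX w (X0 a)) (lcs Bnd (SLP :: B') ++ lcs Nmc c ++ lcs Nm [:: SLP] ++ tables (t :: ts))
  <-> gwin (SX w (X0 (Some (head false t)))) (lcs Bnd B' ++ lcs Nm (rcons c SLP) ++ tables ts).
Proof.
rewrite [lcs Bnd (SLP :: _)]/= -/(lcs Bnd B') cat_cons gwin_SX_bnd.
have [x [v [Hv Ev Ex]]] := run_erase_table a true t ts.
have HM : run xdelta (XM a SLP) (lcs Bnd B' ++ lcs Nmc c ++ lcs Nm [:: SLP] ++ tables (t :: ts)) x
    (lcs Bnd B' ++ lcs Nm c ++ inl (SLP, Nm, false) :: v).
  apply: run_cat_intro; first by apply: run_map.
  apply: run_cat_intro; first by apply: run_map.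
  apply: (@run_cons_intro _ _ _ _ _ (XT1 a true)); last exact: Hv.
  by rewrite /= eqxx; left.
have Eq : gwin (SX w (X0 (Some (head false t))))
    (lcs Bnd B' ++ lcs Nm c ++ inl (SLP, Nm, false) :: v)
  <-> gwin (SX w (X0 (Some (head false t)))) (lcs Bnd B' ++ lcs Nm (rcons c SLP) ++ tables ts).
  apply: gwin_rel2 => //.
  by rewrite !filter_cat /= !filter_lcs Ev filter_tables -cats1 lcs_cat -!catA.
rewrite -Eq; split.
- case=> y [v' [[H|H] [b [Eb Hb]]]].
    have [E1 E2] := xdelta_uniq (isT : xlive (XM a SLP)) H HM; subst y v'.
    by move: Eb; rewrite Ex => -[E]; subst b.
  by have := run_XN_inv H.
- move=> H; exists x; eexists; split; first by left; exact: HM.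
  by exists (Some (head false t)).
Qed.

(** The terminator [SLP] makes names prefix-free, so unequal names differ at a position that both
    possess, possibly in a bit against [SLP]. One sweep per matching symbol leads there. *)
Lemma gwin_compare w a b B' c r t ts : ~~ has is_lp b -> ~~ has is_lp r ->
  gwin (SX w (X0 a)) (lcs Bnd (rcons b SLP ++ B') ++ lcs Nmc c ++ lcs Nm (rcons r SLP) ++
     tables (t :: ts))
  <-> gwin (SX w (X0 (if b == r then Some (head false t) else a)))
     (lcs Bnd B' ++ lcs Nm (rcons (c ++ r) SLP) ++ tables ts).
Proof.
elim: b c r => [|s b IH] c [|s' r]; rewrite /= ?negb_or.
- by move=> _ _; rewrite gwin_match_end cats0.
- move=> _ /andP [Hs' _]; rewrite rcons_cat; apply: (@gwin_mismatch w a SLP s' [::] B' c) => //.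
  by move=> E; rewrite -E in Hs'.
- move=> /andP [Hs Hb] _; rewrite cats0 -[rcons c SLP]cats1.
  apply: (@gwin_mismatch w a s SLP (rcons b SLP) B' c [::]).
    by move=> E; rewrite E in Hs.
  by rewrite (negbTE Hs); exists b.
- move=> /andP [Hs Hb] /andP [_ Hr]; rewrite eqseq_cons rcons_cat.
  case: eqP => [<-|ne] /=.
    have -> : c ++ s :: rcons r SLP = rcons (rcons c s ++ r) SLP by rewrite rcons_cat cat_rcons.
    by rewrite -IH //; apply: (@gwin_match w a s _ c (rcons r SLP)).
  apply: (@gwin_mismatch w a s s' (rcons b SLP) B' c) => //.
  by rewrite (negbTE Hs); exists b.
Qed.

Definition lookup (x : seq sym) (a : option bool) (nts : seq (seq sym * seq bool)) : option bool :=
  foldl (fun a nt => if nt.1 == x then Some (head false nt.2) else a) a nts.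

Lemma gwin_lookup w a x nts : ~~ has is_lp x -> all (fun nt => ~~ has is_lp nt.1) nts ->
  gwin (SX w (X0 a)) (lcs Bnd (flatten [seq rcons nt.1 SLP | nt <- nts]) ++
     lcs Nm (rcons x SLP) ++ tables (map snd nts))
  <-> lookup x a nts = Some w.
Proof.
move=> Hx; elim: nts a => [|[n t] nts IH] a.
- move=> _; rewrite gwin_SX /= cats0.
  split.
  + case=> y [v [H]]; have [-> _] := run_map_inv H (fun _ => erefl).
    by case=> [[b [[<-] ->]]|[b []]].
  + move=> ->; eexists; eexists; split; last by left; exists (Some w).
    exact: (@run_map _ _ _ xdelta (X0 (Some w)) (fun s => inl (s, Nm, false))
      (fun s => inl (s, Nm, false))).
- by move=> /= /andP [Hn Hns]; rewrite -(IH _ Hns); apply: (@gwin_compare _ _ n _ [::] x).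
Qed.

(** * Writing tables *)

Definition qtab (k : bool) (n : nat) (P : seq bool -> Prop) : Prop :=
  if k then exists t, size t = n /\ P t else forall t, size t = n -> P t.

Lemma qtab_iff k n P P' : (forall t, size t = n -> P t <-> P' t) -> qtab k n P <-> qtab k n P'.
Proof.
move=> H; case: k; split.
- by case=> t [Ht /H -/(_ Ht) Hp]; exists t.
- by case=> t [Ht /H -/(_ Ht) Hp]; exists t.
- by move=> Hp t Ht; apply/H/Hp.
- by move=> Hp t Ht; apply/H; [|apply: Hp].
Qed.

Lemma qtab1 k P : qtab k 1 P <-> if k then exists b, P [:: b] else forall b, P [:: b].
Proof.
case: k; split.
- by case=> -[|b [|c t]] [] // _ H; exists b.
- by case=> b H; exists [:: b].
- by move=> H b; apply: H.
- by move=> H [|b [|]].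
Qed.

Lemma qtabS k n P : qtab k n.+1 P <->
  if k then exists b, qtab k n (fun t => P (b :: t)) else forall b, qtab k n (fun t => P (b :: t)).
Proof.
case: k; split.
- by case=> -[|b t] [] // [Ht] H; exists b, t.
- by case=> b [t [Ht H]]; exists (b :: t); rewrite /= Ht.
- by move=> H b t Ht; apply: H; rewrite /= Ht.
- by move=> H [|b t] // [Ht]; apply: H.
Qed.

Lemma gdelta_uniq q u q1 v1 q2 v2 :
  run gdelta q u q1 v1 -> run gdelta q u q2 v2 -> q1 = q2 /\ v1 = v2.
Proof.
apply: (@run_uniq _ _ gdelta (fun _ => True)) => // {q u q1 v1 q2 v2} q g p1 p2 _.
by case: q => [|b]; case: g => [[[s l] c]|t] /= [<-|//] [<-|//].
Qed.

Lemma gwin_SG k p u p' v : run gdelta p u p' v -> gwin (SG k p) u <->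
  (if k then exists q' o, List.In (q', o) (gfin (SG k p')) /\ gwin q' (v ++ oseq o)
   else forall q' o, List.In (q', o) (gfin (SG k p')) -> gwin q' (v ++ oseq o)).
Proof.
move=> Hr; case: k.
- rewrite (win_embed_ex (f := SG true) (d := gdelta)) //; split.
  + case=> p1 [v1 [q' [o [H1 H2 H3]]]]; have [E1 E2] := gdelta_uniq H1 Hr; subst.
    by exists q', o.
  + by case=> q' [o [H1 H2]]; exists p', v, q', o.
- rewrite (win_embed_un (f := SG false) (d := gdelta)) //; split.
  + by move=> H q' o Hin; apply: H Hr Hin.
  + move=> H p1 v1 q' o H1; have [E1 E2] := gdelta_uniq H1 Hr; subst; exact: H.
Qed.

Definition cval (tx : seq (sym * lab * bool)) : nat :=
  foldr (fun (p : sym * lab * bool) n => n.*2 + p.2) 0 tx.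

Lemma cval_lt tx : cval tx < 2 ^ size tx.
Proof. by elim: tx => //= -[p b] tx IH; rewrite expnS /=; case: b => /=; lia. Qed.

Definition cleared (tx : seq (sym * lab * bool)) := [seq (p.1, false) | p <- tx].

Lemma cval0 tx : cval tx = 0 -> cleared tx = tx.
Proof.
elim: tx => //= -[p b] tx IH /=; case: b => /=; first by lia.
by rewrite addn0 => E; rewrite -[in RHS]IH //; lia.
Qed.

Lemma run_incr b tx : exists b' tx',
  [/\ run gdelta (Gc b) (map inl tx) (Gc b') (map inl tx'),
      cval tx' + b' * 2 ^ size tx = cval tx + b, size tx' = size tx
    & cleared tx' = cleared tx].
Proof.
elim: tx b => [|[[s l] c] tx IH] b; first by exists b, [::]; rewrite /= muln1.
have [b' [tx' [H1 H2 H3 H4]]] := IH (b && c).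
exists b', ((s, l, b (+) c) :: tx'); split.
- by apply: run_cons_intro H1; left.
- by rewrite [size _]/= expnS /=; move: H2; case: (b) (c) => [] [] /=; lia.
- by rewrite /= H3.
- by rewrite /= H4.
Qed.

(** The counter is [n + 1] short of overflow, so the carry leaves the text exactly with the last of
    the [n + 1] bits. The counter is then 0 again, ready for the next table. *)
Lemma gwin_bits n k tx tb : cval tx + n.+1 = 2 ^ size tx ->
  gwin (SG k (Gc true)) (map inl tx ++ map inr tb) <->
  qtab k n.+1 (fun t => gwin (SQ None) (map inl (cleared tx) ++ map inr tb ++ tbits t)).
Proof.
elim: n tx tb => [|n IH] tx tb Hn.
all: have [b' [tx' [H1 H2 H3 H4]]] := run_incr true tx.
all: have HW : run gdelta (Gc true) (map inl tx ++ map inr tb) (Gc b') (map inl tx' ++ map inr tb)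
  by apply: run_cat_intro H1 _; apply: run_map.
all: rewrite (gwin_SG _ HW).
- have {H1 HW} [Eb E0] : b' = true /\ cval tx' = 0.
    by have := cval_lt tx'; rewrite H3; case: b' H2 {H1 HW} => /=; lia.
  rewrite Eb -H4 (cval0 E0) qtab1; case: k => /=; split.
  + by case=> q' [o [[[<- <-]|[[<- <-]|//]]]]; rewrite -catA => H; [exists true|exists false].
  + case=> b; rewrite catA => H.
    by exists (SQ None), (Some (inr (TB b))); split=> //; case: (b); auto.
  + move=> H b; rewrite catA; apply: (H _ (Some (inr (TB b)))).
    by case: (b); auto.
  + by move=> H q' o [[<- <-]|[[<- <-]|//]]; rewrite -catA; apply: H.
- have {H1 HW} [Eb E0] : b' = false /\ cval tx' + n.+1 = 2 ^ size tx'.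
    by have := cval_lt tx'; rewrite H3; case: b' H2 {H1 HW} => /=; lia.
  have IH' b := IH tx' (rcons tb (TB b)) E0.
  have Ecat b : (map inl tx' ++ map inr tb) ++ [:: inr (TB b)] =
      map inl tx' ++ map inr (rcons tb (TB b)) :> seq cell by rewrite map_rcons -cats1 -catA.
  have Ecat2 b t : map inl (cleared tx') ++ map inr (rcons tb (TB b)) ++ tbits t =
      map inl (cleared tx) ++ map inr tb ++ tbits (b :: t) :> seq cell.
    by rewrite H4 map_rcons -cats1 -!catA.
  have {IH'} Hb b : gwin (SG k (Gc true)) ((map inl tx' ++ map inr tb) ++ [:: inr (TB b)]) <->
      qtab k n.+1 (fun t => gwin (SQ None)
        (map inl (cleared tx) ++ map inr tb ++ tbits (b :: t))).
    by rewrite Ecat IH'; apply: qtab_iff => t _; rewrite Ecat2.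
  rewrite qtabS Eb; case: k {IH} Hb => /= Hb; split.
  + by case=> q' [o [[[<- <-]|[[<- <-]|//]] /Hb H]]; [exists true|exists false].
  + case=> b /Hb H.
    by exists (SG true (Gc true)), (Some (inr (TB b))); split=> //; case: (b); auto.
  + move=> H b; apply/Hb; apply: (H _ (Some (inr (TB b)))).
    by case: (b); auto.
  + by move=> H q' o [[<- <-]|[[<- <-]|//]]; apply/Hb; apply: H.
Qed.

Definition tc (p : sym * lab) : cell := inl (p, false).

Lemma cval_clear (W : seq (sym * lab)) : cval [seq (p, false) | p <- W] = 0.
Proof. by elim: W => //= p W ->. Qed.

Lemma gwin_table k W ts : gwin (SG k G0) (map tc W ++ tables ts) <->
  qtab k (2 ^ size W) (fun t => gwin (SQ None) (map tc W ++ tables (rcons ts t))).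
Proof.
have HW : run gdelta G0 (map tc W ++ tables ts) G0 (map tc W ++ tables ts) by apply/run_id.
set tb := rcons [seq (if o is Some b then TB b else TH) | o <- tcells ts] TH.
have Etb : (map tc W ++ tables ts) ++ [:: inr TH] =
    map inl [seq (p, false) | p <- W] ++ map inr tb :> seq cell.
  by rewrite /tb map_rcons -cats1 -!catA tablesE -!map_comp.
have -> : gwin (SG k G0) (map tc W ++ tables ts) <->
    gwin (SG k (Gc true)) ((map tc W ++ tables ts) ++ [:: inr TH]).
  rewrite (gwin_SG _ HW); case: k => /=; split.
  + by case=> q' [o [[[<- <-]|//]]].
  + by move=> H; eexists; eexists; split; first by left.
  + by move=> H; apply: (H _ (Some (inr TH))); left.
  + by move=> H q' o [[<- <-]|//].
rewrite Etb.
have Hs : cval [seq (p, false) | p <- W] + (2 ^ size W).-1.+1 = 2 ^ size [seq (p, false) | p <- W].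
  by rewrite cval_clear size_map prednK ?expn_gt0.
rewrite (gwin_bits _ _ Hs) prednK ?expn_gt0 //; apply: qtab_iff => t _.
suff -> : map inl (cleared [seq (p, false) | p <- W]) ++ map inr tb ++ tbits t =
  map tc W ++ tables (rcons ts t) :> seq cell by [].
rewrite /cleared -!map_comp; congr (_ ++ _).
by rewrite /tb map_rcons -cats1 -!catA -map_comp -tablesE /tables map_rcons flatten_rcons.
Qed.

(** * Guessing the outermost connective *)

Definition slabs (f b : bool) (z : seq sym) : seq (sym * lab) :=
  if z is s :: z' then (s, Seg f b) :: [seq (x, Seg false b) | x <- z'] else [::].

Inductive item := IO of sym | IB of sym | IN of sym | IS of seq sym & bool.

Definition ilabs (i : item) : seq (sym * lab) :=
  match i with
  | IO s => [:: (s, Out)] | IB s => [:: (s, Bnd)] | IN s => [:: (s, Nm)]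
  | IS z b => slabs true b z
  end.

Definition labs (its : seq item) : seq (sym * lab) := flatten (map ilabs its).
Definition word (its : seq item) (ts : seq (seq bool)) : seq cell :=
  map tc (labs its) ++ tables ts.

Lemma labs_cat a b : labs (a ++ b) = labs a ++ labs b.
Proof. by rewrite /labs map_cat flatten_cat. Qed.

Lemma labs_map (f : sym -> item) l x : (forall s, ilabs (f s) = [:: (s, l)]) ->
  labs (map f x) = [seq (s, l) | s <- x].
Proof. by move=> H; elim: x => //= s x IH; rewrite -IH /labs /= H. Qed.

Definition inert (i : item) : bool := match i with IO _ | IB _ => true | _ => false end.

Fixpoint parses (v : bool) (m : mst) (x : seq sym) (r : result) (w : seq (sym * lab)) : Prop :=
  if x is s :: x' then exists m1 l w',
    [/\ List.In (m1, l) (mseg m s v), parses v m1 x' r w' & w = (s, l) :: w']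
  else List.In r (mresult m) /\ w = [::].

Definition nonseg (g : cell) : bool := if g is inl (_, Seg _ _, _) then false else true.

Lemma mdelta_nonseg m g : nonseg g -> mdelta m g = List.map (fun m' => (m', g)) (mskip m).
Proof. by case: g => [[[s [|f b| | |]] c]|t]. Qed.

Lemma run_nonseg m Z r u' : all nonseg Z ->
  (exists m', run mdelta m Z m' u' /\ List.In r (mresult m')) <->
  List.In r (mresult m) /\ u' = Z.
Proof.
elim: Z m u' => [|g Z IH] m u' /=.
  by split; [case=> m' [[-> ->] Hr]|case=> Hr ->; exists m].
case/andP=> Hg HZ; rewrite mdelta_nonseg //; split.
- case=> m' [[m1 [g' [w [/List.in_map_iff [m2 [[<- <-] Hm]] H2 ->]]]] Hr].
  have [|H3 ->] := proj1 (IH m2 w HZ); first by exists m'.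
  by split=> //; case: m Hm H3 => [|b|a b n|[] [b|a b|b|b|a b]|b|r'] //= [<-|//].
- case=> Hr ->.
  have [m1 [Hm Hr1]] : exists m1, List.In m1 (mskip m) /\ List.In r (mresult m1).
    case: m Hr => [|b|a b n|[] [b|a b|b|b|a b]|b|r0] //= Hr.
    + by exists (MEnd (RQ None)); split=> //; left.
    + by exists (MEnd r0); split=> //; left.
  have [|m' [H1 H2]] := proj2 (IH m1 Z HZ); first by [].
  exists m'; split=> //; exists m1, g, Z; split=> //.
  by apply/List.in_map_iff; exists m1.
Qed.

(** The automaton reads the claimed value of a cell but not its flag, hence the arbitrary flags.
    This lets the initial tape, on which no cell is flagged, count as a segment. *)
Lemma run_parses v m (xf : seq (sym * bool)) Z r u' : all nonseg Z ->
  (exists m', run mdelta m ([seq tc (p.1, Seg p.2 v) | p <- xf] ++ Z) m' u' /\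
     List.In r (mresult m')) <->
  exists w, parses v m (map fst xf) r w /\ u' = map tc w ++ Z.
Proof.
move=> HZ; elim: xf m u' => [|[s f] xf IH] m u' /=.
  rewrite run_nonseg //; split; [case=> Hr ->|case=> w [[Hr ->] ->] //]; by exists [::].
split.
- case=> m' [[m1 [g [w [/List.in_map_iff [[m2 l] [[<- <-] H1]] H2 ->]]]] Hr].
  have [|w' [H3 ->]] := proj1 (IH m2 w); first by exists m'.
  by exists ((s, l) :: w'); split=> //; exists m2, l, w'.
- case=> w [[m1 [l [w' [H1 H2 ->]]]] ->].
  have [|m' [H3 H4]] := proj2 (IH m1 (map tc w' ++ Z)); first by exists w'.
  exists m'; split=> //; exists m1, (tc (s, l)), (map tc w' ++ Z); split=> //.
  by apply/List.in_map_iff; exists (m1, l).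
Qed.

Lemma slabsE v x : exists xf, map fst xf = x /\
  map tc (slabs true v x) = [seq tc (p.1, Seg p.2 v) | p : sym * bool <- xf].
Proof.
case: x => [|s x]; first by exists [::].
exists ((s, true) :: [seq (y, false) | y <- x]); split.
  by rewrite /= -map_comp map_id.
by rewrite /= -!map_comp.
Qed.

Lemma inert_nonseg its : all inert its -> all nonseg (map tc (labs its)).
Proof. by elim: its => //= -[s|s|s|z b] its IH //= /IH. Qed.

Lemma tables_nonseg ts : all nonseg (tables ts).
Proof. by rewrite tablesE; elim: tcells. Qed.

Lemma gwin_main v x pre post ts : all inert pre -> all inert post ->
  gwin (SM M0) (word (pre ++ IS x v :: post) ts) <->
  exists r w, parses v M0 x r w /\
    gwin (gstart r) (map tc (labs pre ++ w ++ labs post) ++ tables ts).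
Proof.
move=> Hpre Hpost; have [xf [E1 E2]] := slabsE v x.
have HZ : all nonseg (map tc (labs post) ++ tables ts).
  by rewrite all_cat inert_nonseg ?tables_nonseg.
have EW : word (pre ++ IS x v :: post) ts = map tc (labs pre) ++
    [seq tc (p.1, Seg p.2 v) | p <- xf] ++ map tc (labs post) ++ tables ts.
  rewrite /word labs_cat -[labs (IS x v :: post)]/(slabs true v x ++ labs post).
  by rewrite !map_cat E2 -!catA.
have Hskip : run mdelta M0 (map tc (labs pre)) M0 (map tc (labs pre)).
  elim: pre Hpre {EW} => //= i pre IH /andP [Hi /IH H].
  by case: i Hi => // s _; apply: run_cons_intro H; left.
have Hskip' q w : run mdelta M0 (map tc (labs pre)) q w -> q = M0 /\ w = map tc (labs pre).
  elim: pre Hpre {EW Hskip} w => /= [_ w|i pre IH /andP [Hi /IH H] w]; first by case=> -> ->.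
  by case: i Hi => // s _ /= [q1 [g [w' [[[<- <-]|//] /H [-> ->] ->]]]].
rewrite gwin_SM EW; split.
- case=> m [u [r [/run_cat [q1 [v1 [v2 [/Hskip' [-> ->] H2 ->]]]] Hr Hw]]].
  have [|w [H3 E3]] := proj1 (run_parses v M0 xf r v2 HZ); first by exists m.
  exists r, w; split; first by rewrite -E1.
  by rewrite !map_cat -!catA -E3.
- case=> r [w [Hp Hw]]; rewrite -E1 in Hp.
  have [|m [H3 H4]] := proj2 (run_parses v M0 xf r
      (map tc w ++ map tc (labs post) ++ tables ts) HZ).
    by exists w.
  exists m; eexists; exists r; split; [exact: run_cat_intro Hskip H3|by []|].
  by move: Hw; rewrite !map_cat -!catA.
Qed.

Lemma parses_end v r0 x r w : parses v (MEnd r0) x r w <-> [/\ x = [::], r = r0 & w = [::]].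
Proof.
case: x => [|s x] /=; split.
- by case=> [[->|//] ->].
- by case=> _ -> ->; split=> //; left.
- by case=> m [l [w' []]].
- by case.
Qed.

(** A negated subformula runs to the end of the segment. Any other one stops before an occurrence of
    a suitable delimiter, whichever is guessed: parentheses are not matched. *)
Lemma parses_run v st c x r w : parses v (MRun st c) x r w <->
  (exists b, [/\ c = NotT b, st || ~~ nilp x, r = RQ None & w = slabs (~~ st) b x]) \/
  (exists z s y m1 w', [/\ x = z ++ s :: y, st || ~~ nilp z, List.In m1 (mafter c s),
     parses v m1 y r w' & w = slabs (~~ st) (rval c) z ++ (s, Out) :: w']).
Proof.
elim: x st w => [|s x IH] st w; split.
- case=> Hr ->; left; case: st c Hr => -[] //= b [<-|//]; by exists b.
- case=> [[b [-> + -> ->]]|[[|? ?] [s [y [m1 [w' []]]]]]] //.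
  by rewrite orbF => -> /=; split=> //; left.
- case=> m1 [l [w' [+ H ->]]]; rewrite /mseg; case=> [[E1 E2]|Hin].
  + subst m1 l; case/IH: H => [[b [-> _ -> ->]]|[z [s' [y [m1 [w1 [-> _ H1 H2 ->]]]]]]].
      left; exists b; split=> //; first by rewrite orbT.
      by case: (x).
    right; exists (s :: z), s', y, m1, w1; split=> //; first by rewrite orbT.
    by case: (z).
  + right; case: st Hin => // /List.in_map_iff [m2 [[E1 E2] Hin]]; subst m1 l.
    by exists [::], s, x, m2, w'.
- case=> [[b [Ec _ Er ->]]|[[|s1 z] [s' [y [m1 [w1 [[E1 E2] Hst H1 H2 ->]]]]]]].
  + subst c r; exists (MRun true (NotT b)), (Seg (~~ st) b), (slabs false b x); split.
    * by left.
    * by apply/IH; left; exists b.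
    * by case: (x).
  + subst s' y; rewrite orbF in Hst; case: st Hst => // _.
    exists m1, Out, w1; split=> //; right; apply/List.in_map_iff; by exists m1.
  + subst s1 x; exists (MRun true c), (Seg (~~ st) (rval c)).
    exists (slabs false (rval c) z ++ (s', Out) :: w1).
    split; [by left| |by case: (z)].
    by apply/IH; right; exists z, s', y, m1, w1.
Qed.

Fixpoint naccept (x : nst) (nm : seq sym) : bool :=
  if nm is s :: nm' then
    match nstep x s with Some (Some y) => naccept y nm' | _ => false end
  else match nstep x SLP with Some None => true | _ => false end.

Lemma parses_name v app v' n x r w : parses v (MName app v' n) x r w <->
  exists nm y m1 w', [/\ naccept n nm, x = nm ++ SLP :: y, List.In m1 (mname_end app v'),
    parses v m1 y r w' & w = [seq (s, if app then Nm else Bnd) | s <- rcons nm SLP] ++ w'].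
Proof.
elim: x n w => [|s x IH] n w /=; split.
- by case.
- by case=> -[|? ?] [y [m1 [w' []]]].
- case=> m1 [l [w' []]]; case E: (nstep n s) => [[n'|]|] //.
  + case=> [[<- <-]|//] /IH [nm [y [m2 [w1 [H1 -> H2 H3 ->]]]]] ->.
    by exists (s :: nm), y, m2, w1; split=> //=; rewrite E.
  + move=> /List.in_map_iff [m2 [[E1 E2] Hin]] H ->; subst m1 l.
    have Es : s = SLP by case: (n) (s) E => [] [].
    by subst s; exists [::], x, m2, w'; split=> //=; rewrite E.
- case=> -[|s1 nm] [y [m1 [w1 [Hn [E1 E2] H1 H2 ->]]]].
  + subst s y; exists m1, (if app then Nm else Bnd), w1; split=> //.
    by move: Hn => /=; case: (nstep n SLP) => [[]|] // _; apply/List.in_map_iff; exists m1.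
  + subst s1 x; move: Hn => /=; case E: (nstep n s) => [[n'|]|] // Hn.
    exists (MName app v' n'), (if app then Nm else Bnd); eexists; split; [by left| |reflexivity].
    by apply/IH; exists nm, y, m1, w1.
Qed.

(** * Canonical numerals and names of variables *)

Definition canon (x : seq sym) : bool :=
  match x with
  | SB0 :: x' => nilp x'
  | SB1 :: x' => all isbit x'
  | _ => false
  end.

Lemma pos_bits_head p : exists x, pos_bits p = SB1 :: x /\ all isbit x.
Proof.
elim: p => [p [x [/= -> H]]|p [x [/= -> H]]|]; last by exists [::].
- by exists (rcons x SB1); rewrite all_rcons H -cats1 /isbit eqxx orbT.
- by exists (rcons x SB0); rewrite all_rcons H -cats1 /isbit eqxx.
Qed.

Lemma canon_bin n : canon (bin n).
Proof. by rewrite /bin; case: (N.of_nat n) => // p; have [x [-> H]] := pos_bits_head p. Qed.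

Lemma canon_bits x : canon x -> all isbit x.
Proof.
case: x => [|[] [|s x]] //= H; rewrite /isbit ?eqxx ?orbT //=.
Qed.

Lemma bits_bin n : all isbit (bin n).
Proof. exact/canon_bits/canon_bin. Qed.

Lemma pos_bits_surj x : all isbit x -> exists p, pos_bits p = SB1 :: x.
Proof.
elim/last_ind: x => [|x s IH]; first by exists xH.
rewrite all_rcons => /andP [Hs /IH [p Hp]].
case/orP: Hs => /eqP ->; [exists (xO p)|exists (xI p)]; by rewrite /= Hp -cats1.
Qed.

Lemma canonP x : canon x -> exists n, x = bin n.
Proof.
case: x => [|[] x] //= Hx; first by exists 0; case: x Hx.
have [p Hp] := pos_bits_surj Hx; exists (Pos.to_nat p).
by rewrite /bin (_ : N.of_nat _ = Npos p) //; lia.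
Qed.

Lemma bval_pos_bits p : bval (pos_bits p) = Pos.to_nat p.
Proof.
have E : (SB0 == SB1) = false by apply/eqP.
elim: p => [p IH|p IH|] /=; last by rewrite /bval /= eqxx.
- by rewrite cats1 bval_rcons IH eqxx Pos2Nat.inj_xI; lia.
- by rewrite cats1 bval_rcons IH E Pos2Nat.inj_xO; lia.
Qed.

Lemma bval_bin n : bval (bin n) = n.
Proof.
rewrite /bin; case E: (N.of_nat n) => [|p].
  have -> : n = 0 by lia.
  by rewrite /bval /=; case: eqP.
by rewrite bval_pos_bits; lia.
Qed.

Lemma bin_inj : injective bin.
Proof. by move=> n m E; rewrite -(bval_bin n) E bval_bin. Qed.

Definition vname (n i : nat) : seq sym := bin n ++ SComma :: bin i.

Lemma isbit_comma : ~~ isbit SComma.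
Proof. by apply/negP => /orP [] /eqP. Qed.

Lemma isbit_lp s : isbit s -> is_lp s = false.
Proof. by case/orP=> /eqP ->. Qed.

Lemma bits_sep_inj c u y u' y' : ~~ isbit c -> all isbit u -> all isbit u' ->
  u ++ c :: y = u' ++ c :: y' -> u = u' /\ y = y'.
Proof.
move=> Hc; elim: u u' => [|s u IH] [|s' u'] //=.
- by move=> _ _ [->].
- by move=> _ /andP [Hs _] [E _]; rewrite -E (negbTE Hc) in Hs.
- by move=> /andP [Hs _] _ [E _]; rewrite E (negbTE Hc) in Hs.
- by move=> /andP [_ Hu] /andP [_ Hu'] [-> E]; have [-> ->] := IH _ Hu Hu' E.
Qed.

Lemma vname_inj n i n' i' : vname n i = vname n' i' -> n = n' /\ i = i'.
Proof.
by move=> /(bits_sep_inj isbit_comma (bits_bin _) (bits_bin _)) [/bin_inj -> /bin_inj ->].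
Qed.

Lemma vname_eq n i n' i' : (vname n i == vname n' i') = (n == n') && (i == i').
Proof.
by apply/eqP/andP => [/vname_inj [-> ->]|[/eqP -> /eqP ->]].
Qed.

Lemma vname_lp n i : ~~ has is_lp (vname n i).
Proof.
have H x : all isbit x -> ~~ has is_lp x.
  by elim: x => //= s x IH /andP [/isbit_lp -> /IH].
by rewrite has_cat negb_or H ?bits_bin //= H ?bits_bin.
Qed.

Lemma naccept_I1 x : naccept I1 x = all isbit x.
Proof. by elim: x => //= s x <-; case: s; rewrite /isbit ?eqxx ?orbT // ; do 2!case: eqP. Qed.

Lemma naccept_I0 x : naccept I0 x = canon x.
Proof. by case: x => //= -[] //= x; rewrite ?naccept_I1 //; case: x => //= -[]. Qed.

Lemma naccept_A1 x : naccept A1 x <->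
  exists u y, [/\ x = u ++ SComma :: y, all isbit u & canon y].
Proof.
elim: x => [|s x IH]; first by split=> // -[[|? ?] [y []]].
split.
- have K b : isbit b -> naccept A1 x ->
      exists u y, [/\ b :: x = u ++ SComma :: y, all isbit u & canon y].
    by move=> Hb /IH [u [y [-> H1 H2]]]; exists (b :: u), y; rewrite /= Hb H1.
  case: s => //=; try by apply: K; rewrite /isbit eqxx ?orbT.
  by rewrite naccept_I0 => H; exists [::], x.
- case=> -[|s1 u] [y [[E1 E2] H1 H2]]; subst s x; first by rewrite /= naccept_I0.
  case/andP: H1 => Hs Hu.
  have : naccept A1 (u ++ SComma :: y) by apply/IH; exists u, y.
  by case/orP: Hs => /eqP ->.
Qed.

Lemma nacceptP nm : naccept A0 nm <-> exists n i, nm = vname n i.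
Proof.
split.
- case: nm => [|[] nm] //=.
  + case: nm => [|[] nm] //=; rewrite naccept_I0 => /canonP [i ->].
    by exists 0, i.
  + case/naccept_A1=> u [y [-> Hu /canonP [i ->]]].
    have [n Hn] : exists n, SB1 :: u = bin n by apply: canonP.
    by exists n, i; rewrite /vname -Hn.
- case=> n [i ->]; rewrite /vname; have := canon_bin n.
  case: (bin n) => [|[] u] //= Hu.
    by case: u Hu => //= _; rewrite naccept_I0 canon_bin.
  by apply/naccept_A1; exists u, (bin i); rewrite canon_bin.
Qed.

Fixpoint sep_items (args : seq (seq sym * bool)) : seq item :=
  match args with
  | [::] => [::]
  | [:: p] => [:: IS p.1 p.2]
  | p :: args' => IS p.1 p.2 :: IO SComma :: sep_items args'
  end.

Lemma parses_args v b v' x r w : parses v (MRun false (Arg b v')) x r w <->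
  r = RQ (Some v') /\ exists z args, [/\ all (fun p => ~~ nilp p.1) ((z, b) :: args),
    x = sep_comma (map fst ((z, b) :: args)) ++ [:: SRP]
    & w = labs (sep_items ((z, b) :: args)) ++ [:: (SRP, Out)]].
Proof.
have [k] := ubnP (size x); elim: k => // k IH in b x w *; move=> Hk.
rewrite parses_run; split.
- case=> [[b0 []]|[z [s [y [m1 [w' [E Hz Hin H ->]]]]]]] //.
  have Hs : size y < k by move: Hk; rewrite E size_cat /=; lia.
  have Ha b' : m1 = MRun false (Arg b' v') -> s = SComma -> r = RQ (Some v') /\
      exists z0 args, [/\ all (fun p : seq sym * bool => ~~ nilp p.1) ((z0, b) :: args),
        x = sep_comma (map fst ((z0, b) :: args)) ++ [:: SRP]
        & slabs true b z ++ (s, Out) :: w' = labs (sep_items ((z0, b) :: args)) ++ [:: (SRP, Out)]].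
    move=> Em Es; subst m1 s; move: H; rewrite IH //.
    case=> -> [z1 [args [Ha Ey Ew]]]; split=> //; exists z, ((z1, b') :: args); split=> //.
    + by apply/andP.
    + by rewrite E Ey /= -catA.
    + by rewrite Ew -[labs (sep_items ((z, b) :: _))]/(slabs true b z ++ (SComma, Out) ::
        labs (sep_items ((z1, b') :: args))) -catA.
  case: s Hin E Ha => //= -[].
  + move=> Em E Ha; subst m1; case/parses_end: H => Ey -> ->; subst y; split=> //.
    by exists z, [::]; split=> //; [apply/andP|rewrite /labs /= cats0].
  + by [].
  + by move=> Em E Ha; apply: (Ha true).
  + by case=> // Em E Ha; apply: (Ha false).
- case=> Er [z [args [Hz Ex ->]]]; subst x r; right; case: args Hz Hk => [|[z1 b1] args] Hz Hk.
  + exists z, SRP, [::], (MEnd (RQ (Some v'))), [::]; split=> //.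
    * by move: Hz; rewrite /= andbT.
    * by left.
    * by apply/parses_end.
    * by rewrite /labs /= cats0.
  + exists z, SComma, (sep_comma (map fst ((z1, b1) :: args)) ++ [:: SRP]).
    exists (MRun false (Arg b1 v')), (labs (sep_items ((z1, b1) :: args)) ++ [:: (SRP, Out)]).
    case/andP: Hz => Hz1 Hz2; split=> //.
    * by rewrite /= -catA.
    * by case: (b1); [left|right; left].
    * rewrite IH; first by split=> //; exists z1, args.
      by move: Hk; rewrite /= !size_cat /=; lia.
    * by rewrite -[labs (sep_items ((z, b) :: _))]/(slabs true b z ++ (SComma, Out) ::
        labs (sep_items ((z1, b1) :: args))) -catA.
Qed.

(** The parts are arbitrary words, so splitting at a wrong delimiter is legal; it merely creates
    claims that cannot all be defended. They are nonempty because an empty segment leaves no cell to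
    carry its claim. *)
Inductive connective (v : bool) : seq sym -> result -> seq item -> Prop :=
| ParseConst : let s := if v then SOne else SZero in connective v [:: s] RWin [:: IO s]
| ParseNot y : ~~ nilp y -> connective v (SNot :: y) (RQ None) [:: IO SNot; IS y (~~ v)]
| ParseAnd z1 z2 v1 v2 : ~~ nilp z1 -> ~~ nilp z2 -> v1 && v2 = v ->
    connective v (SLP :: z1 ++ SAnd :: z2 ++ [:: SRP]) (RQ None)
      [:: IO SLP; IS z1 v1; IO SAnd; IS z2 v2; IO SRP]
| ParseEx n i z : ~~ nilp z ->
    connective v (SEx :: SF :: vname n i ++ SLP :: z ++ [:: SRP]) (RGen v)
      (IO SEx :: IO SF :: map IB (rcons (vname n i) SLP) ++ [:: IS z v; IO SRP])
| ParseApp n i args : all (fun p => ~~ nilp p.1) args ->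
    connective v (SF :: vname n i ++ SLP :: sep_comma (map fst args) ++ [:: SRP]) (RQ (Some v))
      (IO SF :: map IN (rcons (vname n i) SLP) ++ sep_items args ++ [:: IO SRP]).

Lemma labs_IB x : labs (map IB x) = [seq (s, Bnd) | s <- x].
Proof. exact: labs_map. Qed.

Lemma labs_IN x : labs (map IN x) = [seq (s, Nm) | s <- x].
Proof. exact: labs_map. Qed.

Lemma labs_cons i its : labs (i :: its) = ilabs i ++ labs its.
Proof. by []. Qed.

Lemma parses_close v b x r w : parses v (MClose b) x r w <->
  [/\ x = [:: SRP], r = RQ (Some b) & w = [:: (SRP, Out)]].
Proof.
case: x => [|s x] /=; first by split; case.
split.
- by case=> m [l [w' [+ H ->]]]; case: s => //= -[[E1 E2]|//]; subst;
    case/parses_end: H => -> -> ->.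
- case=> -[-> ->] -> ->; exists (MEnd (RQ (Some b))), Out, [::]; split=> //; first by left.
  by apply/parses_end.
Qed.

Lemma parses_last v c x r w r0 : (forall s m, List.In m (mafter c s) <-> s = SRP /\ m = MEnd r0) ->
  (forall b, c <> NotT b) ->
  parses v (MRun false c) x r w <->
  exists z, [/\ ~~ nilp z, x = z ++ [:: SRP], r = r0
    & w = slabs true (rval c) z ++ [:: (SRP, Out)]].
Proof.
move=> Hc HN; rewrite parses_run; split.
- case=> [[b [/HN]]|[z [s [y [m1 [w' [-> Hz /Hc [-> ->] /parses_end [-> -> ->] ->]]]]]]] //.
  by exists z.
- case=> z [Hz -> -> ->]; right; exists z, SRP, [::], (MEnd r0), [::]; split=> //.
    exact/Hc.
  exact/parses_end.
Qed.

Lemma parsesP v x r w : parses v M0 x r w <-> exists its, connective v x r its /\ w = labs its.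
Proof.
split.
- case: x => [|s x] /=; first by case.
  case=> m1 [l [w' [/List.in_map_iff [m2 [[E1 E2] Hin]] H ->]]]; subst m2 l.
  have Hend : m1 = MEnd RWin -> s = (if v then SOne else SZero) ->
      exists its, connective v (s :: x) r its /\ (s, Out) :: w' = labs its.
    move=> E Es; subst m1; case/parses_end: H => -> -> ->; rewrite Es.
    by exists [:: IO (if v then SOne else SZero)]; split; first exact: ParseConst.
  have Hand a : m1 = MRun false (AndL a v) ->
      exists its, connective v (SLP :: x) r its /\ (SLP, Out) :: w' = labs its.
    move=> E; subst m1; move: H; rewrite parses_run.
    case=> [[b []]|[z [s' [y [m2 [w2 [-> Hz Hin' H ->]]]]]]] //.
    have [b [Es Em Eb]] : exists b, [/\ s' = SAnd, m2 = MRun false (AndR b) & a && b = v].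
      case: a s' Hin' {Hz Hend Hin} => -[]; case: (v) => //=;
        try (by case=> [<-|//]; eexists); by case=> [<-|[<-|//]]; eexists.
    subst m2 s'; move: H; rewrite (@parses_last _ _ _ _ _ (RQ None)) //; last first.
      by move=> s' m; split; [case: s' => //= -[<-|//]|case=> -> ->; left].
    case=> z2 [Hz2 -> -> ->]; exists [:: IO SLP; IS z a; IO SAnd; IS z2 b; IO SRP]; split.
      exact: ParseAnd.
    by rewrite /labs /=.
  case: s Hin Hend => /=.
  + by case: v {Hand H} => // -[<-|//]; apply.
  + by case: v {Hand H} => // -[<-|//]; apply.
  + case=> [E|//] _; subst m1; move: H; rewrite parses_name.
    case=> nm [y [m2 [w2 [/nacceptP [n [i ->]] -> Hin H ->]]]].
    have Harg b : m2 = MRun false (Arg b v) -> exists its,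
        connective v (SF :: vname n i ++ SLP :: y) r its /\
        (SF, Out) :: [seq (s, Nm) | s <- rcons (vname n i) SLP] ++ w2 = labs its.
      move=> E; subst m2; move: H; rewrite parses_args => -[-> [z [args [Ha -> ->]]]].
      eexists; split; first exact: (ParseApp v n i Ha).
      by rewrite labs_cons !labs_cat labs_IN.
    case: Hin => [E|[E|[E|//]]]; [|exact: (Harg true)|exact: (Harg false)].
    subst m2; case/parses_close: H => -> -> ->.
    eexists; split; first exact: (@ParseApp v n i [::]).
    by rewrite labs_cons !labs_cat labs_IN.
  + by case=> [E|[E|//]] _; [apply: (Hand true)|apply: (Hand false)].
  + by [].
  + by [].
  + by [].
  + case=> [E|//] _; subst m1; move: H; rewrite parses_run.
    case=> [[b [[<-] Hx -> ->]]|[z [s' [y [m2 [w2 []]]]]]] //.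
    exists [:: IO SNot; IS x (~~ v)]; split; first exact: ParseNot.
    by rewrite /labs /= cats0.
  + case=> [E|//] _; subst m1; case: x H {Hand} => [|s x] /=; first by case.
    case=> m1 [l [w2 [+ H ->]]]; case: s => //= -[[E1 E2]|//]; subst m1 l.
    move: H; rewrite parses_name.
    case=> nm [y [m2 [w3 [/nacceptP [n [i ->]] -> [E|//] H ->]]]]; subst m2.
    move: H; rewrite (@parses_last _ _ _ _ _ (RGen v)) //; last first.
      by move=> s' m; split; [case: s' => //= -[<-|//]|case=> -> ->; left].
    case=> z [Hz -> -> ->]; eexists; split; first exact: (ParseEx v n i Hz).
    by rewrite !labs_cons labs_cat labs_IB /labs /=.
  + by [].
  + by [].
- case=> its [H ->] {w}; case: H => {x r its}.
  + move=> s; exists (MEnd RWin), Out, [::]; split=> //; last by apply/parses_end.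
    by rewrite /s; case: (v); left.
  + move=> y Hy; exists (MRun false (NotT (~~ v))), Out, (slabs true (~~ v) y); split.
    * by left.
    * by apply/parses_run; left; exists (~~ v).
    * by rewrite /labs /= cats0.
  + move=> z1 z2 v1 v2 H1 H2 Hv; exists (MRun false (AndL v1 v)), Out.
    exists (slabs true v1 z1 ++ (SAnd, Out) :: slabs true v2 z2 ++ [:: (SRP, Out)]); split.
    * by case: (v1); [left|right; left].
    * apply/parses_run; right; exists z1, SAnd, (z2 ++ [:: SRP]), (MRun false (AndR v2)).
      exists (slabs true v2 z2 ++ [:: (SRP, Out)]); split=> //.
        by rewrite -Hv; case: (v1) (v2) => [] []; [left|left|left|right; left].
      rewrite (@parses_last _ _ _ _ _ (RQ None)) //; first by exists z2.
      by move=> s' m; split; [case: s' => //= -[<-|//]|case=> -> ->; left].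
    * by rewrite /labs /=.
  + move=> n i z Hz; set its := map IB _ ++ _.
    exists (MSF v), Out, ((SF, Out) :: labs its); split; [by left| |by []].
    exists (MName false v A0), Out, (labs its); split; [by left| |by []].
    apply/parses_name; exists (vname n i), (z ++ [:: SRP]), (MRun false (ExB v)).
    eexists; split; [by apply/nacceptP; exists n, i|by []|by left| |].
      rewrite (@parses_last _ _ _ _ _ (RGen v)) //; first by exists z.
      by move=> s' m; split; [case: s' => //= -[<-|//]|case=> -> ->; left].
    by rewrite /its labs_cat labs_IB.
  + move=> n i args Ha; set its := map IN _ ++ _.
    exists (MName true v A0), Out, (labs its); split; [by left| |by []].
    apply/parses_name; exists (vname n i), (sep_comma (map fst args) ++ [:: SRP]).
    case: args Ha @its => [|[z b] args] Ha its.
      exists (MClose v), [:: (SRP, Out)].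
      split; [by apply/nacceptP; exists n, i|by []|by left|by apply/parses_close|].
      by rewrite /its labs_cat labs_IN.
    exists (MRun false (Arg b v)), (labs (sep_items ((z, b) :: args)) ++ [:: (SRP, Out)]).
    split; [by apply/nacceptP; exists n, i|by []| | |].
    * by case: (b); [right; left|right; right; left].
    * by apply/parses_args; split=> //; exists z, args.
    * by rewrite /its !labs_cat labs_IN.
Qed.

(** * Unique readability *)

Section QbsfInd.
Context (P : qbsf -> Prop).
Hypothesis HC : forall b, P (QConst b).
Hypothesis HA : forall n i args, (forall p, List.In p args -> P p) -> P (QApp n i args).
Hypothesis HAnd : forall a b, P a -> P b -> P (QAnd a b).
Hypothesis HN : forall a, P a -> P (QNot a).
Hypothesis HE : forall n i a, P a -> P (QEx n i a).

Fixpoint qbsf_nested_ind (phi : qbsf) : P phi :=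
  match phi with
  | QConst b => HC b
  | QApp n i args =>
      HA n i ((fix go (l : list qbsf) : forall p, List.In p l -> P p :=
        match l with
        | [::] => fun p h => False_ind _ h
        | q :: l' => fun p h =>
            match h with
            | or_introl e => match e in _ = p return P p with erefl => qbsf_nested_ind q end
            | or_intror h' => go l' p h'
            end
        end) args)
  | QAnd a b => HAnd (qbsf_nested_ind a) (qbsf_nested_ind b)
  | QNot a => HN (qbsf_nested_ind a)
  | QEx n i a => HE n i (qbsf_nested_ind a)
  end.
End QbsfInd.

(** Tells a nonempty argument list from an empty one, which continues with [SRP]. *)
Lemma enc_head phi : exists s x, [/\ enc phi = s :: x, s <> SRP & s <> SComma].
Proof.
case: phi => [[]|n i args|a b|a|n i a] /=; by do 2 eexists; split.
Qed.

Lemma enc_neq0 phi : ~~ nilp (enc phi).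
Proof. by have [s [x [-> _ _]]] := enc_head phi. Qed.

Lemma isbitN_lp : ~~ isbit SLP.
Proof. by apply/negP => /orP [] /eqP. Qed.

Lemma vname_lp_inj n i x n' i' x' :
  bin n ++ SComma :: bin i ++ SLP :: x = bin n' ++ SComma :: bin i' ++ SLP :: x' ->
  [/\ n = n', i = i' & x = x'].
Proof.
move=> /(bits_sep_inj isbit_comma (bits_bin _) (bits_bin _)) [/bin_inj ->]
  /(bits_sep_inj isbitN_lp (bits_bin _) (bits_bin _)) [/bin_inj -> ->].
by [].
Qed.

Lemma sep_comma_cons p l : sep_comma (p :: l) =
  p ++ (if l is [::] then [::] else SComma :: sep_comma l).
Proof. by case: l => [|q l] //=; rewrite cats0. Qed.

(** Stronger than injectivity, since the induction meets codes of subformulas followed by further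
    symbols. *)
Lemma enc_prefix_inj phi psi x y : enc phi ++ x = enc psi ++ y -> phi = psi /\ x = y.
Proof.
elim/qbsf_nested_ind: phi psi x y => [b|n i args IH|a b IHa IHb|a IHa|n i a IHa]
  [b'|n' i' args'|a' b'|a'|n' i' a'] x y; try (by case: b); try (by case: b'); rewrite //=.
- by case: b; case: b' => // -[->].
- move=> []; rewrite -!catA !cat_cons -!catA !cat_cons.
  case/vname_lp_inj => -> -> /=.
  elim: args args' IH x y => [|p l IHl] [|p' l'] IH x y.
  + by case=> ->.
  + have [s [z [E H _]]] := enc_head p'.
    by rewrite [map _ (_ :: _)]/= sep_comma_cons E /= => -[E']; case: H.
  + have [s [z [E H _]]] := enc_head p.
    by rewrite [map _ (_ :: _)]/= sep_comma_cons E /= => -[E']; case: H.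
  + rewrite ![map _ (_ :: _)]/= !sep_comma_cons -!catA.
    case/(IH p (or_introl erefl)) => <-.
    case: l IHl IH => [|q l] IHl IH; case: l' => [|q' l'] //=; first by case=> ->.
    case=> /(IHl (q' :: l')) [|[<-] ->] // r Hr; apply: IH; by right.
- by rewrite -!catA !cat_cons -!catA => -[/IHa [<-] [/IHb [<-] [->]]].
- by case=> /IHa [<- ->].
- move=> []; rewrite -!catA !cat_cons -!catA !cat_cons.
  by case/vname_lp_inj => -> -> /IHa [<- [->]].
Qed.

Lemma enc_inj : injective enc.
Proof.
by move=> phi psi E; have [] := @enc_prefix_inj phi psi [::] [::]; rewrite ?E.
Qed.

(** * Interpretations given by tables *)

Fixpoint unidx (n k : nat) : seq bool :=
  if n is n'.+1 then odd k :: unidx n' k./2 else [::].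

Lemma idxK vs : unidx (size vs) (idx vs) = vs.
Proof.
elim: vs => //= b vs IH; rewrite addnC half_bit_double oddD odd_double addbF IH.
by case: b.
Qed.

Lemma idx_lt vs : idx vs < 2 ^ size vs.
Proof. by elim: vs => //= b vs IH; rewrite expnS; case: b => /=; lia. Qed.

Definition tabfun (t : seq bool) (vs : seq bool) : bool := nth false t (idx vs).

(** On lists of length [n], [idx] is injective with inverse [unidx n], and its values lie below
    [2 ^ n], hence inside a table of [2 ^ N] entries if [n <= N]. *)
Lemma tabfun_surj (F : seq bool -> bool) n N : exists t, size t = 2 ^ N /\
  forall vs, size vs = n -> n <= N -> tabfun t vs = F vs.
Proof.
exists (mkseq (fun k => F (unidx n k)) (2 ^ N)); split; first by rewrite size_mkseq.
move=> vs Hv Hn; rewrite /tabfun nth_mkseq; first by rewrite -Hv idxK.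
by apply: leq_trans (idx_lt vs) _; rewrite Hv leq_exp2l.
Qed.

Lemma size_sep_comma_enc (l : seq qbsf) : size l <= size (sep_comma (map enc l)).
Proof.
elim: l => // p l IH; rewrite [map _ _]/= sep_comma_cons size_cat.
have := enc_neq0 p; rewrite /nilp; case: l IH => [|q l] IH /=; first by lia.
by rewrite /= in IH; lia.
Qed.

Lemma size_enc_arg p l : List.In p l -> size (enc p) <= size (sep_comma (map enc l)).
Proof.
elim: l => // q l IH; rewrite [map _ _]/= sep_comma_cons size_cat => -[->|/IH H].
  exact: leq_addr.
by case: l H {IH} => [|r l] /= H; lia.
Qed.

Lemma map_ext_In (T U : Type) (f g : T -> U) l :
  (forall x, List.In x l -> f x = g x) -> map f l = map g l.
Proof.
elim: l => //= x l IH H; rewrite (H x (or_introl erefl)) IH // => y Hy.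
by apply: H; right.
Qed.

Lemma pboolP P : reflect P (pbool P).
Proof. by rewrite /pbool; case: excluded_middle_informative => H; constructor. Qed.

(** Every argument takes at least one symbol, so a well formed formula of length at most [N] applies
    only variables of arity at most [N]. *)
Lemma qeval_agree N phi (I J : interp) : qwf phi -> size (enc phi) <= N ->
  (forall n i vs, size vs = n -> n <= N -> I n i vs = J n i vs) ->
  qeval I phi = qeval J phi.
Proof.
elim/qbsf_nested_ind: phi I J => [b|n i args IH|a b IHa IHb|a IHa|n i a IHa] I J //=.
- move=> /andP [/eqP Hn Hw]; rewrite !size_cat /= !size_cat /= => Hs HIJ.
  have -> : map (qeval I) args = map (qeval J) args.
    apply: map_ext_In => p Hp; apply: IH => //.
      by elim: args Hp Hw {Hn Hs} => //= q l IHl [->|/IHl H] /andP [] // _ /H.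
    by have := size_enc_arg Hp; lia.
  apply: HIJ; first by rewrite size_map.
  by have := size_sep_comma_enc args; rewrite Hn; lia.
- move=> /andP [Ha Hb]; rewrite !size_cat /= => Hs HIJ.
  by rewrite (IHa I J) // ?(IHb I J) //; rewrite ?size_cat /= in Hs *; lia.
- by move=> Ha Hs HIJ; rewrite (IHa I J) //; lia.
- move=> Ha; rewrite !size_cat /= !size_cat /= => Hs HIJ.
  have H F : qeval (upd I n i F) a = qeval (upd J n i F) a.
    apply: IHa => //; first by lia.
    by move=> n' i' vs H1 H2; rewrite /upd; case: ifP => // _; apply: HIJ.
  by apply/pboolP/pboolP => -[F HF]; exists F; rewrite -HF H.
Qed.

Lemma qclosed_eq b b' phi : b =i b' -> qclosed_in b phi = qclosed_in b' phi.
Proof.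
elim/qbsf_nested_ind: phi b b' => [c|n i args IH|p q IHp IHq|p IHp|n i p IHp] b b' Hb //=.
- rewrite Hb; congr (_ && _); elim: args IH => //= r l IHl IH.
  rewrite (IH r (or_introl erefl) _ _ Hb) IHl // => s Hs; apply: IH; by right.
- by rewrite (IHp _ _ Hb) (IHq _ _ Hb).
- exact: IHp.
- by apply: IHp => z; rewrite !inE Hb.
Qed.

Definition env := seq ((nat * nat) * seq bool).

Definition ienv (e : env) : interp :=
  foldl (fun I x => upd I x.1.1 x.1.2 (tabfun x.2)) empty_interp e.

Lemma ienv_rcons e x : ienv (rcons e x) = upd (ienv e) x.1.1 x.1.2 (tabfun x.2).
Proof. exact: foldl_rcons. Qed.

Definition sem (e : env) (v : bool) (x : seq sym) : Prop := exists phi,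
  [/\ x = enc phi, qwf phi, qclosed_in (map fst e) phi & qeval (ienv e) phi = v].

(** Both folds go from the outermost binding to the innermost, and in both the last match wins. *)
Lemma lookup_env n i bs (e : env) v :
  lookup (vname n i) None [seq (vname x.1.1 x.1.2, select bs x.2) | x <- e] = Some v <->
  (n, i) \in map fst e /\ ienv e n i bs = v.
Proof.
elim/last_ind: e => [|e [[n' i'] t] IH]; first by split=> // -[].
rewrite map_rcons /lookup foldl_rcons -/(lookup _ _ _) /= vname_eq.
rewrite ienv_rcons /upd /= map_rcons mem_rcons inE xpair_eqE /=.
rewrite [n' == n]eq_sym [i' == i]eq_sym; case: ifP => _ //=.
by rewrite head_select -/(tabfun t bs); split=> [[<-]|[_ ->]].
Qed.

(** * Challenging a subformula *)

(** What a pick does to everything not picked: claims and applied names vanish, bound names stay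
    because their scope persists. *)
Definition clr (i : item) : seq item :=
  match i with
  | IO s => [:: IO s] | IB s => [:: IB s] | IN s => [:: IO s] | IS z _ => map IO z
  end.
Definition clear (its : seq item) : seq item := flatten (map clr its).

Lemma clear_cat a b : clear (a ++ b) = clear a ++ clear b.
Proof. by rewrite /clear map_cat flatten_cat. Qed.

Lemma clear_cons i its : clear (i :: its) = clr i ++ clear its.
Proof. by []. Qed.

Lemma clear_inert its : all inert its -> clear its = its.
Proof. by elim: its => // -[s|s|s|z b] its IH //= /IH E; rewrite clear_cons E. Qed.

Definition nonempty (i : item) : bool := if i is IS z _ then ~~ nilp z else true.

Lemma labs_IO x : labs (map IO x) = [seq (s, Out) | s <- x].
Proof. exact: labs_map. Qed.

Lemma tc_IO x : map tc (labs (map IO x)) = lcs Out x.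
Proof. by rewrite labs_IO -map_comp. Qed.

Lemma tc_IS s z b : map tc (ilabs (IS (s :: z) b)) =
  inl (s, Seg true b, false) :: lcs (Seg false b) z.
Proof. by rewrite /= -map_comp. Qed.

Definition picked (p : pst) : Prop := p <> P0.

Lemma pdelta_uniq p u p1 v1 p2 v2 : picked p ->
  run pdelta p u p1 v1 -> run pdelta p u p2 v2 -> p1 = p2 /\ v1 = v2.
Proof.
apply: (@run_uniq _ _ pdelta picked) => {p u p1 v1 p2 v2} [[] g p1 p2 // _|[] g p // _].
all: by case: g => [[[s [|[] b| | |]] c]|t] /= [<-|//] // [<-|//].
Qed.

Lemma run_clear_item p i : picked p -> nonempty i -> exists p',
  picked p' /\ run pdelta p (map tc (ilabs i)) p' (map tc (labs (clr i))).
Proof.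
case: p => // _ Hi; (exists P1; split; first by []); case: i Hi => [s|s|s|[|s z] b] // _.
all: try by apply: run_cons_intro; first by left.
all: rewrite tc_IS tc_IO; apply: (@run_cons_intro _ _ _ _ _ P1); first by left.
all: by apply: run_map.
Qed.

Lemma run_clear p its : picked p -> all nonempty its -> exists p',
  picked p' /\ run pdelta p (map tc (labs its)) p' (map tc (labs (clear its))).
Proof.
elim: its p => [|i its IH] p Hp /=; first by exists p.
case/andP=> Hi /IH {}IH; have [p1 [Hp1 H1]] := run_clear_item Hp Hi.
have [p2 [Hp2 H2]] := IH _ Hp1; exists p2; split=> //.
by rewrite clear_cons labs_cat labs_cons !map_cat; apply: run_cat_intro H1 H2.
Qed.

Lemma run_drop_item i p v : nonempty i -> run pdelta P0 (map tc (ilabs i)) p v ->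
  (p = P0 /\ v = map tc (labs (clr i))) \/
  (exists z b, [/\ i = IS z b, p = PKeep & v = map tc (ilabs i)]).
Proof.
case: i => [s|s|s|[|s z] b] // _.
1-3: by case=> p1 [g [w [[[<- <-]|//] [-> ->] ->]]]; left.
rewrite tc_IS tc_IO => -[p1 [g [w [Hin H ->]]]].
case: Hin => [[E1 E2]|[[E1 E2]|//]]; subst p1 g.
- by right; exists (s :: z), b; have [-> ->] := run_map_inv H (fun _ => erefl).
- by left; have [-> ->] := run_map_inv H (fun _ => erefl).
Qed.

Lemma run_drop_item_intro i : run pdelta P0 (map tc (ilabs i)) P0 (map tc (labs (clr i))).
Proof.
case: i => [s|s|s|[|s z] b] //; try by apply: run_cons_intro; first by left.
rewrite tc_IS tc_IO; apply: (@run_cons_intro _ _ _ _ _ P0); first by right; left.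
exact: run_map.
Qed.

Lemma run_keep_item z b : ~~ nilp z ->
  run pdelta P0 (map tc (ilabs (IS z b))) PKeep (map tc (ilabs (IS z b))).
Proof.
case: z => // s z _; rewrite tc_IS; apply: (@run_cons_intro _ _ _ _ _ PKeep); first by left.
exact: run_map.
Qed.

Lemma run_pick its p v : all nonempty its -> run pdelta P0 (map tc (labs its)) p v -> p <> P0 ->
  exists i1 z b i2, its = i1 ++ IS z b :: i2 /\
    v = map tc (labs (clear i1 ++ IS z b :: clear i2)).
Proof.
elim: its v => [|i its IH] v /=; first by move=> _ [-> _].
case/andP=> Hi Hits; rewrite labs_cons map_cat => /run_cat [q [v1 [v2 [H1 H2 ->]]]] Hp.
case: (run_drop_item Hi H1) => [[E1 E2]|[z [b [Ei Eq E2]]]]; subst q v1.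
- have [i1 [z [b [i2 [-> ->]]]]] := IH _ Hits H2 Hp.
  exists (i :: i1), z, b, i2; split=> //.
  by rewrite clear_cons !labs_cat -catA map_cat -!map_cat.
- subst i; exists [::], z, b, its; split=> //.
  have HK : picked PKeep by [].
  have [p' [Hp' H3]] := run_clear HK Hits.
  have [_ ->] := pdelta_uniq HK H2 H3.
  by rewrite labs_cons map_cat.
Qed.

Lemma run_pick_intro i1 z b i2 : all nonempty (i1 ++ IS z b :: i2) -> exists p,
  p <> P0 /\ run pdelta P0 (map tc (labs (i1 ++ IS z b :: i2))) p
    (map tc (labs (clear i1 ++ IS z b :: clear i2))).
Proof.
rewrite all_cat => /andP [_ /= /andP [Hz H2]].
have HK : picked PKeep by [].
have [p [Hp Hr]] := run_clear HK H2.
exists p; split=> //; rewrite !labs_cat !labs_cons !map_cat.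
apply: run_cat_intro; last by apply: run_cat_intro Hr; apply: run_keep_item.
elim: i1 => [|i i1 IH] //; rewrite clear_cons labs_cat labs_cons !map_cat.
exact: run_cat_intro (run_drop_item_intro i) IH.
Qed.

Lemma gwin_pick its ts : all nonempty its -> gwin (SP P0) (word its ts) <->
  forall i1 z b i2, its = i1 ++ IS z b :: i2 ->
    gwin (SM M0) (word (clear i1 ++ IS z b :: clear i2) ts).
Proof.
move=> Hits; rewrite gwin_SP; split.
- move=> H i1 z b i2 E; rewrite E in Hits; have [p [Hp Hr]] := run_pick_intro Hits.
  apply: (H p) => //; rewrite E; apply: run_cat_intro Hr _.
  by apply: run_tables.
- move=> H p v /run_cat [p1 [v1 [v2 [H1 H2 ->]]]] Hp.
  rewrite tablesE in H2; have [E1 E2] := run_map_inv H2 (fun _ => erefl).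
  rewrite -tablesE in E2; subst p v2.
  have [i1 [z [b [i2 [E ->]]]]] := run_pick Hits H1 Hp.
  exact: H.
Qed.


(** * Correctness of the game *)

Definition bsyms (its : seq item) : seq sym :=
  flatten [seq if i is IB s then [:: s] else [::] | i <- its].

Lemma bsyms_cat a b : bsyms (a ++ b) = bsyms a ++ bsyms b.
Proof. by rewrite /bsyms map_cat flatten_cat. Qed.

Lemma bsyms_IB x : bsyms (map IB x) = x.
Proof. by elim: x => //= s x IH; rewrite -[in RHS]IH. Qed.

Definition bnames (e : env) : seq sym :=
  flatten [seq rcons (vname x.1.1 x.1.2) SLP | x <- e].

Lemma bnames_rcons e x : bnames (rcons e x) = bnames e ++ rcons (vname x.1.1 x.1.2) SLP.
Proof. by rewrite /bnames map_rcons flatten_rcons. Qed.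

Definition plain (i : item) : bool := if i is IO _ then true else false.

Lemma plain_inert its : all plain its -> all inert its.
Proof. by apply: sub_all => -[]. Qed.

Lemma inert_nonempty its : all inert its -> all nonempty its.
Proof. by apply: sub_all => -[]. Qed.

Lemma plain_IO x : all plain (map IO x).
Proof. by elim: x. Qed.

Lemma filter_inert its : all inert its ->
  filter relevant (map tc (labs its)) = lcs Bnd (bsyms its).
Proof.
elim: its => // i its IH /= /andP [Hi /IH E].
by case: i Hi => // s _; rewrite labs_cons /= E.
Qed.

Lemma bsyms_plain its : all plain its -> bsyms its = [::].
Proof. by elim: its => // -[s|s|s|z b] its IH //= /IH. Qed.

Definition heads (args : seq (seq sym * bool)) : seq (sym * bool) :=
  [seq (head SZero p.1, p.2) | p <- args].

Lemma sep_items_cons p l : sep_items (p :: l) =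
  IS p.1 p.2 :: (if l is [::] then [::] else IO SComma :: sep_items l).
Proof. by case: l. Qed.

Lemma filter_sep_items args : all (fun p => ~~ nilp p.1) args ->
  filter relevant (map tc (labs (sep_items args))) = starts (heads args).
Proof.
elim: args => // -[[|s z] b] l IH //= Hl.
rewrite -/(sep_items ((s :: z, b) :: l)) sep_items_cons labs_cons map_cat filter_cat tc_IS /=.
by rewrite filter_lcs /=; case: l IH Hl => // p l IH /IH E; rewrite labs_cons /= E.
Qed.

Lemma sep_items_nonempty args : all (fun p => ~~ nilp p.1) args -> all nonempty (sep_items args).
Proof.
elim: args => // -[z b] l IH /= /andP [Hz /IH {}IH].
by rewrite -/(sep_items ((z, b) :: l)) sep_items_cons /= Hz; case: l IH.
Qed.

Definition segs_of (its : seq item) : seq (seq sym * bool) :=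
  flatten [seq if i is IS z b then [:: (z, b)] else [::] | i <- its].

Lemma segs_of_cat a b : segs_of (a ++ b) = segs_of a ++ segs_of b.
Proof. by rewrite /segs_of map_cat flatten_cat. Qed.

Lemma in_cat_iff (T : Type) (x : T) a b :
  List.In x (a ++ b) <-> List.In x a \/ List.In x b.
Proof. by elim: a => [|y a IH] /=; tauto. Qed.

Lemma in_segs_of z b its : List.In (z, b) (segs_of its) <->
  exists i1 i2, its = i1 ++ IS z b :: i2.
Proof.
elim: its => [|i its IH]; first by split=> // -[[|? ?] [i2]].
have E : segs_of (i :: its) = segs_of [:: i] ++ segs_of its by rewrite -segs_of_cat.
split.
- rewrite E => /in_cat_iff [|/IH [i1 [i2 ->]]]; last by exists (i :: i1), i2.
  by case: i {E} => [s|s|s|z' b'] //= -[[-> ->]|//]; exists [::], its.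
- rewrite E => -[[|j i1] [i2 [-> Hi]]]; apply/in_cat_iff; first by left; left.
  by right; apply/IH; exists i1, i2.
Qed.

Lemma segs_of_sep args : segs_of (sep_items args) = args.
Proof.
elim: args => // p l IH; rewrite sep_items_cons /segs_of /= -/(segs_of _).
by rewrite -surjective_pairing; case: l IH => // q l IH; rewrite -[in RHS]IH.
Qed.

Lemma clear_plain its : bsyms its = [::] -> all plain (clear its).
Proof.
elim: its => // i its IH; rewrite clear_cons all_cat.
by case: i => [s|s|s|z b] //= /IH -> //; rewrite plain_IO.
Qed.

Lemma inert_clear its : all inert (clear its).
Proof.
elim: its => // i its IH; rewrite clear_cons all_cat IH andbT.
by case: i => // z b; apply/plain_inert/plain_IO.
Qed.

Lemma split_inert pre mid post j1 z b j2 : all inert pre -> all inert post ->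
  pre ++ mid ++ post = j1 ++ IS z b :: j2 ->
  exists i1 i2, [/\ mid = i1 ++ IS z b :: i2, j1 = pre ++ i1 & j2 = i2 ++ post].
Proof.
move=> Hpre Hpost; elim: pre Hpre j1 => [_|i pre IH /= /andP [Hi /IH {}IH]] j1.
- elim: mid j1 => [|m mid IH] [|j j1] /=.
  + by move=> E; rewrite E in Hpost.
  + by move=> E; rewrite E /= all_cat /= !andbF in Hpost.
  + by case=> -> <-; exists [::], mid.
  + by case=> -> /IH [i1 [i2 [-> -> ->]]]; exists (j :: i1), i2.
- case: j1 => [|j j1] /=; first by case=> E; rewrite E in Hi.
  by case=> -> /IH [i1 [i2 [-> -> ->]]]; exists i1, i2.
Qed.

(** The invariant of the game: the tables are those of [e], and the names bound in [e] stand in the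
    same order left of the segment, a quantified name preceding its scope. *)
Definition correct_below (k : nat) : Prop := forall x v pre post (e : env), size x < k ->
  all inert pre -> all plain post -> bsyms pre = bnames e ->
  gwin (SM M0) (word (pre ++ IS x v :: post) (map snd e)) <-> sem e v x.

Lemma gwin_challenge k pre mid post (e : env) : correct_below k ->
  all inert pre -> all plain post -> bsyms pre = bnames e ->
  all nonempty mid -> bsyms mid = [::] ->
  (forall p, List.In p (segs_of mid) -> size p.1 < k) ->
  gwin (SP P0) (word (pre ++ mid ++ post) (map snd e)) <->
  forall p, List.In p (segs_of mid) -> sem e p.2 p.1.
Proof.
move=> IH Hpre Hpost He Hmid Hb Hk; have Hposti := plain_inert Hpost.
have H1 i1 z b i2 : mid = i1 ++ IS z b :: i2 ->
    gwin (SM M0) (word (clear (pre ++ i1) ++ IS z b :: clear (i2 ++ post)) (map snd e)) <->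
    sem e b z.
  move=> E; have {}Hb : bsyms i1 = [::] /\ bsyms i2 = [::].
    by move: Hb; rewrite E bsyms_cat /bsyms /= -/(bsyms i2) -/(bsyms i1); case: (bsyms i1).
  apply: IH.
  - by apply: (Hk (z, b)); apply/in_segs_of; exists i1, i2.
  - exact: inert_clear.
  - by apply: clear_plain; rewrite bsyms_cat (bsyms_plain Hpost) Hb.2.
  - by rewrite clear_cat bsyms_cat (clear_inert Hpre) (bsyms_plain (clear_plain Hb.1)) cats0.
rewrite gwin_pick; last by rewrite !all_cat Hmid !inert_nonempty.
split.
- move=> H [z b] /in_segs_of [i1 [i2 E]]; apply/(H1 _ _ _ _ E)/H.
  by rewrite E -!catA.
- move=> H j1 z b j2 /(split_inert Hpre Hposti) [i1 [i2 [E -> ->]]].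
  by apply/(H1 _ _ _ _ E)/(H (z, b)); apply/in_segs_of; exists i1, i2.
Qed.

Lemma filter_word pre mid post ts : all inert pre -> all plain post ->
  filter relevant (word (pre ++ mid ++ post) ts) =
  lcs Bnd (bsyms pre) ++ filter relevant (map tc (labs mid)) ++ tables ts.
Proof.
move=> Hpre Hpost; rewrite /word !labs_cat !map_cat !filter_cat filter_tables.
rewrite (filter_inert Hpre) (filter_inert (plain_inert Hpost)) (bsyms_plain Hpost).
by rewrite cats0 -catA.
Qed.

(** The challenges of [SQ] are translated one by one. Arity check and lookup depend only on the
    relevant cells, listed in [Hf]: bound names, the applied name, argument heads and tables. *)
Lemma gwin_app k pre post (e : env) n i args v : correct_below k ->
  all inert pre -> all plain post -> bsyms pre = bnames e ->
  all (fun p => ~~ nilp p.1) args -> (forall p, List.In p args -> size p.1 < k) ->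
  gwin (SQ (Some v)) (word (pre ++ (IO SF :: map IN (rcons (vname n i) SLP) ++
      sep_items args ++ [:: IO SRP]) ++ post) (map snd e)) <->
  [/\ forall p, List.In p args -> sem e p.2 p.1, size args = n, (n, i) \in map fst e
    & ienv e n i (map snd args) = v].
Proof.
move=> IH Hpre Hpost He Ha Hk.
set mid := IO SF :: _.
have Hbs x : bsyms (map IN x) = [::] by elim: x.
have Hsg x : segs_of (map IN x) = [::] by elim: x.
have Hne x : all nonempty (map IN x) by elim: x.
have Hsep : bsyms (sep_items args) = [::].
  elim: (args) => // p l IHl; rewrite sep_items_cons /bsyms /= -/(bsyms _).
  by case: l IHl.
have Hmid : segs_of mid = args.
  by rewrite /mid /segs_of /= -/(segs_of _) !segs_of_cat Hsg segs_of_sep cats0.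
have Hbm : bsyms mid = [::].
  by rewrite /mid /bsyms /= -/(bsyms _) !bsyms_cat Hbs Hsep.
have Hnm : all nonempty mid by rewrite /= !all_cat Hne sep_items_nonempty.
have Hf : filter relevant (word (pre ++ mid ++ post) (map snd e)) =
    lcs Bnd (bnames e) ++ lcs Nm (rcons (vname n i) SLP) ++ starts (heads args) ++
    tables (map snd e).
  rewrite filter_word // He; congr (_ ++ _); rewrite catA; congr (_ ++ _).
  rewrite /mid labs_cons !labs_cat map_cat map_cat filter_cat filter_cat map_cat filter_cat.
  by rewrite filter_sep_items // labs_IN -map_comp (filter_lcs Nm) cats0.
rewrite gwin_SQ (gwin_challenge IH Hpre Hpost He Hnm Hbm) ?Hmid //.
rewrite (@gwin_rel (SC _)) // (@gwin_rel (SL _ _)) // Hf.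
rewrite gwin_select.
have -> : lcs Nm (rcons (vname n i) SLP) = lcs Nm (bin n ++ SComma :: rcons (bin i) SLP).
  by rewrite /vname rcons_cat.
rewrite (gwin_count _ _ _ _ (bits_bin n)) bval_bin size_map.
have -> : bin n ++ SComma :: rcons (bin i) SLP = rcons (vname n i) SLP by rewrite /vname rcons_cat.
have Eh : map snd (heads args) = map snd args by rewrite /heads -map_comp.
set bs := map snd args in Eh *.
set nts := [seq (vname x.1.1 x.1.2, select bs x.2) | x <- e].
have Et : map (select (map snd (heads args))) (map snd e) = map snd nts.
  by rewrite Eh /nts -!map_comp.
have En : bnames e = flatten [seq rcons nt.1 SLP | nt <- nts].
  by rewrite /nts -map_comp.
rewrite Et En gwin_lookup ?vname_lp //; last first.
  by rewrite /nts all_map; apply/allP => x _ /=; apply: vname_lp.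
rewrite lookup_env; split.
- by case=> H1 [H2 [H3 H4]].
- by case=> H1 H2 H3 H4.
Qed.

(** * Claims and connectives *)

Lemma sem_not (e : env) v y : sem e (~~ v) y <-> sem e v (SNot :: y).
Proof.
split.
- by case=> phi [-> H1 H2 H3]; exists (QNot phi); rewrite /= H3 negbK.
- by case=> -[[]|n i l|a b|a|n i a] [] //= [->] H1 H2 <-; exists a; rewrite negbK.
Qed.

Lemma sem_and e v1 v2 z1 z2 : sem e v1 z1 -> sem e v2 z2 ->
  sem e (v1 && v2) (SLP :: z1 ++ SAnd :: z2 ++ [:: SRP]).
Proof.
case=> a [-> A1 A2 A3] [b [-> B1 B2 B3]]; exists (QAnd a b).
by rewrite /= A1 A2 A3 B1 B2 B3.
Qed.

Lemma closed_rcons (e : env) n i t phi :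
  qclosed_in (map fst (rcons e ((n, i), t))) phi = qclosed_in ((n, i) :: map fst e) phi.
Proof. by apply: qclosed_eq => z; rewrite map_rcons mem_rcons. Qed.

Lemma enc_ex_inv n i z phi : SEx :: SF :: vname n i ++ SLP :: z ++ [:: SRP] = enc phi ->
  exists a, phi = QEx n i a /\ z = enc a.
Proof.
case: phi => [[]|? ? ?|? ?|?|n' i' a] //= [E]; exists a; move: E.
rewrite /vname -!catA !cat_cons => /vname_lp_inj [-> -> E].
by have := congr1 rev E; rewrite !rev_cat => -[/(can_inj revK) ->].
Qed.

(* A variable of arity above [N] is not applied in a formula of length at most [N],
   so tables of length [2 ^ N] represent all the relevant functions. *)
Lemma sem_ex e v n i z N : size z <= N ->
  qtab v (2 ^ N) (fun t => sem (rcons e ((n, i), t)) v z) <->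
  sem e v (SEx :: SF :: vname n i ++ SLP :: z ++ [:: SRP]).
Proof.
move=> HN.
have Hext phi t F : z = enc phi -> qwf phi ->
    (forall vs, size vs = n -> n <= N -> tabfun t vs = F vs) ->
    qeval (ienv (rcons e ((n, i), t))) phi = qeval (upd (ienv e) n i F) phi.
  move=> Ez Hw HF; apply: (@qeval_agree N) => //; first by rewrite -Ez.
  move=> n' i' vs Hs Hn; rewrite ienv_rcons /upd /=.
  by case: ifP => // /andP [/eqP En _]; apply: HF; rewrite -En.
have Eenc phi : SEx :: SF :: vname n i ++ SLP :: enc phi ++ [:: SRP] = enc (QEx n i phi) by [].
case: v; split.
- case=> t [Ht [phi [Ez H1 H2 H3]]]; exists (QEx n i phi); rewrite Ez; split=> //=.
    by rewrite closed_rcons in H2.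
  by apply/pboolP; exists (tabfun t); rewrite -(Hext phi t).
- case=> phi [E H1 H2 H3].
  have [a Ea] := enc_ex_inv E.
  case: Ea H1 H2 H3 => -> Ez /= H1 H2 /pboolP [F HF].
  have [t [Ht Htab]] := tabfun_surj F n N; exists t; split=> //; exists a; split=> //.
    by rewrite closed_rcons.
  by rewrite (Hext a t F).
(* Any table will do here: it only supplies the formula [phi]. *)
- move=> H; have [phi [Ez H1 H2 _]] := H (nseq (2 ^ N) false) (size_nseq _ _).
  exists (QEx n i phi); rewrite Ez; split=> //=; first by rewrite closed_rcons in H2.
  apply/pboolP => -[F HF].
  have [t [Ht Htab]] := tabfun_surj F n N.
  (* The claim for [t] has its own witness [psi]; unique readability identifies it with [phi]. *)
  have [psi [Ez' _ _]] := H t Ht.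
  have -> : psi = phi by apply: enc_inj; rewrite -Ez -Ez'.
  by rewrite (Hext phi t F) // HF.
- case=> phi [E H1 H2 H3] t Ht.
  have [a Ea] := enc_ex_inv E.
  case: Ea H1 H2 H3 => -> Ez /= H1 H2 /pboolP HF.
  exists a; split=> //; first by rewrite closed_rcons.
  rewrite (Hext a t (tabfun t)) //; apply/negbTE/negP => H; apply: HF.
  by exists (tabfun t).
Qed.

Lemma sem_args (e : env) (args : seq (seq sym * bool)) :
  (forall p, List.In p args -> sem e p.2 p.1) <->
  exists phis, [/\ map fst args = map enc phis, all qwf phis, all (qclosed_in (map fst e)) phis
    & map snd args = map (qeval (ienv e)) phis].
Proof.
elim: args => [|[z b] args IH]; first by split=> // _; exists [::].
split.
- move=> H; have [p Hp|phis [E1 E2 E3 E4]] := proj1 IH; first by apply: H; right.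
  have [phi /= [-> H1 H2 H3]] := H (z, b) (or_introl erefl).
  by exists (phi :: phis); rewrite /= E1 E2 E3 -E4 H1 H2 H3.
- case=> -[|phi phis] [] //= [Ez E1] /andP [H1 H2] /andP [H3 H4] [Eb E2] p [<-|].
    by exists phi.
  by apply: (proj2 IH); exists phis.
Qed.

(** Induction on the length of the segment, which shrinks in every round. A winning split yields
    subformulas that assemble to a formula; conversely the existential player wins with the true
    parse and the true values. *)
Theorem game_correct k : correct_below k.
Proof.
elim: k => // k IH x v pre post e; rewrite ltnS => Hx Hpre Hpost He.
have Hposti := plain_inert Hpost.
have -> : gwin (SM M0) (word (pre ++ IS x v :: post) (map snd e)) <->
    exists r its, connective v x r its /\ gwin (gstart r) (word (pre ++ its ++ post) (map snd e)).
  rewrite gwin_main //; split.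
  - case=> r [w [/parsesP [its [Hp ->]] Hw]]; exists r, its; split=> //.
    by rewrite /word !labs_cat.
  - case=> r [its [Hp Hw]]; exists r, (labs its); split; first by apply/parsesP; exists its.
    by move: Hw; rewrite /word !labs_cat.
have Cnot y b : size (SNot :: y) <= k -> ~~ nilp y ->
    gwin (SQ None) (word (pre ++ [:: IO SNot; IS y b] ++ post) (map snd e)) <-> sem e b y.
  move=> Hk Hy; rewrite gwin_SQ (gwin_challenge IH) //=; first last.
  - by move=> p [<-|//].
  - by rewrite Hy.
  - split; first by case=> H _; apply: (H (y, b)); left.
    by move=> H; split=> // p [<-|//].
have Cand z1 z2 v1 v2 : size (SLP :: z1 ++ SAnd :: z2 ++ [:: SRP]) <= k ->
    ~~ nilp z1 -> ~~ nilp z2 ->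
    gwin (SQ None) (word (pre ++ [:: IO SLP; IS z1 v1; IO SAnd; IS z2 v2; IO SRP] ++ post)
      (map snd e)) <-> sem e v1 z1 /\ sem e v2 z2.
  move=> Hk H1 H2; rewrite gwin_SQ (gwin_challenge IH) //=; first last.
  - by move: Hk; rewrite /= !size_cat /= !size_cat => Hk p [<-|[<-|//]] /=; lia.
  - by rewrite H1 H2.
  - split; first by case=> H _; split; [apply: (H (z1, v1)); left|apply: (H (z2, v2)); right; left].
    by case=> A B; split=> // p [<-|[<-|//]].
have Cex n i z : size (SEx :: SF :: vname n i ++ SLP :: z ++ [:: SRP]) <= k -> ~~ nilp z ->
    gwin (SG v G0) (word (pre ++ (IO SEx :: IO SF :: map IB (rcons (vname n i) SLP) ++
      [:: IS z v; IO SRP]) ++ post) (map snd e)) <->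
    sem e v (SEx :: SF :: vname n i ++ SLP :: z ++ [:: SRP]).
  move=> Hk Hz; set its := (X in word X).
  (* The table gets [2 ^ size (labs its)] bits, and the scope [z] is part of that text, as [sem_ex]
     demands. *)
  have Hs : size z <= size (labs its).
    rewrite /its labs_cat labs_cat labs_cons labs_cons labs_cat labs_cons !size_cat /=.
    by case: (z) Hz => //= s z' _; rewrite size_map; lia.
  rewrite gwin_table -(sem_ex _ _ _ _ Hs); apply: qtab_iff => t _.
  rewrite gwin_SQ.
  set pre' := pre ++ IO SEx :: IO SF :: map IB (rcons (vname n i) SLP).
  have -> : its = pre' ++ [:: IS z v; IO SRP] ++ post.
    by rewrite /its /pre' -!catA /= -!catA.
  rewrite -/(word _ _) -[rcons (map snd e) t]/(rcons (map snd e) ((n, i), t).2) -map_rcons.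
  rewrite (gwin_challenge (e := rcons e ((n, i), t)) IH) //=; first last.
  - by move: Hk; rewrite /= !size_cat /= !size_cat => Hk p [<-|//] /=; lia.
  - by rewrite Hz.
  - by rewrite /pre' bsyms_cat bnames_rcons He /bsyms /= -/(bsyms _) bsyms_IB.
  - rewrite /pre' all_cat Hpre /=; by elim: (rcons _ _).
  - split; first by case=> H _; apply: (H (z, v)); left.
    by move=> H; split=> // p [<-|//].
have Capp n i args : all (fun p => ~~ nilp p.1) args ->
    size (SF :: vname n i ++ SLP :: sep_comma (map fst args) ++ [:: SRP]) <= k ->
    gwin (SQ (Some v)) (word (pre ++ (IO SF :: map IN (rcons (vname n i) SLP) ++
      sep_items args ++ [:: IO SRP]) ++ post) (map snd e)) <->
    [/\ forall p, List.In p args -> sem e p.2 p.1, size args = n, (n, i) \in map fst e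
      & ienv e n i (map snd args) = v].
  move=> Ha Hk; apply: (gwin_app n i v IH Hpre Hpost He Ha) => p Hp.
  suff : size p.1 <= size (sep_comma (map fst args)).
    by move: Hk; rewrite /= !size_cat /= !size_cat; lia.
  elim: (args) Hp => // q l IHl; rewrite [map _ _]/= sep_comma_cons size_cat => -[->|/IHl H].
    exact: leq_addr.
  by case: l H {IHl} => [|r l] /= H; lia.
split.
- case=> r [its [Hp]]; case: Hp Hx => {x r its} [s _ _|y Hy Hx
    |z1 z2 v1 v2 H1 H2 Hv Hx|n i z Hz Hx|n i args Ha Hx].
  + by exists (QConst v); rewrite /s; case: (v).
  + by move=> /(Cnot _ _ Hx Hy) /sem_not.
  + by move=> /(Cand _ _ _ _ Hx H1 H2) [A B]; rewrite -Hv; apply: sem_and.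
  + by move=> /(Cex _ _ _ Hx Hz).
  + move=> /(Capp _ _ _ Ha Hx) [/sem_args [phis [E1 E2 E3 E4]] H2 H3 H4].
    exists (QApp n i phis); split.
    * by rewrite E1.
    * by rewrite /= E2 -(size_map enc) -E1 size_map H2 eqxx.
    * by rewrite /= H3.
    * by rewrite /= -E4.
- case=> phi; case: phi => [b|n i phis|a b|a|n i a] [Ex H1 H2 H3]; rewrite Ex in Hx *.
  + exists RWin, [:: IO (if b then SOne else SZero)]; split; last exact: gwin_SWin.
    by move: H3 => /= <-; case: (b) (ParseConst b).
  + set args := [seq (enc p, qeval (ienv e) p) | p <- phis].
    have E1 : map fst args = map enc phis by rewrite /args -map_comp.
    have E2 : map snd args = map (qeval (ienv e)) phis by rewrite /args -map_comp.
    have Eenc : enc (QApp n i phis) =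
        SF :: vname n i ++ SLP :: sep_comma (map fst args) ++ [:: SRP].
      by rewrite E1.
    have Ha : all (fun p => ~~ nilp p.1) args.
      by rewrite /args all_map; elim: (phis) => //= p l ->; rewrite enc_neq0.
    rewrite Eenc in Hx *.
    eexists; eexists; split; first exact: (ParseApp v n i Ha).
    move: H1 H2 H3 => /= /andP [/eqP Hn Hw] /andP [Hb Hc] Hv.
    apply/(Capp _ _ _ Ha Hx); split=> //.
    * by apply/sem_args; exists phis.
    * by rewrite /args size_map.
    * by rewrite E2.
  + move: H1 H2 H3 => /= /andP [A1 B1] /andP [A2 B2] Hv.
    eexists; eexists; split; first exact: (ParseAnd (enc_neq0 a) (enc_neq0 b) Hv).
    apply/(Cand _ _ _ _ Hx (enc_neq0 a) (enc_neq0 b)).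
    by split; [exists a|exists b].
  + eexists; eexists; split; first exact: (ParseNot v (enc_neq0 a)).
    apply/(Cnot _ _ Hx (enc_neq0 a)); exists a; split=> //.
    by rewrite -H3 /= negbK.
  + eexists; eexists; split; first exact: (ParseEx v n i (enc_neq0 a)).
    by apply/(Cex _ _ _ Hx (enc_neq0 a)); exists (QEx n i a).
Qed.

(** * Resource bounds *)

Definition wt (P : lab -> bool) (g : cell) : nat := if g is inl (_, l, _) then P l else 0.
Definition cnt (P : lab -> bool) (u : seq cell) : nat := sumn (map (wt P) u).
Definition ntext := cnt xpredT.
Definition nseg := cnt (fun l => if l is Seg _ _ then true else false).
Definition nnm := cnt (fun l => if l is Nm then true else false).
Definition nbnd := cnt (fun l => if l is Bnd then true else false).
(** [Bnd] is included so that this count still bounds [nbnd] when the selection by arguments hands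
    over to the name lookup. *)
Definition nlook := cnt (fun l => match l with Seg true _ | Bnd => true | _ => false end).

Lemma cnt_cat P u v : cnt P (u ++ v) = cnt P u + cnt P v.
Proof. by rewrite /cnt map_cat sumn_cat. Qed.

Lemma cnt_le (P Q : lab -> bool) u : (forall l, P l -> Q l) -> cnt P u <= cnt Q u.
Proof.
move=> H; elim: u => //= g u IH; apply: leq_add IH.
case: g => [[[s l] c]|t] //=; by case: (P l) (H l) => // ->.
Qed.

Lemma run_potential (S : Type) (d : S -> cell -> list (S * cell)) (f : S -> nat) (P : lab -> bool) :
  (forall q g q' g', List.In (q', g') (d q g) -> wt P g' + f q' <= wt P g + f q) ->
  forall q u q' u', run d q u q' u' -> cnt P u' + f q' <= cnt P u + f q.
Proof.
move=> H q u; elim: u q => [|g u IH] q q' u' /=; first by case=> -> ->.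
case=> q1 [g' [w' [/H H1 /IH H2 ->]]]; rewrite /cnt /= -/(cnt P u) -/(cnt P w').
by lia.
Qed.

Definition mstarted (m : mst) : nat := if m is M0 then 0 else 1.

(** The first symbol of the claimed formula loses its segment label and no cell gains one. The
    potential [mstarted] charges this loss to the step that leaves [M0]. *)
Lemma main_nseg u m u' r : run mdelta M0 u m u' -> List.In r (mresult m) -> nseg u' < nseg u.
Proof.
move=> Hr Hm; have : mstarted m = 1 by case: m Hm {Hr}.
suff H : nseg u' + mstarted m <= nseg u + mstarted M0 by rewrite /= in H; lia.
apply: (run_potential (f := mstarted)) Hr => {u m u' r Hm} m g m' g'.
case: g => [[[s l] c]|t]; last first.
  move=> /List.in_map_iff [m1 [[<- <-] H]] /=.
  by case: m H => [|b|a b n|[] []|b|r] //= => [|b|] [<-|//].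
case: l => [|f b| | |].
2: { move=> /List.in_map_iff [[m1 l] [[<- <-] H]]; rewrite /wt /=.
     have : mstarted m1 = 1 /\ (m = M0 -> l = Out).
       case: m H => [|b0|a b0 n|st rk|b0|r] //=.
       - move=> /List.in_map_iff [m2 [[<- <-] H]]; split=> //.
         by case: s H => //=; try (case: (b)) => //; try case=> [<-|//]; try case=> [<-|] //.
       - by case: s => // -[[<- _]|//].
       - case: (nstep n s) => [[y|]|] //; first by case=> [[<- _]|//].
         move=> /List.in_map_iff [m2 [[<- _] H]]; split=> //.
         by move: H; rewrite /mname_end; case: a => /= -[<-|] // [<-|] // [<-|].
       - case=> [[<- _]|] //; case: st => // /List.in_map_iff [m2 [[<- _] H]]; split=> //.
         by case: rk s H => [x|[] [] |x|x|x y] [] //=; try (by case=> [<-|//]);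
           case=> [<-|] // [<-|].
       - by case: s => // -[[<- _]|//].
     by case=> E E'; rewrite E; case: m E' {H} => [E'|*|*|*|*|*]; rewrite ?E' //=; case: (l). }
all: move=> /List.in_map_iff [m1 [[<- <-] H]]; rewrite /wt /=.
all: by case: m H => [|b|a b n|[] [b|a b|b|b|a b]|b|r] //= [<-|//].
Qed.

Lemma pick_nseg p u p' u' : run pdelta p u p' u' -> nseg u' <= nseg u.
Proof.
move=> H; suff : nseg u' + 0 <= nseg u + 0 by rewrite !addn0.
apply: (run_potential (f := fun _ : pst => 0)) H => {p u p' u'} p g p' g'.
case: g => [[[s [|[] b| | |]] c]|t]; case: p => /= H;
  by repeat (case: H => [[_ <-]|H] //).
Qed.

Lemma gen_nseg p u p' u' : run gdelta p u p' u' -> nseg u' <= nseg u.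
Proof.
move=> H; suff : nseg u' + 0 <= nseg u + 0 by rewrite !addn0.
apply: (run_potential (f := fun _ : gst => 0)) H => {p u p' u'} p g p' g'.
by case: g => [[[s l] c]|t]; case: p => [|b] /= [[_ <-]|//].
Qed.

Lemma count_nnm u b p u' : run cdelta (C0, false) u (CC b, p) u' -> nnm u' < nnm u.
Proof.
pose f (q : cst * bool) := match q.1 with CB _ | CC _ => 1 | _ => 0 end.
move=> H; suff : nnm u' + f (CC b, p) <= nnm u + f (C0, false) by rewrite /f /= addn0 addn1.
apply: (run_potential (f := f)) H => {u b p u'} [[q p]] g [q' p'] g'.
case: g => [[[s [|[] b| | |]] c]|t]; rewrite /cdelta /f.
4: { by move=> /List.in_map_iff [[a l] [[<- _ <-] H]]; move: H => /=; case: q => [||x|x|];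
     case: s => //= H; repeat (case: H => [[<- <-]|H] //). }
all: case: q => [||x|x|] //= [[<- _ <-]|//] //=; by case: (p).
Qed.

Definition foundl (q : option bool * bool) : nat := if q.1 is Some _ then 1 else 0.

Lemma look_nlook q u q' u' : run ldelta q u q' u' -> nlook u' + foundl q' <= nlook u + foundl q.
Proof.
apply: run_potential => {q u q' u'} [[q p]] g [q' p'] g'.
case: g => [[[s [|[] b| | |]] c]|[|b|]]; rewrite /foundl; case: q => [x|] /=;
  by case=> [[<- _ <-]|//].
Qed.

Lemma lookup_nbnd x u x' u' : run xdelta x u x' u' -> nbnd u' + xlive x' <= nbnd u + xlive x.
Proof.
apply: (run_potential (f := fun x => xlive x : nat)) => {x u x' u'} x g x' g'.
case: x => [a|a|a s|a s d|a t|a t]; case: g => [[[s' [|[] b| | |]] c]|[|b|]] //=;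
  try (by case=> [[<- <-]|//]).
- by case=> [[<- <-]|[[<- <-]|//]].
- by case: eqP => // _; case: is_lp => /= -[[<- <-]|//].
- by case: is_lp => /= -[[<- <-]|//].
all: by case: d => /=; try (case: eqP => //= _); case=> [[<- <-]|//].
Qed.

Definition istext (g : cell) : bool := if g is inl _ then true else false.

Lemma gdelta_istext q g q' g' : List.In (q', g') (gdelta_all q g) -> istext g' = istext g.
Proof.
case: q => [m|x|p|k p|p|v p|v x|] //=; try (move=> /List.in_map_iff [[a b] [[_ <-] /= H]]; move: H).
- by case: g => [[[s [|f w| | |]] c]|t] /List.in_map_iff [? [[_ <-] _]].
- by case=> // -[_ <-].
- by case: g => [[[s [|[] w| | |]] c]|t]; case: p => /= H; repeat (case: H => [[_ <-]|H] //).
- by case: g => [[[s l] c]|t]; case: p => [|w] /= [[_ <-]|//].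
- case: g => [[[s [|[] w| | |]] c]|t] /=; try (by case=> [[_ <-]|//]).
  + by case: p.1 => [||y|y|] //= [[_ <-]|//].
  + by move=> /List.in_map_iff [? [[_ <-] _]].
- by case: g => [[[s [|[] w| | |]] c]|[|w|]] /=; case: p.1 => [y|] /= [[_ <-]|//].
- case: x => [y|y|y s|y s d|y t|y t]; case: g => [[[s' [|[] w| | |]] c]|[|w|]] //=;
    try (by case=> [[_ <-]|//]).
  + by case=> [[_ <-]|[[_ <-]|//]].
  + by case: eqP => // _; case: is_lp => /= -[[_ <-]|//].
  all: by case: d => /=; try (case: eqP => //= _); case=> [[_ <-]|//].
Qed.

Lemma ntext_swp q u q' u' : @swp game q u q' u' -> ntext u' = ntext u.
Proof.
case=> q1 [v [o [Hr Hf ->]]]; rewrite /ntext cnt_cat.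
have -> : cnt xpredT (oseq o) = 0.
  case: q1 Hf {Hr} => [m|x|p|k [|b]|[[||b|b|] p]|w [[b|] p]|w [a|a|a s|a s d|a t|a t]|] //=.
  - by move=> /List.in_map_iff [r [[_ <-] _]].
  - by case: x => [b|] [[_ <-]|] //; repeat (case=> [[_ <-]|] //).
  - by case: p => //= -[[_ <-]|//].
  - by case=> [[_ <-]|//].
  - by case=> [[_ <-]|[[_ <-]|//]].
  - by case: eqP => // _ [[_ <-]|//].
  - by case=> [[_ <-]|//].
  - by case=> [[_ <-]|//].
  - by case=> [[_ <-]|//].
  - by case: eqP => // _ [[_ <-]|//].
  - by case=> [[_ <-]|//].
  - by case=> [[_ <-]|//].
rewrite addn0; elim: u q v Hr {Hf} => [|g u IH] q v /=; first by case=> _ ->.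
case=> a [g' [w' [/gdelta_istext Hg /IH E ->]]]; rewrite /cnt /= -!/(cnt _ _) E.
by case: g g' Hg => [[[? ?] ?]|?] [[[? ?] ?]|?].
Qed.

Definition cvalu (u : seq cell) : nat :=
  foldr (fun (g : cell) n => if g is inl (_, _, c) then n.*2 + (c : bool) else n) 0 u.

Lemma ntext_cons g u : ntext (g :: u) = istext g + ntext u.
Proof. by case: g => [[[s l] c]|t]. Qed.

Lemma cvalu_lt u : cvalu u < 2 ^ ntext u.
Proof.
elim: u => //= -[[[s l] c]|t] u IH; rewrite ntext_cons //= add1n expnS.
by case: c => /=; lia.
Qed.

Lemma cvalu_incr b u q u' : run gdelta (Gc b) u q u' ->
  exists b', q = Gc b' /\ cvalu u' + b' * 2 ^ ntext u = cvalu u + b.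
Proof.
elim: u b u' => [|[[[s l] c]|t] u IH] b u' /=.
- by case=> -> ->; exists b; rewrite muln1.
- case=> q1 [g' [w' [[[<- <-]|//] /IH [b' [-> H]] ->]]]; exists b'; split=> //.
  rewrite ntext_cons /= add1n expnS; move: H.
  by case: (b) (c) => [] [] /=; lia.
- case=> q1 [g' [w' [[[<- <-]|//] /IH [b' [-> H]] ->]]]; exists b'; split=> //.
Qed.

Lemma cvalu_table u t : cvalu (u ++ [:: inr t]) = cvalu u.
Proof. by elim: u => //= -[[[s l] c]|t'] u ->. Qed.

Definition sweep_start (q : gstate) : bool :=
  match q with
  | SM M0 | SQ _ | SP P0 | SG _ G0 | SG _ (Gc true) | SC (C0, false)
  | SL _ (None, false) | SX _ (X0 _) | SWin => true
  | _ => false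
  end.

(* Bounds the number of remaining sweeps. *)
Definition mu (q : gstate) (u : seq cell) : nat :=
  let N := ntext u in
  let base := nseg u * (2 ^ N + 4) + (N.*2 + 2) in
  match q with
  | SM _ => base
  | SP _ => base + 1
  | SQ _ => base + 2
  | SG _ (Gc _) => base + 2 + (2 ^ N - cvalu u)
  | SG _ G0 => base + 3 + 2 ^ N
  | SC _ => nnm u + 1
  | SL _ _ => nlook u + 2
  | SX _ _ => nbnd u + 1
  | SWin => 0
  end.

(* Bounds the number of remaining alternations. *)
Definition al (q : gstate) (u : seq cell) : nat :=
  match q with
  | SM _ => (nseg u).*2 + 1
  | SQ _ | SP _ | SG false _ => (nseg u).*2 + 2
  | SG true _ => (nseg u).*2 + 3
  | SC _ | SL _ _ | SX _ _ => 1
  | SWin => 0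
  end.

Definition descent (q : gstate) u (q' : gstate) u' : Prop :=
  [/\ sweep_start q', mu q' u' < mu q u
    & al q' u' + ~~ stkind_eqb (gkind q') (gkind q) <= al q u].

(** One round takes at most one sweep of [SM], one for the head of a table, [2 ^ N] for its bits,
    and one each of [SQ] and [SP]: hence the factor [2 ^ N + 4] per segment label in [mu]. The
    summand [2N + 2] pays for a final arity check or lookup. A round changes the player at most
    twice, hence twice [nseg] in [al]. *)
Lemma sweep_descent q u q' u' : sweep_start q -> @swp game q u q' u' -> descent q u q' u'.
Proof.
move=> Hq Hs; have HN := ntext_swp Hs.
case: Hs => q1 [v [o [Hr Hf Eu']]]; rewrite /descent.
case: q Hq Hr => [m|x|p|k p|p|w p|w x|] // Hq Hr.
- case: m Hq Hr => // _ /(run_embed (f := SM) (d := mdelta)) [] // m [E Hr].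
  subst q1; case/List.in_map_iff: Hf => r [[E1 E2] Hf]; subst o q'.
  rewrite cats0 in Eu'; subst u'; have Hn := main_nseg Hr Hf.
  have : nseg v * (2 ^ ntext u + 4) + (2 ^ ntext u + 4) <= nseg u * (2 ^ ntext u + 4).
    by rewrite -mulSnr leq_mul2r Hn orbT.
  by case: r Hf {Hr} => [|x|[]] _ Hm; split=> //=; rewrite ?HN; lia.
- have [E1 E2] := proj1 (@run_id _ _ gdelta_all (SQ x) u q1 v (fun _ => erefl)) Hr.
  subst q1 v; have Eo : o = None /\
      (q' = SP P0 \/ q' = SC (C0, false) \/ exists b, q' = SL b (None, false)).
    case: Hf => [[<- <-]|]; first by auto.
    by case: x {Hq Hr} => // b [[<- <-]|[[<- <-]|//]]; eauto.
  case: Eo => Eo Hq'; subst o; rewrite cats0 in Eu'; subst u'.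
  have H1 : nnm u <= ntext u by apply: cnt_le.
  have H2 : nlook u <= ntext u by apply: cnt_le.
  by case: Hq' => [->|[->|[b ->]]]; split=> //=; lia.
- case: p Hq Hr => // _ /(run_embed (f := SP) (d := pdelta)) [] // p [E Hr].
  subst q1; have Hn := pick_nseg Hr.
  have [Eq Eo] : q' = SM M0 /\ o = None by case: p Hf {Hr} => //= -[[<- <-]|//].
  subst q' o; rewrite cats0 in Eu'; subst u'.
  have : nseg v * (2 ^ ntext u + 4) <= nseg u * (2 ^ ntext u + 4) by rewrite leq_mul2r Hn orbT.
  by split=> //=; rewrite ?HN; lia.
- case/(run_embed (f := SG k) (d := gdelta)): Hr => // p' [E Hr]; subst q1.
  have Hn := gen_nseg Hr.
  have Hm : nseg v * (2 ^ ntext u + 4) <= nseg u * (2 ^ ntext u + 4) by rewrite leq_mul2r Hn orbT.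
  have Hnt t : nseg (v ++ [:: inr t]) = nseg v by rewrite /nseg cnt_cat addn0.
  case: p Hq Hr => [|[]] // _ Hr.
  + have [E1 E2] := proj1 (@run_id _ _ gdelta G0 u p' v (fun _ => erefl)) Hr.
    subst p' v; case: Hf => [[E1 E2]|//]; subst q' o u'.
    have := HN; rewrite /= => HN'; split=> //; rewrite /= ?HN' ?Hnt ?stkind_eqbb /=; first by lia.
    by rewrite addn0; case: (k); rewrite /= ?Hnt; lia.
  + have [b' [Ep Hc]] := cvalu_incr Hr; subst p'.
    have [t [Eq Eo]] : exists t,
        q' = (if b' then SQ None else SG k (Gc true)) /\ o = Some (inr (TB t)).
      by case: Hf => [[<- <-]|[[<- <-]|//]]; eexists.
    subst q' o u'; have Hlt := cvalu_lt u.
    case: b' Hc {Hf Hr} => /= Hc; split=> //=; rewrite ?HN ?Hnt ?cvalu_table.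
    * by lia.
    * by case: (k) => /=; lia.
    * have := cvalu_lt (v ++ [:: inr (TB t)]); rewrite cvalu_table HN; lia.
    * by rewrite stkind_eqbb; case: (k); rewrite /= ?Hnt; lia.
- case: p Hq Hr => -[] // [] // _ /(run_embed (f := SC) (d := cdelta)) [] //.
  move=> [[||b|b|] c] [E Hr]; subst q1 => //.
  + move: Hf => /=; case: eqP => // _ [[E1 E2]|//]; subst q' o; rewrite cats0 in Eu'; subst u'.
    by have := count_nnm Hr; split=> //=; lia.
  + by case: Hf => [[<- _]|//]; split=> //=; lia.
- case: p Hq Hr => -[] // [] // _ /(run_embed (f := SL w) (d := ldelta)) [] //.
  move=> [[b|] c] [E Hr]; subst q1.
  + case: Hf => [[E1 E2]|//]; subst q' o; rewrite cats0 in Eu'; subst u'.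
    by have := look_nlook Hr; rewrite /foundl /= => H; split=> //=; lia.
  + case: Hf => [[E1 E2]|//]; subst q' o; rewrite cats0 in Eu'; subst u'.
    have := look_nlook Hr; rewrite /foundl /= => H.
    have : nbnd v <= nlook v by apply: cnt_le => -[].
    by split=> //=; lia.
- case: x Hq Hr => // a _ /(run_embed (f := SX w) (d := xdelta)) [] // x [E Hr]; subst q1.
  have := lookup_nbnd Hr; rewrite /= addn0 => H.
  have [E|[a' [E [Eo Hx]]]] : q' = SWin \/ exists a', q' = SX w (X0 a') /\ o = None /\ xlive x.
    case: x Hf {Hr H} => [b|b|b s|b s d|b t|b t] //=.
    * by case: eqP => // _ [[<- _]|//]; left.
    * by case=> [[<- <-]|//]; right; eexists.
    * by case=> [[<- <-]|//]; right; eexists.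
  + by subst q'; split=> //=; lia.
  + by subst q' o; rewrite cats0 in Eu'; subst u'; rewrite Hx in H; split=> //=; lia.
- by case: (u) Hr => [|g w] /=; [case=> E _; rewrite E in Hf|case=> ? [? [? []]]].
Qed.

Lemma sbnd_game n a q u : sweep_start q -> mu q u < n -> al q u <= a -> @sbnd game n a q u.
Proof.
elim: n a q u => // n IH a q u Hq Hmu Hal /=.
have Hpos : gkind q <> KAcc -> 0 < al q u.
  by case: q {Hq Hmu Hal} => [?|?|?|[] ?|?|? ?|? ?|] //=; lia.
have Hstep q' u' : @swp game q u q' u' ->
    sbnd n (if stkind_eqb (gkind q') (gkind q) then a else a.-1) q' u'.
  move=> /(sweep_descent Hq) [H1 H2 H3]; apply: IH => //; first by lia.
  by move: H3; case: ifP => _ /=; lia.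
by case: (gkind q) Hpos Hstep => // Hpos Hstep; split=> //; apply: leq_trans Hal; apply: Hpos.
Qed.

Definition inp (s : sym) : cell := tc (s, Seg false true).

Lemma gwin_init w : gwin (SM M0) (map inp w) <-> QBSF_lang w.
Proof.
have -> : gwin (SM M0) (map inp w) <-> gwin (SM M0) (word [:: IS w true] [::]).
  have Hp xf : map fst xf = w ->
      gwin (SM M0) [seq tc (p.1, Seg p.2 true) | p : sym * bool <- xf] <->
      exists r w', parses true M0 w r w' /\ gwin (gstart r) (map tc w').
    move=> <-; rewrite gwin_SM; split.
    - case=> m [u [r [H1 H2 H3]]].
      have [|w' [H4 E]] := proj1 (@run_parses true M0 xf [::] r u isT).
        by exists m; rewrite cats0.
      by exists r, w'; split=> //; rewrite E cats0 in H3.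
    - case=> r [w' [H1 H2]].
      have [|m [H3 H4]] := proj2 (@run_parses true M0 xf [::] r (map tc w' ++ [::]) isT).
        by exists w'.
      by exists m, (map tc w'), r; rewrite !cats0 in H3.
  have [xf [E1 E2]] := slabsE true w.
  have -> : word [:: IS w true] [::] = [seq tc (p.1, Seg p.2 true) | p : sym * bool <- xf].
    by rewrite /word /labs /= !cats0.
  rewrite (Hp xf E1) -(Hp [seq (s, false) | s <- w]); first by rewrite -map_comp.
  by rewrite -map_comp map_id.
rewrite (@game_correct (size w).+1 w true [::] [::] [::]) //; split.
- by case=> phi [E H1 H2 H3]; exists phi.
- by case=> phi [E [H1 [H2 H3]]]; exists phi.
Qed.

(** With [E = 2 ^ N], there are at most [10 E^2] sweeps of at most [24 E^2] steps each; 240 is the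
    product of the constants, and [E^4] is [2 ^ (4N)]. Finally [4N <= N^4 + 4], where the summand 4,
    required for [N = 1], causes the factor [2 ^ 4]. *)
Lemma sweeps_time N n : n = N * (2 ^ N + 4) + (N.*2 + 2) + 1 ->
  n * ((N + n).*2 + 2) <= 240 * 2 ^ 4 * 2 ^ (N ^ 4) + 240 * 2 ^ 4.
Proof.
move=> En; have HN : N < 2 ^ N by apply: ltn_expl.
have H1 : n <= 10 * (2 ^ N * 2 ^ N) by rewrite En; nia.
apply: leq_trans (leq_addr _ _).
apply: (@leq_trans (240 * 2 ^ (4 * N))).
  have -> : 2 ^ (4 * N) = 2 ^ N * 2 ^ N * (2 ^ N * 2 ^ N) by rewrite -!expnD; congr (2 ^ _); lia.
  set E := 2 ^ N in HN H1 *.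
  have H2 : (N + n).*2 + 2 <= 24 * (E * E) by nia.
  have := leq_mul H1 H2; set F := E * E => H3.
  by apply: leq_trans H3 _; lia.
rewrite -mulnA leq_mul2l /= -expnD leq_exp2l //.
by case: N {n En HN H1} => [|[|N]] //; rewrite !expnS expn0; nia.
Qed.

Theorem theorem4 : AEXP_poly QBSF_lang.
Proof.
exists 4, (@sweep_atm game inp (SM M0)), (240 * 2 ^ 4); split=> // w T.
have Ht : ntext (map inp w) = size w by elim: w {T} => //= s w; rewrite /ntext /cnt /= => ->.
have Hs : nseg (map inp w) = size w by elim: w {T Ht} => //= s w; rewrite /nseg /cnt /= => ->.
(* Initially every cell carries a segment label, so [al] is [2N + 1], which lies below [N ^ 4 + 4]
   for every [N]. *)
have Hb : @sbnd game (mu (SM M0) (map inp w) + 1) (size w ^ 4 + 4) (SM M0) (map inp w).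
  apply: sbnd_game; rewrite ?addn1 //= Hs.
  by case: (size w) => [|[|N]] //; rewrite !expnS expn0; nia.
have HT : (mu (SM M0) (map inp w) + 1) * ((size w + (mu (SM M0) (map inp w) + 1)).*2 + 2) <= T.
  by apply: sweeps_time; rewrite /mu Ht Hs.
have [H1 H2] := sweep_atm_correct Hb HT.
by split=> //; rewrite H2 gwin_init.
Qed.
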